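(* There is an isomorphism of categories between the category $\mathbf{\Sigma Lie}^{\mathrm{ev}}$ of summability Lie algebras with evaluations (arrows: strongly linear morphisms of algebras) and the category $\mathbf{\Pi Gr}^{\mathrm{ev}}$ of multipliability exponential groups with evaluations (arrows: strongly multiplicative homomorphisms of exponential groups). It is given by the mutually inverse functors $L\mapsto \mathrm{Gr}(L)$ and $\mathcal{G}\mapsto\mathrm{Lie}(\mathcal{G})$ described in the context, both of which send an arrow $\Phi$ to the same underlying map $\Phi$.
   Context: $k$ is a fixed associative, commutative, unital $\mathbb{Q}$-algebra. A number $m\in\mathbb{N}$ is identified with $\{0,\dots,m-1\}$. **Summability modules.** For a $k$-module $V$ and a set $I$, $V^{(I)}\subseteq V^I$ is the set of finitely supported maps. A summability structure on $V$ is a class $\Sigma=(\Sigma_I)_{I \text{ a set}}$ of partial maps $\Sigma_I: V^I\to V$, such that each $\operatorname{dom}\Sigma_I$ is a submodule of $V^I$, $\Sigma_I$ is $k$-linear on $\operatorname{dom}\Sigma_I$, and for all sets $I,J$: (SM1) $V^{(I)}\subseteq \operatorname{dom}\Sigma_I$ and $\Sigma_I v=\sum_{v(i)\neq 0}v(i)$ for $v\in V^{(I)}$. (SM2) If $\varphi:I\to J$ is a bijection and $v\in\operatorname{dom}\Sigma_J$, then $v\circ\varphi\in\operatorname{dom}\Sigma_I$ and $\Sigma_I(v\circ\varphi)=\Sigma_J v$. (SM3) If $I=\bigsqcup_{j\in J}I_j$ and $v\in\operatorname{dom}\Sigma_I$, then $v\upharpoonright I_j\in\operatorname{dom}\Sigma_{I_j}$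 for each $j$, $(\Sigma_{I_j}(v\upharpoonright I_j))_{j\in J}\in\operatorname{dom}\Sigma_J$, and $\Sigma_J(\Sigma_{I_j}(v\upharpoonright I_j))_{j\in J}=\Sigma_I v$. (SM4) If $I\cap J=\varnothing$ and $(v,w)\in\operatorname{dom}\Sigma_I\times\operatorname{dom}\Sigma_J$, then $v\sqcup w\in\operatorname{dom}\Sigma_{I\sqcup J}$. (SM5) If $v\in\operatorname{dom}\Sigma_I$ and $f_i:X_i\to k$ ($i\in I$) are functions with finite domains, then $(f_i(x)v(i))_{i\in I, x\in X_i}\in\operatorname{dom}\Sigma_{\{(i,x): i\in I, x\in X_i\}}$. Elements of $\operatorname{dom}\Sigma_I$ are called summable families. A $k$-linear map $\phi$ between summability modules is strongly linear if for every summable $v:I\to V$, $\phi\circ v$ is summable and $\Sigma_I(\phi\circ v)=\phi(\Sigma_I v)$. **Algebras.** An algebra is a $k$-module with a $k$-bilinear product. A summability algebra is an algebra $A$ with a summability structure such that for all summable $a:I\to A$, $b:J\to A$, the family $(a(i)\cdot b(j))_{(i,j)\in I\times J}$ is summable with sum $(\Sigma_I a)\cdot(\Sigma_J b)$. It is a summability Lie algebra if its underlying algebra is a Lie algebra. A summability subalgebra is a subalgebra containing the sum of each of its families that is summable in the ambient algebra; it carries the restricted summability structure. **Formal series.** For a set $I$, $k\langle\!\langle I\rangle\!\rangle$ is the algebra of formal power series in non-commuting associative variables $X_i$, $i\in I$: all functions from the free monoid $I^\star$ to $k$, with the Cauchy product; a family $(P_j)_j$ is summable iff each word lies in the support of finitely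 many $P_j$, with pointwise sum. $k\langle\!\langle I\rangle\!\rangle_0$ is the set of series with zero constant term. Set $\exp(P)=\sum_n P^n/n!$ and $\log(1+P)=\sum_n \frac{(-1)^n}{n+1}P^{n+1}$ for $P\in k\langle\!\langle I\rangle\!\rangle_0$. $\mathrm{Lie}\langle\!\langle I\rangle\!\rangle$ is the smallest summability subalgebra of the summability Lie algebra $(k\langle\!\langle I\rangle\!\rangle,[P,Q]=PQ-QP)$ containing all $X_i$, $i\in I$. **Lie evaluations.** A summability Lie algebra $L$ has evaluations if for every set $I$ and every summable $a:I\to L$ there is a (necessarily unique) strongly linear Lie algebra morphism $\mathrm{ev}^{\mathrm{Lie}}_a:\mathrm{Lie}\langle\!\langle I\rangle\!\rangle\to L$ with $\mathrm{ev}^{\mathrm{Lie}}_a(X_i)=a(i)$ for all $i$. **Exponential groups.** An exponential group (over $k$) is a group $\mathcal{G}$ with a map $k\times\mathcal{G}\to\mathcal{G}$, $(\lambda,f)\mapsto f^\lambda$ such that $f^1=f$, $f^{\lambda+\mu}=f^\lambda f^\mu$, $(f^\lambda)^\mu=f^{\lambda\mu}$, $(fg)^\lambda=f^\lambda g^\lambda$ whenever $fg=gf$, and $(fgf^{-1})^\lambda=fg^\lambda f^{-1}$. Homomorphisms are group homomorphisms commuting with all power maps. **Multipliability.** $\mathbf{Los}$ is the class of linearly ordered sets $I=(\underline I,<)$; $I^*$ is $I$ with reversed order; $i^+=\{j\in I: j>i\}$. Write $I=\coprod_J(I_j)_{j}$ if $J\in\mathbf{Los}$, $\underline I=\bigcup_j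 \underline{I_j}$ and all elements of $I_j$ are $<$ all elements of $I_{j'}$ whenever $j<j'$ in $J$. A multipliability structure on an exponential group $\mathcal{G}$ is a class of partial maps $\Pi_I:\mathcal{G}^{\underline I}\to\mathcal{G}$ ($I\in\mathbf{Los}$) such that for all $I,J\in\mathbf{Los}$: (MG1) $\operatorname{dom}\Pi_I$ is a subgroup of $\mathcal{G}^{\underline I}$; for $f,g\in\operatorname{dom}\Pi_I$, the family $f[g]:=(\Pi_{(i^+)^*}(f^{-1}\upharpoonright i^+)\cdot g(i)\cdot\Pi_{i^+}(f\upharpoonright i^+))_{i\in I}$ is in $\operatorname{dom}\Pi_I$ and $\Pi_I(f\cdot g)=(\Pi_I f)(\Pi_I f[g])$. (MG2) Every finitely supported $g$ is in $\operatorname{dom}\Pi_I$, and if $\operatorname{supp}g=\{i_1<\dots<i_n\}$, then $\Pi_I g=g(i_1)\cdots g(i_n)$. (MG3) If $\varphi:I\to J$ is an order isomorphism and $g\in\operatorname{dom}\Pi_J$, then $g\circ\varphi\in\operatorname{dom}\Pi_I$ and $\Pi_I(g\circ\varphi)=\Pi_Jg$. (MG4) If $I=\coprod_J(I_j)_j$ and $g\in\operatorname{dom}\Pi_I$, then $g\upharpoonright I_j\in\operatorname{dom}\Pi_{I_j}$ for all $j$, $(\Pi_{I_j}(g\upharpoonright I_j))_j\in\operatorname{dom}\Pi_J$ and $\Pi_J((\Pi_{I_j}(g\upharpoonright I_j))_j)=\Pi_Ig$. (MG5) If $I=I_1\amalg I_2$ and $(g,h)\in\operatorname{dom}\Pi_{I_1}\times\operatorname{dom}\Pi_{I_2}$,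 then $g\sqcup h\in\operatorname{dom}\Pi_I$. (MG6) If $g\in\operatorname{dom}\Pi_I$ and $g_0\in\mathcal{G}$, then $(g_0g(i)g_0^{-1})_i\in\operatorname{dom}\Pi_I$ with product $g_0(\Pi_Ig)g_0^{-1}$. (MEG7) If $g\in\operatorname{dom}\Pi_I$, then $g^{-1}=(g(i)^{-1})_i\in\operatorname{dom}\Pi_{I^*}$ and $\Pi_{I^*}g^{-1}=(\Pi_Ig)^{-1}$. (MEG8) If $g\in\operatorname{dom}\Pi_I$ and $f_i:X_i\to k$ ($i\in I$) have finite domains, then $(g(i)^{f_i(x)})_{i\in I,x\in X_i}$ is multipliable (for any linear ordering of the index set). (MEG9) For each linear ordering $\triangleleft$ on $\underline I$, $\operatorname{dom}\Pi_I=\operatorname{dom}\Pi_{(\underline I,\triangleleft)}$. Elements of $\operatorname{dom}\Pi_I$ are called multipliable families (this depends only on the index set, by MEG9). A map $\Phi:\mathcal{G}\to\mathcal{H}$ is strongly multiplicative if for $g\in\operatorname{dom}\Pi_I$, $\Phi\circ g$ is multipliable and $\Pi_I(\Phi\circ g)=\Phi(\Pi_Ig)$. **Group evaluations.** $1+k\langle\!\langle I\rangle\!\rangle_0$ is an exponential group under the product and $Q^\lambda=\exp(\lambda\log Q)$, with multipliability structure: $(Q_j)_{j\in \underline J}$ is multipliable iff $(Q_j-1)_j$ is summable, and then $\Pi_J(Q_j)_j=\sum_{j_1<\dots<j_n}(Q_{j_1}-1)\cdots(Q_{j_n}-1)$ (sum over all finite increasing sequences in $J$, including the empty one). $\mathrm{Gr}\langle\!\langle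 I\rangle\!\rangle:=\exp(\mathrm{Lie}\langle\!\langle I\rangle\!\rangle)$ is an exponential subgroup closed under these products, with the restricted structure. A multipliability exponential group $\mathcal{G}$ has evaluations if for every set $I$ and multipliable $f:I\to\mathcal{G}$ there is a (unique) strongly multiplicative exponential group homomorphism $\mathrm{ev}^{\mathrm{Gr}}_f:\mathrm{Gr}\langle\!\langle I\rangle\!\rangle\to\mathcal{G}$ with $\mathrm{ev}_f^{\mathrm{Gr}}(\exp(X_i))=f(i)$ for all $i$. **The functors.** For $L\in\mathbf{\Sigma Lie}^{\mathrm{ev}}$, $\mathrm{Gr}(L)$ is the set $L$ with $\operatorname{dom}\Pi_I=\operatorname{dom}\Sigma_{\underline I}$ and $\Pi_Ia=\mathrm{ev}^{\mathrm{Lie}}_a(\log(\Pi_I(\exp(X_i))_{i\in I}))$ for $I\in\mathbf{Los}$, group law $a*b=\Pi_{(2,<)}(a,b)=\mathrm{ev}^{\mathrm{Lie}}_{(a,b)}(\log(\exp(X_0)\exp(X_1)))$, identity $0$, and $a^\lambda=\lambda a$. For $\mathcal{G}\in\mathbf{\Pi Gr}^{\mathrm{ev}}$, $\mathrm{Lie}(\mathcal{G})$ is the set $\mathcal{G}$ where a family $b:J\to\mathcal{G}$ is summable iff it is multipliable, $\Sigma_Jb=\mathrm{ev}^{\mathrm{Gr}}_b(\exp(\sum_{j\in J}X_j))$, $a+b=\mathrm{ev}^{\mathrm{Gr}}_{(a,b)}(\exp(X_0+X_1))$, $[a,b]=\mathrm{ev}^{\mathrm{Gr}}_{(a,b)}(\exp([X_0,X_1]))$,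 $\lambda a=a^\lambda$, and zero element $1$. *)

(* Defs.v *)
From mathcomp Require Import all_boot all_order all_algebra.
From mathcomp Require Import all_classical.
From Stdlib Require Import Sorted.

Set Implicit Arguments.
Unset Strict Implicit.
Unset Printing Implicit Defensive.

Import GRing.Theory.
Local Open Scope ring_scope.

(* Conventions.
   - A set is a type. A Q-algebra k is a commutative ring, possibly zero, with
     a ring morphism q : rat -> k. (MathComp's algebras exclude the zero ring.)
   - A partial map Sigma_I : V^I -> V is encoded by its graph: [sum v s] means
     that v is in the domain and that Sigma_I v = s; single-valuedness is an
     axiom of the structure.
   - The algebraic structures are unbundled (carrier and operations on one
     side, axioms on the other) rather than MathComp instances, because an
     isomorphism of categories is about equality of objects: a MathComp
     instance also records a choice operator on its carrier. *)

Definition the (T : Type) (x0 : T) (P : T -> Prop) : T :=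
  if pselect (exists x, P x) is left ex then projT1 (cid ex) else x0.

Lemma sval_eq (T : Type) (P : T -> Prop) (x y : {t : T | P t}) :
  sval x = sval y -> x = y.
Proof. by case: x y => [x px] [y py] /=; exact: eq_exist. Qed.

(** * Summability algebras *)

Record salg (k : comPzRingType) := SAlg {
  sa_car :> Type;
  sa_zero : sa_car;
  sa_add : sa_car -> sa_car -> sa_car;
  sa_opp : sa_car -> sa_car;
  sa_scale : k -> sa_car -> sa_car;
  sa_mul : sa_car -> sa_car -> sa_car;
  sa_sum : forall I : Type, (I -> sa_car) -> sa_car -> Prop }.

Arguments sa_zero {k} s.

Definition summable (k : comPzRingType) (A : salg k) (I : Type) (v : I -> A) :=
  exists s, sa_sum v s.

Record is_module (k : comPzRingType) (A : salg k) : Prop := IsModule {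
  sa_addA : associative (@sa_add k A);
  sa_addC : commutative (@sa_add k A);
  sa_add0 : left_id (sa_zero A) (@sa_add k A);
  sa_addN : left_inverse (sa_zero A) (@sa_opp k A) (@sa_add k A);
  sa_scaleA : forall (a b : k) (x : A),
    sa_scale a (sa_scale b x) = sa_scale (a * b) x;
  sa_scale1 : forall x : A, sa_scale 1 x = x;
  sa_scaleDr : forall (a : k) (x y : A),
    sa_scale a (sa_add x y) = sa_add (sa_scale a x) (sa_scale a y);
  sa_scaleDl : forall (a b : k) (x : A),
    sa_scale (a + b) x = sa_add (sa_scale a x) (sa_scale b x) }.

Record is_bilinear (k : comPzRingType) (A : salg k) : Prop := IsBilinear {
  sa_mulDl : forall x y z : A,
    sa_mul (sa_add x y) z = sa_add (sa_mul x z) (sa_mul y z);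
  sa_mulDr : forall x y z : A,
    sa_mul x (sa_add y z) = sa_add (sa_mul x y) (sa_mul x z);
  sa_mulZl : forall (a : k) (x y : A),
    sa_mul (sa_scale a x) y = sa_scale a (sa_mul x y);
  sa_mulZr : forall (a : k) (x y : A),
    sa_mul x (sa_scale a y) = sa_scale a (sa_mul x y) }.

(* In [sm3] the pieces of the partition may be empty. Disjoint unions are sum
   types in [sm4]; by [sm2] this covers disjoint subsets. *)
Record is_summability (k : comPzRingType) (A : salg k) : Prop :=
  IsSummability {
  sum_fun : forall (I : Type) (v : I -> A) (s t : A),
    sa_sum v s -> sa_sum v t -> s = t;
  sum_zero : forall I : Type, sa_sum (fun _ : I => sa_zero A) (sa_zero A);
  sum_add : forall (I : Type) (v w : I -> A) (s t : A),
    sa_sum v s -> sa_sum w t ->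
    sa_sum (fun i => sa_add (v i) (w i)) (sa_add s t);
  sum_scale : forall (I : Type) (a : k) (v : I -> A) (s : A),
    sa_sum v s -> sa_sum (fun i => sa_scale a (v i)) (sa_scale a s);
  sm1 : forall (I : Type) (v : {classic I} -> A),
    finite_set [set i | v i <> sa_zero A]%classic ->
    sa_sum v
      (\big[@sa_add k A/sa_zero A]_(i \in [set: {classic I}]%classic) v i);
  sm2 : forall (I J : Type) (phi : I -> J) (v : J -> A) (s : A),
    bijective phi -> sa_sum v s -> sa_sum (v \o phi) s;
  sm3 : forall (I J : Type) (P : J -> I -> Prop) (v : I -> A) (s : A),
    (forall i, exists! j, P j i) -> sa_sum v s ->
    exists w : J -> A,
      (forall j, sa_sum (fun i : {i : I | P j i} => v (sval i)) (w j)) /\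
      sa_sum w s;
  sm4 : forall (I J : Type) (v : I -> A) (w : J -> A),
    summable v -> summable w ->
    summable (fun x : I + J => match x with inl i => v i | inr j => w j end);
  sm5 : forall (I : Type) (X : I -> finType) (f : forall i, X i -> k)
      (v : I -> A),
    summable v ->
    summable (fun p : {i : I & X i} =>
      sa_scale (f (projT1 p) (projT2 p)) (v (projT1 p))) }.

Record is_salg (k : comPzRingType) (A : salg k) : Prop := IsSAlg {
  salg_module : is_module A;
  salg_bilinear : is_bilinear A;
  salg_summability : is_summability A;
  salg_sum_mul : forall (I J : Type) (a : I -> A) (b : J -> A) (s t : A),
    sa_sum a s -> sa_sum b t ->
    sa_sum (fun p : I * J => sa_mul (a p.1) (b p.2)) (sa_mul s t) }.

Record is_slie (k : comPzRingType) (A : salg k) : Prop := IsSLie {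
  slie_salg : is_salg A;
  slie_alt : forall x : A, sa_mul x x = sa_zero A;
  slie_jacobi : forall x y z : A,
    sa_add (sa_mul x (sa_mul y z))
      (sa_add (sa_mul y (sa_mul z x)) (sa_mul z (sa_mul x y))) = sa_zero A }.

Record salg_hom (k : comPzRingType) (A B : salg k) (phi : A -> B) : Prop :=
  SAlgHom {
  salg_homD : forall x y, phi (sa_add x y) = sa_add (phi x) (phi y);
  salg_homZ : forall (a : k) x, phi (sa_scale a x) = sa_scale a (phi x);
  salg_homM : forall x y, phi (sa_mul x y) = sa_mul (phi x) (phi y);
  salg_hom_sum : forall (I : Type) (v : I -> A) (s : A),
    sa_sum v s -> sa_sum (phi \o v) (phi s) }.

Record is_subsalg (k : comPzRingType) (A : salg k) (S : A -> Prop) : Prop :=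
  IsSubSAlg {
  subsalg0 : S (sa_zero A);
  subsalgD : forall x y, S x -> S y -> S (sa_add x y);
  subsalgN : forall x, S x -> S (sa_opp x);
  subsalgZ : forall (a : k) x, S x -> S (sa_scale a x);
  subsalgM : forall x y, S x -> S y -> S (sa_mul x y);
  subsalg_sum : forall (I : Type) (v : I -> A) (s : A),
    (forall i, S (v i)) -> sa_sum v s -> S s }.

Definition sub_salg (k : comPzRingType) (A : salg k) (S : A -> Prop)
    (HS : is_subsalg S) : salg k := {|
  sa_car := {x : A | S x};
  sa_zero := exist S (sa_zero A) (subsalg0 HS);
  sa_add := fun x y =>
    exist S (sa_add (sval x) (sval y)) (subsalgD HS (svalP x) (svalP y));
  sa_opp := fun x => exist S (sa_opp (sval x)) (subsalgN HS (svalP x));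
  sa_scale := fun a x =>
    exist S (sa_scale a (sval x)) (subsalgZ HS a (svalP x));
  sa_mul := fun x y =>
    exist S (sa_mul (sval x) (sval y)) (subsalgM HS (svalP x) (svalP y));
  sa_sum := fun I v s => sa_sum (fun i : I => sval (v i)) (sval s) |}.

(** * Linearly ordered sets *)

(* Strict linear orders, in [Prop], on plain types: MathComp's [orderType]
   additionally carries a display and a choice operator. *)
Record is_linear (T : Type) (lt : T -> T -> Prop) : Prop := IsLinear {
  lin_irr : forall x, ~ lt x x;
  lin_trans : forall y x z, lt x y -> lt y z -> lt x z;
  lin_total : forall x y, lt x y \/ x = y \/ lt y x }.

Record los := Los {
  los_car :> Type;
  los_lt : los_car -> los_car -> Prop;
  los_lin : is_linear los_lt }.

Lemma rev_lin (I : los) : is_linear (fun i j : I => los_lt j i).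
Proof.
case: I => T lt [irr tr tot] /=; split=> //.
- by move=> y x z xy yz; exact: tr yz xy.
- by move=> x y; case: (tot x y) => [|[]]; auto.
Qed.

Definition rev_los (I : los) : los := Los (rev_lin I).

Lemma sub_lin (I : los) (P : I -> Prop) :
  is_linear (fun i j : {i : I | P i} => los_lt (sval i) (sval j)).
Proof.
case: I P => T lt [irr tr tot] /= P; split=> /=.
- by move=> x; exact: irr.
- by move=> y x z; exact: tr.
- move=> x y; case: (tot (sval x) (sval y)) => [|[]]; auto.
  by move=> e; right; left; exact: sval_eq.
Qed.

Definition sub_los (I : los) (P : I -> Prop) : los := Los (sub_lin P).

Definition sum_lt (I J : los) (x y : I + J) : Prop :=
  match x, y with
  | inl i, inl i' => los_lt i i'
  | inl _, inr _ => True
  | inr _, inl _ => False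
  | inr j, inr j' => los_lt j j'
  end.

Lemma sum_lin (I J : los) : is_linear (@sum_lt I J).
Proof.
case: I J => T lt [irr tr tot] [T' lt' [irr' tr' tot']]; split=> /=.
- by case=> x /=; [exact: irr | exact: irr'].
- by case=> y [] x [] z //=; [exact: tr | exact: tr'].
- case=> x [] y /=; auto.
  + by case: (tot x y) => [|[->|]]; auto.
  + by case: (tot' x y) => [|[->|]]; auto.
Qed.

Definition sum_los (I J : los) : los := Los (@sum_lin I J).

Definition increasing (I : los) (s : seq I) : Prop :=
  StronglySorted (@los_lt I) s.

(** * Multipliability exponential groups *)

Record pgr (k : comPzRingType) := PGr {
  pg_car :> Type;
  pg_one : pg_car;
  pg_mul : pg_car -> pg_car -> pg_car;
  pg_inv : pg_car -> pg_car;
  pg_pow : pg_car -> k -> pg_car;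
  pg_prod : forall I : los, (I -> pg_car) -> pg_car -> Prop }.

Arguments pg_one {k} p.

Definition in_dom (k : comPzRingType) (G : pgr k) (I : los) (g : I -> G) :=
  exists p, pg_prod g p.

Definition multipliable (k : comPzRingType) (G : pgr k) (I : Type)
    (g : I -> G) :=
  exists (lt : I -> I -> Prop) (lin : is_linear lt),
    @in_dom k G (Los lin) g.

Record is_expgroup (k : comPzRingType) (G : pgr k) : Prop := IsExpGroup {
  pg_mulA : associative (@pg_mul k G);
  pg_mul1g : left_id (pg_one G) (@pg_mul k G);
  pg_mulg1 : right_id (pg_one G) (@pg_mul k G);
  pg_mulVg : left_inverse (pg_one G) (@pg_inv k G) (@pg_mul k G);
  pg_mulgV : right_inverse (pg_one G) (@pg_inv k G) (@pg_mul k G);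
  pg_pow1 : forall f : G, pg_pow f 1 = f;
  pg_powD : forall (f : G) (a b : k),
    pg_pow f (a + b) = pg_mul (pg_pow f a) (pg_pow f b);
  pg_powM : forall (f : G) (a b : k),
    pg_pow (pg_pow f a) b = pg_pow f (a * b);
  pg_powMg : forall (f g : G) (a : k), pg_mul f g = pg_mul g f ->
    pg_pow (pg_mul f g) a = pg_mul (pg_pow f a) (pg_pow g a);
  pg_powJ : forall (f g : G) (a : k),
    pg_pow (pg_mul (pg_mul f g) (pg_inv f)) a =
    pg_mul (pg_mul f (pg_pow g a)) (pg_inv f) }.

(* In [mg1], x i and y i are the products of f^-1 along the reversed final
   segment (i^+)^* and of f along i^+. In [meg8] and [meg9], [Los lin] ranges
   over the linear orderings of a given set. *)
Record is_multipliability (k : comPzRingType) (G : pgr k) : Prop :=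
  IsMultipliability {
  prod_fun : forall (I : los) (g : I -> G) (p r : G),
    pg_prod g p -> pg_prod g r -> p = r;
  prod_inv_dom : forall (I : los) (g : I -> G),
    in_dom g -> @in_dom k G I (fun i => pg_inv (g i));
  prod_mul_dom : forall (I : los) (f g : I -> G),
    in_dom f -> in_dom g -> @in_dom k G I (fun i => pg_mul (f i) (g i));
  mg1 : forall (I : los) (f g : I -> G) (p r : G),
    pg_prod f p -> pg_prod g r ->
    exists (x y : I -> G) (t : G),
      [/\ forall i, @pg_prod k G (rev_los (sub_los (los_lt i)))
            (fun j => pg_inv (f (sval j))) (x i),
          forall i, @pg_prod k G (sub_los (los_lt i))
            (fun j => f (sval j)) (y i),
          @pg_prod k G I (fun i => pg_mul (pg_mul (x i) (g i)) (y i)) t &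
          @pg_prod k G I (fun i => pg_mul (f i) (g i)) (pg_mul p t)];
  mg2 : forall (I : los) (g : I -> G) (s : seq I),
    increasing s -> (forall i, List.In i s <-> g i <> pg_one G) ->
    pg_prod g (\big[@pg_mul k G/pg_one G]_(i <- s) g i);
  mg3 : forall (I J : los) (phi : I -> J) (g : J -> G) (p : G),
    bijective phi -> (forall i i', los_lt (phi i) (phi i') <-> los_lt i i') ->
    pg_prod g p -> pg_prod (g \o phi) p;
  mg4 : forall (I J : los) (P : J -> I -> Prop) (g : I -> G) (p : G),
    (forall i, exists j, P j i) ->
    (forall j j' i i', los_lt j j' -> P j i -> P j' i' -> los_lt i i') ->
    pg_prod g p ->
    exists h : J -> G,
      (forall j, @pg_prod k G (sub_los (P j)) (fun i => g (sval i)) (h j)) /\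
      pg_prod h p;
  mg5 : forall (I J : los) (g : I -> G) (h : J -> G),
    in_dom g -> in_dom h ->
    @in_dom k G (sum_los I J)
      (fun x => match x with inl i => g i | inr j => h j end);
  mg6 : forall (I : los) (g : I -> G) (p g0 : G), pg_prod g p ->
    @pg_prod k G I (fun i => pg_mul (pg_mul g0 (g i)) (pg_inv g0))
      (pg_mul (pg_mul g0 p) (pg_inv g0));
  meg7 : forall (I : los) (g : I -> G) (p : G), pg_prod g p ->
    @pg_prod k G (rev_los I) (fun i => pg_inv (g i)) (pg_inv p);
  meg8 : forall (I : los) (g : I -> G) (X : I -> finType)
      (f : forall i, X i -> k)
      (lt : {i : I & X i} -> {i : I & X i} -> Prop) (lin : is_linear lt),
    in_dom g ->
    @in_dom k G (Los lin) (fun p => pg_pow (g (projT1 p)) (f _ (projT2 p)));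
  meg9 : forall (I : los) (lt : I -> I -> Prop) (lin : is_linear lt)
      (g : I -> G),
    in_dom g <-> @in_dom k G (Los lin) g }.

Record pgr_hom (k : comPzRingType) (G H : pgr k) (phi : G -> H) : Prop :=
  PGrHom {
  pgr_homM : forall f g, phi (pg_mul f g) = pg_mul (phi f) (phi g);
  pgr_homX : forall f (a : k), phi (pg_pow f a) = pg_pow (phi f) a;
  pgr_hom_prod : forall (I : los) (g : I -> G) (p : G),
    pg_prod g p -> pg_prod (phi \o g) (phi p) }.

(** * Formal power series in non-commuting variables *)

Definition series (k : comPzRingType) (I : Type) : Type := seq I -> k.

Definition szero (k : comPzRingType) (I : Type) : series k I := fun _ => 0.
Definition sone (k : comPzRingType) (I : Type) : series k I :=
  fun w => (nilp w)%:R.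
Arguments szero k I : clear implicits.
Arguments sone k I : clear implicits.
Definition sX (k : comPzRingType) (I : Type) (i : I) : series k I :=
  fun w => `[< w = [:: i] >]%:R.
Definition sadd (k : comPzRingType) (I : Type) (P Q : series k I) :
  series k I := fun w => P w + Q w.
Definition sopp (k : comPzRingType) (I : Type) (P : series k I) :
  series k I := fun w => - P w.
Definition sscale (k : comPzRingType) (I : Type) (a : k) (P : series k I) :
  series k I := fun w => a * P w.
Definition smul (k : comPzRingType) (I : Type) (P Q : series k I) :
  series k I :=
  fun w => \sum_(n < (size w).+1) P (take n w) * Q (drop n w).
Definition spow (k : comPzRingType) (I : Type) (P : series k I) (n : nat) :
  series k I := iter n (smul P) (sone k I).
Definition sbracket (k : comPzRingType) (I : Type) (P Q : series k I) :
  series k I := sadd (smul P Q) (sopp (smul Q P)).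

Arguments sX k {I} i.

Definition series_summable (k : comPzRingType) (I J : Type)
    (P : {classic J} -> series k I) : Prop :=
  forall w, finite_set [set j | P j w <> 0]%classic.

(* Only meaningful for summable families. *)
Definition series_sum (k : comPzRingType) (I J : Type)
    (P : {classic J} -> series k I) : series k I :=
  fun w => \sum_(j \in [set: {classic J}]%classic) P j w.

(* exp and log are used on series with constant term 0 and 1 respectively. *)
Definition sexp (k : comPzRingType) (q : {rmorphism rat -> k}) (I : Type)
    (P : series k I) : series k I :=
  @series_sum k I nat (fun n => sscale (q (n`!%:R^-1)) (spow P n)).

Definition slog (k : comPzRingType) (q : {rmorphism rat -> k}) (I : Type)
    (Q : series k I) : series k I :=
  @series_sum k I nat (fun n =>
    sscale (q ((-1) ^+ n / n.+1%:R)) (spow (sadd Q (sopp (sone k I))) n.+1)).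

Definition series_lie (k : comPzRingType) (I : Type) : salg k := {|
  sa_car := series k I;
  sa_zero := szero k I;
  sa_add := @sadd k I;
  sa_opp := @sopp k I;
  sa_scale := @sscale k I;
  sa_mul := @sbracket k I;
  sa_sum := fun J P S => @series_summable k I J P /\ S = @series_sum k I J P |}.

Definition in_Lie (k : comPzRingType) (I : Type) (P : series k I) : Prop :=
  forall S : series k I -> Prop,
    @is_subsalg k (series_lie k I) S -> (forall i, S (sX k i)) -> S P.

Lemma in_Lie_subsalg (k : comPzRingType) (I : Type) :
  @is_subsalg k (series_lie k I) (@in_Lie k I).
Proof.
split.
- by move=> S HS _; exact: (subsalg0 HS).
- by move=> x y hx hy S HS HX; apply: (subsalgD HS); [exact: hx|exact: hy].
- by move=> x hx S HS HX; apply: (subsalgN HS); exact: hx.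
- by move=> a x hx S HS HX; apply: (subsalgZ HS); exact: hx.
- by move=> x y hx hy S HS HX; apply: (subsalgM HS); [exact: hx|exact: hy].
- move=> J v s hv hs S HS HX; apply: (subsalg_sum HS) hs => j.
  exact: hv.
Qed.

Lemma in_Lie_X (k : comPzRingType) (I : Type) (i : I) : in_Lie (sX k i).
Proof. by move=> S _; apply. Qed.

Definition LieSeries (k : comPzRingType) (I : Type) : salg k :=
  sub_salg (in_Lie_subsalg k I).

Definition LieX (k : comPzRingType) (I : Type) (i : I) : LieSeries k I :=
  exist _ (sX k i) (in_Lie_X i).

(* The product, along J, of a family of series with constant term 1: sum over
   the finite increasing sequences in J, the empty one included. *)
Definition series_prod (k : comPzRingType) (I : Type) (J : los)
    (Q : J -> series k I) : series k I :=
  @series_sum k I {s : seq J | increasing s} (fun s =>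
    \big[@smul k I/sone k I]_(j <- sval s) sadd (Q j) (sopp (sone k I))).

Definition in_Gr (k : comPzRingType) (q : {rmorphism rat -> k}) (I : Type)
    (Q : series k I) : Prop :=
  exists2 P, in_Lie P & Q = sexp q P.

(** * Evaluations *)

Definition is_evLie (k : comPzRingType) (L : salg k) (I : Type) (a : I -> L)
    (ev : LieSeries k I -> L) : Prop :=
  salg_hom ev /\ forall i, ev (LieX k i) = a i.

Definition has_evLie (k : comPzRingType) (L : salg k) : Prop :=
  forall (I : Type) (a : I -> L), summable a -> exists! ev, is_evLie a ev.

(* The value of ev_a at a series P of Lie<<I>>. *)
Definition evLie (k : comPzRingType) (L : salg k) (I : Type) (a : I -> L)
    (P : series k I) : L :=
  the (sa_zero L) (fun x => exists2 ev, is_evLie a ev &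
    exists2 p : LieSeries k I, sval p = P & ev p = x).

(* Gr<<I>> := exp(Lie<<I>>) is closed under products, powers and infinite
   products (Baker-Campbell-Hausdorff), so the operations restricted from
   1 + k<<I>>_0 are described here by their graphs. *)
Record is_evGr (k : comPzRingType) (q : {rmorphism rat -> k}) (G : pgr k)
    (I : Type) (f : I -> G) (ev : {Q : series k I | in_Gr q Q} -> G) : Prop :=
  IsEvGr {
  evGrM : forall P Q R : {Q | in_Gr q Q},
    sval R = smul (sval P) (sval Q) -> ev R = pg_mul (ev P) (ev Q);
  evGrX : forall (P R : {Q | in_Gr q Q}) (a : k),
    sval R = sexp q (sscale a (slog q (sval P))) -> ev R = pg_pow (ev P) a;
  evGr_prod : forall (J : los) (Q : J -> {Q | in_Gr q Q})
      (R : {Q | in_Gr q Q}),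
    @series_summable k I J
      (fun j => sadd (sval (Q j)) (sopp (sone k I))) ->
    sval R = series_prod (fun j => sval (Q j)) ->
    @pg_prod k G J (fun j => ev (Q j)) (ev R);
  evGr_expX : forall (i : I) (R : {Q | in_Gr q Q}),
    sval R = sexp q (sX k i) -> ev R = f i }.

Definition has_evGr (k : comPzRingType) (q : {rmorphism rat -> k})
    (G : pgr k) : Prop :=
  forall (I : Type) (f : I -> G), multipliable f ->
    exists! ev, is_evGr (q := q) f ev.

(* The value of ev_f at a series Q of Gr<<I>>. *)
Definition evGr (k : comPzRingType) (q : {rmorphism rat -> k}) (G : pgr k)
    (I : Type) (f : I -> G) (Q : series k I) : G :=
  the (pg_one G) (fun x => exists2 ev, is_evGr (q := q) f ev &
    exists2 p : {Q | in_Gr q Q}, sval p = Q & ev p = x).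

(** * The constructions Gr and Lie *)

Definition pair2 (T : Type) (a b : T) : 'I_2 -> T :=
  fun i => if i == ord0 then a else b.

Definition X0 (k : comPzRingType) : series k 'I_2 := sX k ord0.
Definition X1 (k : comPzRingType) : series k 'I_2 := sX k ord_max.

Definition Gr (k : comPzRingType) (q : {rmorphism rat -> k}) (L : salg k) :
    pgr k := {|
  pg_car := L;
  pg_one := sa_zero L;
  pg_mul := fun a b =>
    evLie (pair2 a b) (slog q (smul (sexp q (X0 k)) (sexp q (X1 k))));
  pg_inv := @sa_opp k L;
  pg_pow := fun a c => sa_scale c a;
  pg_prod := fun I a p => summable a /\
    p = evLie a (slog q (series_prod (fun i : I => sexp q (sX k i)))) |}.

Definition Lie (k : comPzRingType) (q : {rmorphism rat -> k}) (G : pgr k) :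
    salg k := {|
  sa_car := G;
  sa_zero := pg_one G;
  sa_add := fun a b => evGr q (pair2 a b) (sexp q (sadd (X0 k) (X1 k)));
  sa_opp := @pg_inv k G;
  sa_scale := fun c a => pg_pow a c;
  sa_mul := fun a b => evGr q (pair2 a b) (sexp q (sbracket (X0 k) (X1 k)));
  sa_sum := fun J b s => multipliable b /\
    s = evGr q b (sexp q (@series_sum k J J (fun j => sX k j))) |}.

(** * Categories *)

Record category := Category {
  obj :> Type;
  arrow : obj -> obj -> Type;
  arrow_id : forall X, arrow X X;
  arrow_comp : forall X Y Z, arrow Y Z -> arrow X Y -> arrow X Z;
  arrow_comp1f : forall X Y (f : arrow X Y), arrow_comp (arrow_id Y) f = f;
  arrow_compf1 : forall X Y (f : arrow X Y), arrow_comp f (arrow_id X) = f;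
  arrow_compA : forall X Y Z W (h : arrow Z W) (g : arrow Y Z) (f : arrow X Y),
    arrow_comp h (arrow_comp g f) = arrow_comp (arrow_comp h g) f }.

Record functor (C D : category) := Functor {
  fobj :> C -> D;
  farr : forall X Y, arrow X Y -> arrow (fobj X) (fobj Y);
  farr_id : forall X, farr (arrow_id X) = arrow_id (fobj X);
  farr_comp : forall X Y Z (g : arrow Y Z) (f : arrow X Y),
    farr (arrow_comp g f) = arrow_comp (farr g) (farr f) }.

Definition id_functor (C : category) : functor C C :=
  @Functor C C id (fun _ _ => id) (fun _ => erefl) (fun _ _ _ _ _ => erefl).

Lemma comp_functor1 (C D E : category) (F : functor C D) (G : functor D E)
  (X : C) : farr G (farr F (arrow_id X)) = arrow_id (G (F X)).
Proof. by rewrite !farr_id. Qed.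

Lemma comp_functorM (C D E : category) (F : functor C D) (G : functor D E)
    (X Y Z : C) (g : arrow Y Z) (f : arrow X Y) :
  farr G (farr F (arrow_comp g f)) =
  arrow_comp (farr G (farr F g)) (farr G (farr F f)).
Proof. by rewrite !farr_comp. Qed.

Definition comp_functor (C D E : category) (G : functor D E)
    (F : functor C D) : functor C E :=
  @Functor C E (fun X => G (F X)) (fun _ _ f => farr G (farr F f))
    (comp_functor1 F G) (comp_functorM F G).

Definition mutually_inverse (C D : category) (F : functor C D)
    (G : functor D C) : Prop :=
  comp_functor G F = id_functor C /\ comp_functor F G = id_functor D.

(** * The two categories and the two functors *)

Record slie_ev (k : comPzRingType) := SLieEv {
  slie_data :> salg k;
  slie_ax : is_slie slie_data;
  slie_has_ev : has_evLie slie_data }.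

Record pgr_ev (k : comPzRingType) (q : {rmorphism rat -> k}) := PGrEv {
  pgr_data :> pgr k;
  pgr_expgroup : is_expgroup pgr_data;
  pgr_multipliability : is_multipliability pgr_data;
  pgr_has_ev : has_evGr q pgr_data }.

Lemma salg_hom_id (k : comPzRingType) (A : salg k) : salg_hom (@id A).
Proof. by []. Qed.

Lemma salg_hom_comp (k : comPzRingType) (A B C : salg k) (g : B -> C)
  (f : A -> B) : salg_hom g -> salg_hom f -> salg_hom (g \o f).
Proof.
move=> [gD gZ gM gS] [fD fZ fM fS]; split=> /=.
- by move=> x y; rewrite fD gD.
- by move=> a x; rewrite fZ gZ.
- by move=> x y; rewrite fM gM.
- by move=> I v s /fS /gS.
Qed.

Lemma pgr_hom_id (k : comPzRingType) (G : pgr k) : pgr_hom (@id G).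
Proof. by []. Qed.

Lemma pgr_hom_comp (k : comPzRingType) (G H K : pgr k) (g : H -> K)
  (f : G -> H) : pgr_hom g -> pgr_hom f -> pgr_hom (g \o f).
Proof.
move=> [gM gX gP] [fM fX fP]; split=> /=.
- by move=> x y; rewrite fM gM.
- by move=> x a; rewrite fX gX.
- by move=> I v p /fP /gP.
Qed.

Definition SigmaLie (k : comPzRingType) : category.
Proof.
refine (@Category (slie_ev k)
  (fun L M => {phi : L -> M | salg_hom phi})
  (fun L => exist _ id (salg_hom_id L))
  (fun L M N g f => exist _ (sval g \o sval f)
    (salg_hom_comp (svalP g) (svalP f))) _ _ _);
  by move=> *; apply: sval_eq.
Defined.

Definition PiGr (k : comPzRingType) (q : {rmorphism rat -> k}) : category.
Proof.
refine (@Category (pgr_ev q)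
  (fun G H => {phi : G -> H | pgr_hom phi})
  (fun G => exist _ id (pgr_hom_id G))
  (fun G H K g f => exist _ (sval g \o sval f)
    (pgr_hom_comp (svalP g) (svalP f))) _ _ _);
  by move=> *; apply: sval_eq.
Defined.

(* What has to be proved for Gr (below: Lie) to be a functor that sends an
   arrow to the same underlying map. *)
Record Gr_well_defined (k : comPzRingType) (q : {rmorphism rat -> k}) :
    Prop := GrWellDefined {
  Gr_expgroup : forall L : slie_ev k, is_expgroup (Gr q L);
  Gr_multipliability : forall L : slie_ev k, is_multipliability (Gr q L);
  Gr_has_ev : forall L : slie_ev k, has_evGr q (Gr q L);
  Gr_hom : forall (L M : slie_ev k) (phi : L -> M),
    salg_hom phi -> @pgr_hom k (Gr q L) (Gr q M) phi }.

Record Lie_well_defined (k : comPzRingType) (q : {rmorphism rat -> k}) :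
    Prop := LieWellDefined {
  Lie_slie : forall G : pgr_ev q, is_slie (Lie q G);
  Lie_has_ev : forall G : pgr_ev q, has_evLie (Lie q G);
  Lie_hom : forall (G H : pgr_ev q) (phi : G -> H),
    pgr_hom phi -> @salg_hom k (Lie q G) (Lie q H) phi }.

Arguments Gr_expgroup {k q} _ L.
Arguments Gr_multipliability {k q} _ L.
Arguments Gr_has_ev {k q} _ L.
Arguments Lie_slie {k q} _ G.
Arguments Lie_has_ev {k q} _ G.

Definition GrFunctor (k : comPzRingType) (q : {rmorphism rat -> k})
    (wd : Gr_well_defined q) : functor (SigmaLie k) (PiGr q).
Proof.
refine (@Functor (SigmaLie k) (PiGr q)
  (fun L : slie_ev k => PGrEv (Gr_expgroup wd L) (Gr_multipliability wd L)
    (Gr_has_ev wd L))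
  (fun L M phi => exist _ (sval phi) (Gr_hom wd (svalP phi))) _ _);
  by move=> *; apply: sval_eq.
Defined.

Definition LieFunctor (k : comPzRingType) (q : {rmorphism rat -> k})
    (wd : Lie_well_defined q) : functor (PiGr q) (SigmaLie k).
Proof.
refine (@Functor (PiGr q) (SigmaLie k)
  (fun G : pgr_ev q => SLieEv (Lie_slie wd G) (Lie_has_ev wd G))
  (fun G H phi => exist _ (sval phi) (Lie_hom wd (svalP phi))) _ _);
  by move=> *; apply: sval_eq.
Defined.

(* Main.v *)
(* Everything takes place in formal series. By Friedrichs' criterion, proved with
   the Dynkin operator, Lie<<I>> consists of the primitive series (those that
   vanish on proper shuffles) and Gr<<I>> of the group-like ones. Hence Gr<<I>> is
   closed under finite and infinite products, powers and inverses, and the logarithm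
   of each such expression in the exp(X_i) is a Lie series. That exp and log are
   mutually inverse, and exchange primitive and group-like series, comes from the
   fact that the coefficients of Q^n are polynomial in n, with linear coefficient
   those of log Q.

   An axiom of multipliability groups for Gr(L) is obtained by evaluating the
   corresponding identity between infinite products of formal series, which can be
   checked on finite products because only finitely many factors matter for a given
   word. Evaluation commutes with substitution because evaluations are unique. The
   axioms for Lie(G) follow in the same way from the Lie algebra Lie<<I>>.

   Two points need more: the uniqueness of group evaluations in Gr(L), and
   (f g)^a = f^a g^a for commuting f and g. Both follow from the fact that every
   element of Gr<<I>> is an infinite product of iterated commutators of elements
   exp(c X_i): the Dynkin operator sum_i [X_i, D_i] is the leading term of
   prod_i (exp X_i, R_i) if D_i is that of R_i, so leading terms can be removed one
   degree at a time. *)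

From HB Require Import structures.
Require Import Defs.
From mathcomp Require Import all_boot all_order all_algebra qpoly ring zify.
From mathcomp Require Import finmap all_classical wochoice.
From Stdlib Require Import Sorted.

Set Implicit Arguments.
Unset Strict Implicit.
Unset Printing Implicit Defensive.

Import GRing.Theory Num.Theory.
Local Open Scope ring_scope.

(** * Sums with finite support *)

(** Convergence is word by word and not by degree: for infinite [I] the family of the variables is
    summable although all its members have degree 1. Limits are therefore controlled on
    [factor_of w], the finitely many factors of one word; [shorter n] serves for inductions on
    degree and for leading terms. Both sets are closed under factors, so congruence on them is
    stable under products, [exp] and [log].

    The polynomials in n have rational coefficients and are treated over [rat], where interpolation
    is available; [q] then carries the result to [k], which may be any Q-algebra.

    Elements of an abstract algebra or group are turned into values of distinct variables, with one
    copy of the index set for each family involved; this is where the axioms on disjoint unions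
    enter.

    Equality of objects is equality of records. Both constructions keep the carrier, the neutral
    element, the opposite or inverse, and the scaling or power map, so only the remaining fields
    have to be identified. *)

Lemma mem_classic (T : eqType) (s : seq T) (x : T) :
  ((x : {classic T}) \in (s : seq {classic T})) = (x \in s).
Proof.
have inj : injective (id : T -> {classic T}) by [].
by rewrite -(mem_map inj) map_id.
Qed.

Lemma uniq_classic (T : eqType) (s : seq T) :
  uniq (s : seq {classic T}) = uniq s.
Proof.
have inj : injective (id : T -> {classic T}) by [].
by rewrite -(map_inj_uniq inj) map_id.
Qed.

Section FiniteSums.
Variable k : comPzRingType.

(* [fs f s] includes the finiteness of the support of [f], unlike the value of
   [\sum_(j \in A) f j]. *)
Definition fin_supp (J : Type) (f : J -> k) : Prop :=
  exists r : seq {classic J}, forall j, j \notin r -> f j = 0.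

Definition fs (J : Type) (f : J -> k) (s : k) : Prop :=
  exists r : seq {classic J},
    [/\ uniq r, (forall j, j \notin r -> f j = 0) & s = \sum_(j <- r) f j].

Lemma fsP (J : Type) (f : J -> k) s :
  fs f s <-> finite_set [set j : {classic J} | f j <> 0]%classic /\
             s = \sum_(j \in [set: {classic J}]%classic) f j.
Proof.
split=> [[r [ur fr ->]]|[fin ->]].
  split; first apply/finite_seqP.
    exists [seq j <- r | f j != 0]; apply/seteqP; split=> j /=.
      move=> fj; rewrite mem_filter; case: eqP => //= _.
      by apply: contrapT => /negP /fr.
    by rewrite mem_filter => /andP[/eqP].
  rewrite (@fsbigTE _ _ _ {classic J} [fset x | x in r]%fset) => [|j].
    apply: perm_big; apply: uniq_perm => //; first exact: fset_uniq.
    by move=> j; rewrite !inE.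
  by rewrite !inE /= => /fr.
have [r er] := finite_fsetP.1 fin.
exists r; split; first exact: fset_uniq.
- move=> j jr; apply: contrapT => fj.
  by have : [set j : {classic J} | f j <> 0]%classic j by []; rewrite er /= (negPf jr).
- apply: fsbigTE => j jr; apply: contrapT => fj.
  by have : [set j : {classic J} | f j <> 0]%classic j by []; rewrite er /= (negPf jr).
Qed.

Lemma fs_fun (J : Type) (f : J -> k) s t : fs f s -> fs f t -> s = t.
Proof. by move=> /fsP[_ ->] /fsP[_ ->]. Qed.

Lemma fs_supp (J : Type) (f : J -> k) s : fs f s -> fin_supp f.
Proof. by move=> [r [_ fr _]]; exists r. Qed.

Lemma fs_ex (J : Type) (f : J -> k) : fin_supp f -> exists s, fs f s.
Proof.
move=> [r fr]; exists (\sum_(j <- undup r) f j); exists (undup r); split=> //.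
  exact: undup_uniq.
by move=> j; rewrite mem_undup => /fr.
Qed.

Lemma fs_seq (J : Type) (f : J -> k) s (r : seq {classic J}) :
  uniq r -> (forall j, j \notin r -> f j = 0) -> fs f s ->
  s = \sum_(j <- r) f j.
Proof. by move=> ur fr /fs_fun; apply; exists r. Qed.

Lemma fs_ext (J : Type) (f g : J -> k) s : f =1 g -> fs f s -> fs g s.
Proof. by move=> /funext ->. Qed.

Lemma fs_common (J : Type) (f g : J -> k) s t : fs f s -> fs g t ->
  exists r : seq {classic J}, [/\ uniq r,
    forall j, j \notin r -> f j = 0 /\ g j = 0,
    s = \sum_(j <- r) f j & t = \sum_(j <- r) g j].
Proof.
move=> hf hg; have [[r [_ fr _]] [r' [_ gr _]]] := (hf, hg).
exists (undup (r ++ r')); have ur := undup_uniq (r ++ r').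
have h j : j \notin undup (r ++ r') -> f j = 0 /\ g j = 0.
  by rewrite mem_undup mem_cat negb_or => /andP[/fr -> /gr ->].
by split=> //; [apply: fs_seq hf | apply: fs_seq hg] => // j /h[].
Qed.

Lemma fs_zero (J : Type) : fs (fun _ : J => 0) 0.
Proof. by exists [::]; split=> //; rewrite big_nil. Qed.

Lemma fs_add (J : Type) (f g : J -> k) s t :
  fs f s -> fs g t -> fs (fun j => f j + g j) (s + t).
Proof.
move=> hf hg; have [r [ur h -> ->]] := fs_common hf hg.
exists r; split=> //; last by rewrite big_split.
by move=> j /h[-> ->]; rewrite addr0.
Qed.

Lemma fs_scale (J : Type) (a : k) (f : J -> k) s :
  fs f s -> fs (fun j => a * f j) (a * s).
Proof.
move=> [r [ur h ->]]; exists r; split=> //; last by rewrite mulr_sumr.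
by move=> j /h ->; rewrite mulr0.
Qed.

Lemma fs_pair (J J' : Type) (f : J -> k) (g : J' -> k) s t :
  fs f s -> fs g t -> fs (fun p : J * J' => f p.1 * g p.2) (s * t).
Proof.
move=> [r [ur h ->]] [r' [ur' h' ->]].
exists [seq ((i : {classic J}), (j : {classic J'})) : {classic J * J'}
       | i <- r, j <- r']; split.
- by apply: allpairs_uniq => // -[i j] [i' j'] _ _ [-> ->].
- move=> [i j] ij /=; case: (boolP ((i : {classic J}) \in r)) => [ir|/h->]; last by rewrite mul0r.
  case: (boolP ((j : {classic J'}) \in r')) => [jr|/h'->]; last by rewrite mulr0.
  by case/negP: ij; apply/allpairsP; exists (i, j).
- rewrite big_allpairs mulr_suml; apply: eq_bigr => i _.
  by rewrite mulr_sumr.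
Qed.

Lemma fs_inj (I J : Type) (phi : I -> J) (f : J -> k) s :
  injective phi -> (forall j, (forall i, phi i <> j) -> f j = 0) ->
  fs (f \o phi) s <-> fs f s.
Proof.
move=> inj f0.
have to t : fs (f \o phi) t -> fs f t.
  move=> [r [ur h ->]]; exists (map (phi : {classic I} -> {classic J}) r); split.
  - by rewrite (map_inj_uniq (inj : injective (phi : {classic I} -> {classic J}))).
  - move=> j; apply: contraNeq => /eqP fj.
    have [i eij] : exists i, phi i = j.
      by apply: contrapT => /forallNP hj; apply: fj; exact: f0.
    apply/mapP; exists i; last by [].
    by apply: contrapT => /negP /h /=; rewrite eij.
  - by rewrite big_map.
split=> [/to//|hs]; have [t ht] : exists t, fs (f \o phi) t.
  apply: fs_ex; have [r [_ h _]] := hs.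
  (* A chosen partial inverse of [phi], which pulls the finite support of [f] back to [I]. *)
  pose psi (j : {classic J}) : option {classic I} :=
    if pselect (exists i, phi i = j) is left ex then Some (projT1 (cid ex))
    else None.
  exists (pmap psi r) => i ir; apply: h; apply: contraNN ir => ir.
  rewrite mem_pmap; apply/mapP; exists (phi i) => //; rewrite /psi.
  case: pselect => [ex|[]]; last by exists i.
  by congr Some; apply: inj; rewrite (projT2 (cid ex)).
by rewrite (fs_fun hs (to _ ht)).
Qed.

Lemma fs_sub (I : Type) (P : I -> Prop) (f : I -> k) s :
  fs (fun i : {i | P i} => f (sval i)) s <->
  fs (fun i => if `[< P i >] then f i else 0) s.
Proof.
rewrite -(@fs_inj {i | P i} I sval); first last.
- move=> j hj; case: asboolP => // Pj; by case: (hj (exist _ j Pj)).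
- by move=> x y; exact: sval_eq.
split; apply: fs_ext => -[i Pi] /=; by case: asboolP.
Qed.

Lemma fs_fibers (I J : Type) (phi : I -> J) (f : I -> k) s : fs f s ->
  exists w : J -> k,
    (forall j, fs (fun i => if `[< phi i = j >] then f i else 0) (w j)) /\
    fs w s.
Proof.
move=> [r [ur h ->]].
pose r' := undup (map (phi : {classic I} -> {classic J}) r).
exists (fun j => \sum_(i <- r) if `[< phi i = j >] then f i else 0); split.
  by move=> j; exists r; split=> // i /h ->; rewrite if_same.
exists r'; split; first exact: undup_uniq.
  move=> j; rewrite mem_undup => jr; rewrite big_seq big1 // => i ir.
  by case: asboolP => // e; case/negP: jr; apply/mapP; exists i.
rewrite exchange_big /= big_seq [RHS]big_seq; apply: eq_bigr => i ir.
rewrite (bigD1_seq (phi i : {classic J})) /= ?undup_uniq //; last first.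
  by rewrite mem_undup; apply/mapP; exists i.
rewrite asboolT // big1 ?addr0 // => j /eqP e; case: asboolP => // e'.
by case: e; rewrite e'.
Qed.

Lemma fs_fubini (I J : Type) (phi : I -> J) (f : I -> k) (w : J -> k) s :
  fs f s ->
  (forall j, fs (fun i => if `[< phi i = j >] then f i else 0) (w j)) ->
  fs w s.
Proof.
move=> /(fs_fibers phi)[w' [hw' hs]] hw; apply: fs_ext hs => j.
exact: fs_fun (hw' j) (hw j).
Qed.

Lemma fs_ord n (f : nat -> k) : (forall i, (n <= i)%N -> f i = 0) ->
  fs f (\sum_(i < n) f i).
Proof.
move=> h; exists (iota 0 n : seq {classic nat}); split.
- by rewrite uniq_classic iota_uniq.
- by move=> i; rewrite mem_classic mem_iota -leqNgt => /h.
- by rewrite -(big_mkord xpredT f) /index_iota subn0.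
Qed.

Lemma fs_single (J : Type) (f : J -> k) j0 :
  (forall j, j <> j0 -> f j = 0) -> fs f (f j0).
Proof.
move=> h; exists [:: j0]; split=> [//|j|]; last by rewrite big_seq1.
by rewrite inE => /eqP; exact: h.
Qed.

(** The fibers of (i, j) |-> i + j are finite, so the double sum may be grouped by antidiagonals;
    this is the Cauchy product behind [expD] and [grouplike_exp]. *)
Lemma fs_conv (F : nat -> nat -> k) s :
  fs (fun p : nat * nat => F p.1 p.2) s ->
  fs (fun n => \sum_(i < n.+1) F (n - i)%N i) s.
Proof.
move=> h; apply: (fs_fubini (phi := fun p : nat * nat => (p.1 + p.2)%N) h) => n.
pose G p := if `[< p.1 + p.2 = n >]%N then F p.1 p.2 else 0.
pose g i : {classic nat * nat} := ((n - i)%N, i).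
exists (map g (iota 0 n.+1)); split.
- by rewrite map_inj_uniq ?iota_uniq // => i j [].
- move=> [i j]; apply: contraNeq; case: asboolP => [e _|]; last by rewrite eqxx.
  have {}e : (i + j)%N = n by [].
  apply/mapP; exists j; first by rewrite mem_iota ltnS -e leq_addl.
  by rewrite /g -e addnK.
- rewrite big_map -[X in iota 0 X]subn0 -/(index_iota 0 n.+1) big_mkord.
  by apply: eq_bigr => i _; rewrite /= subnK ?asboolT // -ltnS.
Qed.

End FiniteSums.

(** * The ring of formal series *)

(* [series] unfolds to a function type, on which MathComp has the pointwise ring
   structure; this alias carries the Cauchy product. *)
Definition fps (k : comPzRingType) (I : Type) : Type := series k I.

(** The left derivative by a letter. Cauchy products and shuffles both satisfy recursions on the
    first letter in terms of it, which makes induction on words possible. *)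
Definition lder (k : comPzRingType) (I : Type) (a : I) (P : fps k I) :
  fps k I := fun w => P (a :: w).

Section SeriesRing.
Variables (k : comPzRingType) (I : Type).
Implicit Types (P Q R : fps k I) (w u v : seq I).

HB.instance Definition _ := gen_eqMixin (fps k I).
HB.instance Definition _ := gen_choiceMixin (fps k I).

Fact sadd_A : associative (@sadd k I).
Proof. by move=> P Q R; apply: funext => w; exact: addrA. Qed.
Fact sadd_C : commutative (@sadd k I).
Proof. by move=> P Q; apply: funext => w; exact: addrC. Qed.
Fact sadd_0 : left_id (szero k I) (@sadd k I).
Proof. by move=> P; apply: funext => w; exact: add0r. Qed.
Fact sadd_N : left_inverse (szero k I) (@sopp k I) (@sadd k I).
Proof. by move=> P; apply: funext => w; exact: addNr. Qed.

HB.instance Definition _ :=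
  GRing.isZmodule.Build (fps k I) sadd_A sadd_C sadd_0 sadd_N.

Lemma smul_nil P Q : smul P Q [::] = P [::] * Q [::].
Proof. by rewrite /smul big_ord1. Qed.

Lemma smul_cons P Q a w :
  smul P Q (a :: w) = P [::] * Q (a :: w) + smul (lder a P) Q w.
Proof. by rewrite /smul big_ord_recl. Qed.

Lemma smulDl P Q R : smul (P + Q) R = smul P R + smul Q R :> fps k I.
Proof.
apply: funext => w; change (smul (P + Q) R w = smul P R w + smul Q R w).
rewrite /smul -big_split; apply: eq_bigr => n _; exact: mulrDl.
Qed.

Lemma smulDr P Q R : smul P (Q + R) = smul P Q + smul P R :> fps k I.
Proof.
apply: funext => w; change (smul P (Q + R) w = smul P Q w + smul P R w).
rewrite /smul -big_split; apply: eq_bigr => n _; exact: mulrDr.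
Qed.

Lemma smulZl a P Q : smul (sscale a P) Q = sscale a (smul P Q).
Proof.
apply: funext => w; rewrite /sscale /smul mulr_sumr; apply: eq_bigr => n _.
by rewrite mulrA.
Qed.

Lemma smulZr a P Q : smul P (sscale a Q) = sscale a (smul P Q).
Proof.
apply: funext => w; rewrite /sscale /smul mulr_sumr; apply: eq_bigr => n _.
by rewrite mulrCA.
Qed.

Lemma lder_smul a P Q :
  lder a (smul P Q) = sscale (P [::]) (lder a Q) + smul (lder a P) Q.
Proof. by apply: funext => w; rewrite /lder smul_cons. Qed.

Fact smul_A : associative (@smul k I).
Proof.
move=> P Q R; apply: funext => w.
elim: w P => [|a w IH] P; first by rewrite !smul_nil mulrA.
rewrite !smul_cons lder_smul smulDl smulZl smul_nil IH.
by rewrite [X in _ = _ + X]/GRing.add /= /sadd /sscale addrA mulrDr mulrA.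
Qed.

Fact smul_1l : left_id (sone k I) (@smul k I).
Proof.
move=> P; apply: funext => w; rewrite /smul big_ord_recl take0 drop0 mul1r.
rewrite big1 ?addr0 // => i _; case: w i => [[]//|a w i /=].
by rewrite /sone /= mul0r.
Qed.

Fact smul_1r : right_id (sone k I) (@smul k I).
Proof.
move=> P; apply: funext => w; elim: w P => [|a w IH] P.
  by rewrite smul_nil mulr1.
by rewrite smul_cons IH /sone /= mulr0 add0r.
Qed.

HB.instance Definition _ :=
  GRing.Zmodule_isPzRing.Build (fps k I) smul_A smul_1l smul_1r smulDl smulDr.

Fact sscale_A a b P : sscale a (sscale b P) = sscale (a * b) P.
Proof. by apply: funext => w; exact: mulrA. Qed.
Fact sscale_1 : left_id 1 (@sscale k I).
Proof. by move=> P; apply: funext => w; exact: mul1r. Qed.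
Fact sscale_Dr : right_distributive (@sscale k I) +%R.
Proof. by move=> a P Q; apply: funext => w; exact: mulrDr. Qed.
Fact sscale_Dl P : {morph (@sscale k I)^~ P : a b / a + b}.
Proof. by move=> a b; apply: funext => w; exact: mulrDl. Qed.

HB.instance Definition _ :=
  GRing.Zmodule_isLmodule.Build k (fps k I) sscale_A sscale_1 sscale_Dr sscale_Dl.

Lemma szE : szero k I = 0 :> fps k I. Proof. by []. Qed.
Lemma soE : sone k I = 1 :> fps k I. Proof. by []. Qed.
Lemma saddE P Q : sadd P Q = P + Q :> fps k I. Proof. by []. Qed.
Lemma soppE P : sopp P = - P :> fps k I. Proof. by []. Qed.
Lemma sscaleE a P : sscale a P = a *: P :> fps k I. Proof. by []. Qed.
Lemma smulE P Q : smul P Q = P * Q :> fps k I. Proof. by []. Qed.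
Lemma sbrE P Q : sbracket P Q = P * Q - Q * P :> fps k I. Proof. by []. Qed.
Lemma spowE P n : spow P n = P ^+ n :> fps k I.
Proof. by elim: n => //= n IH; rewrite exprS -IH. Qed.
Definition fpsE := (szE, soE, saddE, soppE, sscaleE, smulE, sbrE, spowE).

Lemma c0 w : (0 : fps k I) w = 0. Proof. by []. Qed.
Lemma c1 w : (1 : fps k I) w = (nilp w)%:R. Proof. by []. Qed.
Lemma cD P Q w : (P + Q) w = P w + Q w. Proof. by []. Qed.
Lemma cN P w : (- P) w = - P w. Proof. by []. Qed.
Lemma cB P Q w : (P - Q) w = P w - Q w. Proof. by []. Qed.
Lemma cZ a P w : (a *: P) w = a * P w. Proof. by []. Qed.
Lemma cM_nil P Q : (P * Q) [::] = P [::] * Q [::].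
Proof. exact: smul_nil. Qed.
Lemma cM_cons P Q a w :
  (P * Q) (a :: w) = P [::] * Q (a :: w) + (lder a P * Q) w.
Proof. exact: smul_cons. Qed.
Lemma cM P Q w :
  (P * Q) w = \sum_(n < (size w).+1) P (take n w) * Q (drop n w).
Proof. by []. Qed.
Lemma csum (T : Type) (r : seq T) (p : pred T) (F : T -> fps k I) w :
  (\sum_(i <- r | p i) F i) w = \sum_(i <- r | p i) F i w.
Proof. by elim/big_rec2: _ => // i y1 y2 _ <-. Qed.

Lemma fps_scaleAl a P Q : a *: (P * Q) = (a *: P) * Q.
Proof. by rewrite -!fpsE smulZl. Qed.
Lemma fps_scaleAr a P Q : a *: (P * Q) = P * (a *: Q).
Proof. by rewrite -!fpsE smulZr. Qed.

Lemma fps_exprZn a P n : (a *: P) ^+ n = a ^+ n *: P ^+ n.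
Proof.
elim: n => [|n IH]; first by rewrite !expr0 scale1r.
by rewrite !exprS IH -fps_scaleAl -fps_scaleAr scalerA.
Qed.

(** * Congruence on a factor-closed set of words, and order *)

(** The series vanishing on a factor-closed set of words form a two-sided ideal, so congruence on
    such a set is compatible with products. *)
Definition factor_closed (W : seq I -> Prop) :=
  forall a u b, W (a ++ u ++ b) -> W u.

Definition factor_of (w : seq I) : seq I -> Prop :=
  fun u => exists a b, w = a ++ u ++ b.

Definition shorter (n : nat) : seq I -> Prop := fun u => (size u < n)%N.

Lemma factor_of_closed w : factor_closed (factor_of w).
Proof.
move=> a u b [a' [b' ->]]; exists (a' ++ a), (b ++ b').
by rewrite !catA.
Qed.

Lemma shorter_closed n : factor_closed (shorter n).
Proof.
move=> a u b; rewrite /shorter !size_cat; apply: leq_ltn_trans.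
by rewrite addnCA leq_addr.
Qed.

Lemma factor_of_refl w : factor_of w w.
Proof. by exists [::], [::]; rewrite cats0. Qed.

Definition eqon (W : seq I -> Prop) P Q := forall w, W w -> P w = Q w.

Lemma eqon_sym W P Q : eqon W P Q -> eqon W Q P.
Proof. by move=> h w /h. Qed.
Lemma eqon_trans W Q P R : eqon W P Q -> eqon W Q R -> eqon W P R.
Proof. by move=> h h' w hw; rewrite h // h'. Qed.
Lemma eqonD W P P' Q Q' : eqon W P P' -> eqon W Q Q' -> eqon W (P + Q) (P' + Q').
Proof. by move=> h h' w hw; rewrite !cD h // h'. Qed.
Lemma eqonN W P P' : eqon W P P' -> eqon W (- P) (- P').
Proof. by move=> h w hw; rewrite !cN h. Qed.
Lemma eqonB W P P' Q Q' : eqon W P P' -> eqon W Q Q' -> eqon W (P - Q) (P' - Q').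
Proof. by move=> h h'; apply: eqonD => //; exact: eqonN. Qed.
Lemma eqonZ W a P P' : eqon W P P' -> eqon W (a *: P) (a *: P').
Proof. by move=> h w hw; rewrite !cZ h. Qed.

Lemma eqonM W P P' Q Q' : factor_closed W ->
  eqon W P P' -> eqon W Q Q' -> eqon W (P * Q) (P' * Q').
Proof.
move=> cW h h' w hw; rewrite !cM; apply: eq_bigr => n _; congr (_ * _).
- by apply: h; apply: (cW [::] _ (drop n w)); rewrite /= cat_take_drop.
- by apply: h'; apply: (cW (take n w) _ [::]); rewrite cats0 cat_take_drop.
Qed.

Lemma eqonX W P P' n : factor_closed W ->
  eqon W P P' -> eqon W (P ^+ n) (P' ^+ n).
Proof.
move=> cW h; elim: n => [//|n IH].
by rewrite !exprS; exact: eqonM.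
Qed.

Lemma eqon_prod W (T : Type) (s : seq T) (F G : T -> fps k I) :
  factor_closed W -> (forall i, eqon W (F i) (G i)) ->
  eqon W (\prod_(i <- s) F i) (\prod_(i <- s) G i).
Proof.
move=> cW h; elim: s => [|a s IH]; first by rewrite !big_nil.
by rewrite !big_cons; exact: eqonM.
Qed.

Lemma eqonP P Q : (forall w, eqon (factor_of w) P Q) <-> P = Q.
Proof.
split=> [h|-> //]; apply: funext => w; exact: h (factor_of_refl w).
Qed.

Definition ordge n P := eqon (shorter n) P 0.

Lemma ordgeP n P Q : eqon (shorter n) P Q <-> ordge n (P - Q).
Proof.
split=> h w hw; first by rewrite cB h // subrr.
by apply/eqP; rewrite -subr_eq0; apply/eqP; exact: h.
Qed.

Lemma ordge_le m n P : (m <= n)%N -> ordge n P -> ordge m P.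
Proof. by move=> mn h w hw; apply: h; exact: leq_trans mn. Qed.

Lemma ordgeM m n P Q : ordge m P -> ordge n Q -> ordge (m + n) (P * Q).
Proof.
move=> hP hQ w hw; rewrite cM big1 // => i _.
case: (ltnP i m) => im.
  by rewrite hP ?mul0r // /shorter size_take_min; exact: leq_ltn_trans (geq_minl _ _) im.
rewrite hQ ?mulr0 // /shorter size_drop ltn_subLR.
  by apply: leq_trans hw _; rewrite leq_add2r.
by rewrite -ltnS.
Qed.

Lemma ordge1P P : ordge 1 P <-> P [::] = 0.
Proof.
split=> [h|h [|//]]; first exact: h.
by move=> _; rewrite h.
Qed.

Lemma ordgeX m P n : ordge m P -> ordge (n * m) (P ^+ n).
Proof.
move=> h; elim: n => [//|n IH].
by rewrite mulSn exprS; exact: ordgeM.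
Qed.

Lemma ordgeX0 P n w : P [::] = 0 -> (size w < n)%N -> (P ^+ n) w = 0.
Proof.
move=> /ordge1P h hw; apply: (@ordgeX 1 P n h).
by rewrite /shorter muln1.
Qed.

End SeriesRing.

(** * Summable families of series *)

Section HasSum.
Variables (k : comPzRingType) (I : Type).
Implicit Types (P Q R S T : fps k I).

(* The graph of the summation of series, [hs P S] being [sa_sum P S] in
   [series_lie k I]. *)
Definition hs (J : Type) (P : J -> fps k I) S := forall w, fs (P ^~ w) (S w).

Definition summ (J : Type) (P : J -> fps k I) := forall w, fin_supp (P ^~ w).

Lemma hsP (J : Type) (P : J -> fps k I) S :
  hs P S <-> @series_summable k I J P /\ S = @series_sum k I J P.
Proof.
split=> [h|[h ->] w]; last by apply/fsP.
split=> [w|]; first by have /fsP[] := h w.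
by apply: funext => w; have /fsP[] := h w.
Qed.

Lemma hs_fun J (P : J -> fps k I) S T : hs P S -> hs P T -> S = T.
Proof. by move=> h h'; apply: funext => w; exact: fs_fun (h w) (h' w). Qed.

Lemma hs_ex J (P : J -> fps k I) : summ P -> exists S, hs P S.
Proof.
by move=> h; have [f hf] := choice (fun w => fs_ex (h w)); exists f.
Qed.

Lemma hs_summ J (P : J -> fps k I) S : hs P S -> summ P.
Proof. by move=> h w; exact: fs_supp (h w). Qed.

Lemma summP J (P : J -> fps k I) : summ P <-> @series_summable k I J P.
Proof.
split=> [/hs_ex[S /hsP[]//]|h].
by apply: (@hs_summ _ _ (@series_sum k I J P)); apply/hsP.
Qed.

Lemma hs_sum J (P : J -> fps k I) : summ P -> hs P (@series_sum k I J P).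
Proof. by move=> /summP h; apply/hsP. Qed.

Lemma hs_ext J (P Q : J -> fps k I) S : P =1 Q -> hs P S -> hs Q S.
Proof. by move=> /funext ->. Qed.

Lemma hs_zero J : hs (fun _ : J => 0) 0.
Proof. by move=> w; exact: fs_zero. Qed.

Lemma hs_add J (P Q : J -> fps k I) S T :
  hs P S -> hs Q T -> hs (fun j => P j + Q j) (S + T).
Proof. by move=> h h' w; exact: fs_add. Qed.

Lemma hs_scale J a (P : J -> fps k I) S : hs P S -> hs (fun j => a *: P j) (a *: S).
Proof. by move=> h w; exact: fs_scale. Qed.

Lemma hs_opp J (P : J -> fps k I) S : hs P S -> hs (fun j => - P j) (- S).
Proof. by move=> h w; rewrite cN -mulN1r; apply: fs_ext (fs_scale (-1) (h w)) => j; rewrite mulN1r. Qed.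

Lemma fs_bigsum (T : Type) (r : seq T) J (F : T -> J -> k) (s : T -> k) :
  (forall t, fs (F t) (s t)) ->
  fs (fun j => \sum_(t <- r) F t j) (\sum_(t <- r) s t).
Proof.
move=> h; elim: r => [|a r IH].
  by rewrite big_nil; apply: fs_ext (fs_zero k J) => j; rewrite big_nil.
rewrite big_cons; apply: fs_ext (fs_add (h a) IH) => j.
by rewrite big_cons.
Qed.

Lemma hs_mul J J' (P : J -> fps k I) (Q : J' -> fps k I) S T :
  hs P S -> hs Q T -> hs (fun p : J * J' => P p.1 * Q p.2) (S * T).
Proof.
move=> h h' w; apply: (@fs_bigsum 'I_(size w).+1 _ _
  (fun n p => P p.1 (take n w) * Q p.2 (drop n w)) (fun n => S _ * T _)) => n.
exact: (fs_pair (h _) (h' _)).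
Qed.

Lemma hs_mull J (P : J -> fps k I) S R : hs P S -> hs (fun j => R * P j) (R * S).
Proof.
move=> h w; apply: (@fs_bigsum 'I_(size w).+1 _ _
  (fun n j => R (take n w) * P j (drop n w)) (fun n => R _ * S _)) => n.
exact: fs_scale (h _).
Qed.

Lemma hs_mulr J (P : J -> fps k I) S R : hs P S -> hs (fun j => P j * R) (S * R).
Proof.
move=> h w; apply: (@fs_bigsum 'I_(size w).+1 _ _
  (fun n j => P j (take n w) * R (drop n w)) (fun n => S _ * R _)) => n.
by rewrite mulrC; apply: fs_ext (fs_scale _ (h _)) => j; rewrite mulrC.
Qed.

Lemma hs_inj J J' (phi : J -> J') (P : J' -> fps k I) S :
  injective phi -> (forall j, (forall i, phi i <> j) -> P j = 0) ->
  hs (P \o phi) S <-> hs P S.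
Proof.
move=> inj h.
have e w : fs ((P ^~ w) \o phi) (S w) <-> fs (P ^~ w) (S w).
  by apply: fs_inj => // j /h ->.
by split=> hs w; have /e := hs w.
Qed.

Lemma hs_fubini J J' (phi : J -> J') (P : J -> fps k I) (Q : J' -> fps k I) S :
  hs P S ->
  (forall j, hs (fun i => if `[< phi i = j >] then P i else 0) (Q j)) ->
  hs Q S.
Proof.
move=> h h' w; have {}h := h w; apply: (fs_fubini h (phi := phi)) => j.
by apply: fs_ext (h' j w) => i; case: asboolP.
Qed.

Lemma hs_sub J (p : J -> Prop) (P : J -> fps k I) S :
  hs (fun i : {i | p i} => P (sval i)) S <->
  hs (fun i => if `[< p i >] then P i else 0) S.
Proof.
split=> h w.
  have h' := (fs_sub p (P ^~ w) (S w)).1 (h w).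
  by apply: fs_ext h' => i; case: asboolP.
apply: (fs_sub p (P ^~ w) (S w)).2.
by apply: fs_ext (h w) => i; case: asboolP.
Qed.

Lemma hs_seq J (P : J -> fps k I) (r : seq {classic J}) :
  uniq r -> (forall j, j \notin r -> P j = 0) -> hs P (\sum_(j <- r) P j).
Proof.
move=> ur h w; exists r; split=> // [j /h -> //|].
by rewrite csum.
Qed.

Lemma hs_single J (P : J -> fps k I) j0 :
  (forall j, j <> j0 -> P j = 0) -> hs P (P j0).
Proof.
move=> h; have := @hs_seq J P [:: j0]; rewrite big_seq1; apply=> // j.
by rewrite inE => /eqP; exact: h.
Qed.

Lemma hs_eqon W J (P Q : J -> fps k I) S T : hs P S -> hs Q T ->
  (forall j, eqon W (P j) (Q j)) -> eqon W S T.
Proof.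
move=> h h' e w hw; apply: fs_fun (h w) _.
by apply: fs_ext (h' w) => j; rewrite e.
Qed.

(** A word has finitely many factors, so the supports at all of them have a finite union. In this
    form summability passes to anything that preserves congruences. *)
Lemma summ_loc J (P : J -> fps k I) : summ P <->
  (forall w, exists r : seq {classic J},
     forall j, j \notin r -> eqon (factor_of w) (P j) 0).
Proof.
split=> [h w|h w]; last first.
  have [r hr] := h w; exists r => j /hr; apply; exact: factor_of_refl.
have [f hf] := choice h.
pose L := [seq f (take m (drop n w)) | n <- iota 0 (size w).+1, m <- iota 0 (size w).+1].
exists (flatten L) => j jr u [a [b e]]; apply: hf.
apply: contraNN jr => jr; apply/flattenP; exists (f u) => //.
have -> : u = take (size u) (drop (size a) w).
  by rewrite e drop_size_cat // take_size_cat.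
apply/allpairsP; exists (size a, size u); split=> //.
- by rewrite mem_iota /= ltnS e !size_cat leq_addr.
- by rewrite mem_iota /= ltnS e !size_cat addnCA leq_addr.
Qed.

Lemma eqon_summ J (P Q : J -> fps k I) : summ P ->
  (forall w j, eqon (factor_of w) (P j) 0 -> eqon (factor_of w) (Q j) 0) ->
  summ Q.
Proof.
move=> /summ_loc h h'; apply/summ_loc => w.
by have [r hr] := h w; exists r => j /hr /h'.
Qed.

Lemma summ_comp J J' (phi : J -> J') (P : J' -> fps k I) :
  injective phi -> summ P -> summ (P \o phi).
Proof.
move=> inj h w; have [r hr] := h w.
(* Extended by zero outside the image of [phi], so that [fs_inj] applies. *)
pose Q j' := if `[< exists j, phi j = j' >] then P j' w else 0.
have [s hs] : exists s, fs Q s.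
  by apply: fs_ex; exists r => j /hr; rewrite /Q => ->; rewrite if_same.
have : fs (Q \o phi) s.
  apply: (fs_inj (f := Q) s inj _).2 hs => j hj.
  by rewrite /Q asboolF // => -[i /hj].
move=> /fs_supp[r' hr']; exists r' => j /hr'; rewrite /Q /= asboolT //.
by exists j.
Qed.

End HasSum.

(** * Extracting linear coefficients of polynomial functions *)

(** A polynomial of degree less than N is determined by its values at 0, ..., N - 1, so its linear
    coefficient is a fixed rational combination of them. *)
Lemma linear_coef_extractor (N : nat) : exists c : nat -> rat,
  forall p : {poly rat}, (size p <= N)%N -> \sum_(n < N) c n * p.[n%:R] = p`_1.
Proof.
case: N => [|N].
  by exists (fun=> 0) => p; rewrite leqn0 size_poly_eq0 => /eqP ->; rewrite big_ord0 coef0.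
have inj : injective (fun n : nat => n%:R : rat).
  by move=> m n /eqP; rewrite eqr_nat => /eqP.
(* The weight at n is the linear coefficient of the n-th Lagrange polynomial; the value 0 beyond N
   is never reached by the sum. *)
exists (fun n => if insub n is Some i then
  (tnth (lagrange N.+1 (fun n : nat => n%:R : rat)) i : {poly rat})`_1 else 0).
move=> p hp; rewrite [in RHS](lagrange_gen _ inj hp) // coef_sum.
by apply: eq_bigr => i _; rewrite valK coefCM mulrC.
Qed.

(** The binomial coefficient X over j, as a polynomial in X. *)
Definition binpoly (j : nat) : {poly rat} :=
  j`!%:R^-1 *: \prod_(i < j) ('X - i%:R%:P).

Lemma size_binpoly j : (size (binpoly j) <= j.+1)%N.
Proof.
apply: leq_trans (size_scale_leq _ _) _.
by rewrite size_prod_XsubC /index_enum -enumT size_enum_ord.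
Qed.

Lemma fact_neq0 j : j`!%:R != 0 :> rat.
Proof. by rewrite pnatr_eq0 -lt0n fact_gt0. Qed.

Lemma horner_binpoly j n : (binpoly j).[n%:R] = 'C(n, j)%:R.
Proof.
have e : \prod_(i < j) (n%:R - i%:R) = (n ^_ j)%:R :> rat.
  case: (leqP j n) => [jn|nj].
    rewrite ffact_prod natr_prod; apply: eq_bigr => i _.
    by rewrite natrB // (leq_trans _ jn) // ltnW.
  by rewrite ffact_small // (bigD1 (Ordinal nj)) //= subrr mul0r.
rewrite hornerZ horner_prod.
under eq_bigr do rewrite hornerXsubC.
rewrite e -bin_ffact natrM mulrCA mulVf ?mulr1 //; exact: fact_neq0.
Qed.

Lemma coef0_binpoly j : (0 < j)%N -> (binpoly j)`_0 = 0.
Proof.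
case: j => // j _; rewrite coefZ big_ord_recl /= subr0 coefXM eqxx mulr0 //.
Qed.

(** These are the coefficients of the logarithm series: log Q is the derivative at n = 0 of Q^n,
    expanded by the binomial theorem. *)
Lemma coef1_binpoly j : (binpoly j.+1)`_1 = (-1) ^+ j / j.+1%:R.
Proof.
rewrite coefZ big_ord_recl /= subr0 coefXM /= -horner_coef0 horner_prod.
have -> : \prod_(i < j) ('X - (bump 0 i)%:R%:P).[0] = (-1) ^+ j * j`!%:R :> rat.
  rewrite fact_prod big_add1 /= big_mkord natr_prod.
  elim: j => [|j IH]; first by rewrite !big_ord0 mulr1.
  rewrite !big_ord_recr /= IH hornerXsubC sub0r exprS mulN1r.
  by rewrite !mulNr mulrN -!mulrA.
rewrite factS natrM invfM mulrCA; congr (_ * _).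
by rewrite -mulrA mulVf ?mulr1 //; exact: fact_neq0.
Qed.

(** * Exponential and logarithm *)

Section ExpLog.
Variables (k : comPzRingType) (q : {rmorphism rat -> k}) (I : Type).
Implicit Types (P Q R : fps k I) (w : seq I).

Local Notation exp P := (sexp q (P : fps k I) : fps k I).
Local Notation log Q := (slog q (Q : fps k I) : fps k I).
Local Notation ifact n := (q (n`!%:R^-1)).

Lemma hs_exp P : P [::] = 0 -> hs (fun n => ifact n *: P ^+ n) (exp P).
Proof.
move=> P0; have e n : ifact n *: P ^+ n = sscale (ifact n) (spow P n).
  by rewrite spowE.
apply: (hs_ext (fun n => esym (e n))); apply: hs_sum => w.
exists (iota 0 (size w).+1 : seq {classic nat}) => n.
rewrite mem_classic mem_iota add0n -leqNgt /= => hn.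
by rewrite -(e n) cZ ordgeX0 ?mulr0.
Qed.

Lemma hs_log Q : Q [::] = 1 ->
  hs (fun n => q ((-1) ^+ n / n.+1%:R) *: (Q - 1) ^+ n.+1) (log Q).
Proof.
move=> Q1; have Q0 : (Q - 1) [::] = 0 by rewrite cB Q1 c1 subrr.
have e n : q ((-1) ^+ n / n.+1%:R) *: (Q - 1) ^+ n.+1 =
    sscale (q ((-1) ^+ n / n.+1%:R)) (spow (sadd Q (sopp (sone k I))) n.+1).
  by rewrite spowE.
apply: (hs_ext (fun n => esym (e n))); apply: hs_sum => w.
exists (iota 0 (size w).+1 : seq {classic nat}) => n.
rewrite mem_classic mem_iota add0n -leqNgt /= => hn.
by rewrite -(e n) cZ ordgeX0 ?mulr0 // ltnW.
Qed.

Lemma expE P w N : P [::] = 0 -> (size w < N)%N ->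
  (exp P) w = \sum_(n < N) ifact n * (P ^+ n) w.
Proof.
move=> P0 hw; apply: fs_fun (hs_exp P0 w) _.
apply: (@fs_ord _ _ (fun n => ifact n * (P ^+ n) w)) => n hn.
by rewrite ordgeX0 ?mulr0 //; exact: leq_trans hn.
Qed.

Lemma logE Q w N : Q [::] = 1 -> (size w <= N)%N ->
  (log Q) w = \sum_(n < N) q ((-1) ^+ n / n.+1%:R) * ((Q - 1) ^+ n.+1) w.
Proof.
move=> Q1 hw; apply: fs_fun (hs_log Q1 w) _.
apply: (@fs_ord _ _ (fun n => q ((-1) ^+ n / n.+1%:R) * ((Q - 1) ^+ n.+1) w)).
move=> n hn; rewrite ordgeX0 ?mulr0 //; first by rewrite cB Q1 c1 subrr.
by rewrite ltnS; exact: leq_trans hn.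
Qed.

Lemma exp_nil P : P [::] = 0 -> (exp P) [::] = 1.
Proof.
move=> P0; rewrite (expE P0 (ltnSn _)) big_ord1 expr0 c1 fact0 invr1 rmorph1.
by rewrite mul1r.
Qed.

Lemma log_nil Q : Q [::] = 1 -> (log Q) [::] = 0.
Proof. by move=> Q1; rewrite (logE Q1 (leqnn _)) big_ord0. Qed.

Lemma hs_conv (F : nat -> nat -> fps k I) S :
  hs (fun p : nat * nat => F p.1 p.2) S ->
  hs (fun n => \sum_(i < n.+1) F (n - i)%N i) S.
Proof.
move=> h w; apply: fs_ext (fs_conv (F := fun i j => F i j w) (h w)) => n.
by rewrite csum.
Qed.

Lemma ifactM n i : (i <= n)%N -> ifact n * 'C(n, i)%:R = ifact (n - i)%N * ifact i.
Proof.
move=> hi; rewrite -(rmorph_nat q) -!rmorphM; congr (q _).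
apply: (mulfI (fact_neq0 n)); rewrite mulrA mulfV ?fact_neq0 // mul1r.
rewrite -(bin_fact hi) !natrM -invfM [X in _ / X]mulrC mulfK //.
by rewrite mulf_neq0 ?fact_neq0.
Qed.

Lemma expD P R : P [::] = 0 -> R [::] = 0 -> P * R = R * P ->
  exp (P + R) = exp P * exp R.
Proof.
move=> P0 R0 c; have PR0 : (P + R) [::] = 0 by rewrite cD P0 R0 addr0.
apply: hs_fun (hs_exp PR0) _; have := hs_conv (F := fun i j => (ifact i *: P ^+ i) * (ifact j *: R ^+ j))
  (hs_mul (hs_exp P0) (hs_exp R0)).
apply: hs_ext => n; rewrite exprDn_comm // scaler_sumr; apply: eq_bigr => i _.
rewrite -fps_scaleAl -fps_scaleAr scalerA -ifactM; last by rewrite -ltnS.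
by rewrite -scalerA scaler_nat.
Qed.

Lemma exp0 : exp 0 = 1.
Proof.
have h := hs_exp (erefl : (0 : fps k I) [::] = 0).
apply: hs_fun h _; have := @hs_single k I nat (fun n => ifact n *: (0 : fps k I) ^+ n) 0%N.
rewrite fact0 invr1 rmorph1 scale1r expr0; apply=> -[//|n] _.
by rewrite expr0n scaler0.
Qed.

Lemma expNl P : P [::] = 0 -> exp (- P) * exp P = 1.
Proof.
move=> P0; rewrite -expD ?addNr ?exp0 //; first by rewrite cN P0 oppr0.
by rewrite mulNr mulrN.
Qed.

Lemma expNr P : P [::] = 0 -> exp P * exp (- P) = 1.
Proof.
by move=> P0; have := @expNl (- P); rewrite opprK; apply; rewrite cN P0 oppr0.
Qed.

Lemma exp_scaleD (a b : k) P : P [::] = 0 ->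
  exp ((a + b) *: P) = exp (a *: P) * exp (b *: P).
Proof.
move=> P0; rewrite scalerDl expD ?cZ ?P0 ?mulr0 //.
by rewrite -!fps_scaleAl -!fps_scaleAr !scalerA mulrC.
Qed.

Lemma exp_natX P n : P [::] = 0 -> exp (n%:R *: P) = exp P ^+ n.
Proof.
move=> P0; elim: n => [|n IH]; first by rewrite scale0r exp0 expr0.
by rewrite -natr1 exp_scaleD // IH scale1r exprSr.
Qed.

(** The binomial theorem for Q = 1 + (Q - 1); the sum may stop at N because (Q - 1)^j has order at
    least j. *)
Lemma pow_binpoly Q w N n : Q [::] = 1 -> (size w < N)%N ->
  (Q ^+ n) w = \sum_(j < N) q (binpoly j).[n%:R] * ((Q - 1) ^+ j) w.
Proof.
move=> Q1 hw; have Q0 : (Q - 1) [::] = 0 by rewrite cB Q1 c1 subrr.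
rewrite -[in LHS](subrK 1 Q) exprD1n csum.
(* Both sums are extended to a common range; the added terms vanish, on one side because the
   binomial coefficient is 0 and on the other because of the order. *)
rewrite (big_ord_widen (n.+1 + N) (fun i => ((Q - 1) ^+ i *+ 'C(n, i)) w)) ?leq_addr //.
rewrite (big_ord_widen (n.+1 + N) (fun j => q (binpoly j).[n%:R] * ((Q - 1) ^+ j) w)) ?leq_addl //.
rewrite [LHS]big_mkcond [RHS]big_mkcond; apply: eq_bigr => j _.
rewrite horner_binpoly rmorph_nat -scaler_nat cZ.
case: (ltnP j n.+1) => hj; case: (ltnP j N) => hj' //.
  by rewrite ordgeX0 ?mulr0 //; exact: leq_trans hj'.
by rewrite bin_small ?mul0r.
Qed.

(* The coefficients of [Q ^+ n] are polynomial functions of [n], with linear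
   coefficient those of [log Q]. *)
Lemma log_linear_coef Q w (N : nat) (c : nat -> rat) : Q [::] = 1 ->
  (size w < N)%N ->
  (forall p : {poly rat}, (size p <= N)%N ->
     \sum_(n < N) c n * p.[n%:R] = p`_1) ->
  (log Q) w = \sum_(n < N) q (c n) * (Q ^+ n) w.
Proof.
case: N => // N Q1 hw hc.
under [RHS]eq_bigr do rewrite (pow_binpoly _ Q1 hw) mulr_sumr.
rewrite exchange_big /= (@logE _ _ N) //.
have e (j : 'I_N.+1) : \sum_(n < N.+1) q (c n) * (q (binpoly j).[n%:R] * ((Q - 1) ^+ j) w) =
    q (binpoly j)`_1 * ((Q - 1) ^+ j) w.
  rewrite -hc ?(leq_trans (size_binpoly j)) // rmorph_sum mulr_suml.
  by apply: eq_bigr => n _; rewrite rmorphM mulrA.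
under [RHS]eq_bigr do rewrite e.
rewrite big_ord_recl /= {1}/binpoly big_ord0 alg_polyC coefC rmorph0 mul0r add0r.
by apply: eq_bigr => j _; rewrite coef1_binpoly.
Qed.

(** The power (exp P)^n is exp(n P), whose coefficients are the polynomials in n given by the sum of
    n^j P^j / j!; their linear coefficient is P. *)
Lemma log_exp P : P [::] = 0 -> log (exp P) = P.
Proof.
move=> P0; apply: funext => w.
(* The bound is one more than the length requires, so that the term j = 1 is present even for the
   empty word. *)
have [c hc] := linear_coef_extractor (size w).+2.
rewrite (log_linear_coef (exp_nil P0) (leqnSn _) hc).
have e n : (exp P ^+ n) w =
    \sum_(j < (size w).+2) q ('X^j).[n%:R] * (ifact j * (P ^+ j) w).
  rewrite -exp_natX // (@expE _ _ (size w).+2) ?cZ ?P0 ?mulr0 //.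
  apply: eq_bigr => j _; rewrite fps_exprZn cZ hornerXn rmorphXn /= rmorph_nat.
  by rewrite mulrCA.
under eq_bigr do rewrite e mulr_sumr.
rewrite exchange_big /=.
have e' (j : 'I_(size w).+2) : \sum_(n < (size w).+2) q (c n) * (q ('X^j).[n%:R] *
    (ifact j * (P ^+ j) w)) = q ('X^j)`_1 * (ifact j * (P ^+ j) w).
  rewrite -hc ?size_polyXn // rmorph_sum mulr_suml.
  by apply: eq_bigr => n _; rewrite rmorphM mulrA.
under eq_bigr do rewrite e' coefXn.
rewrite 2!big_ord_recl big1 /=; last by move=> i _; rewrite rmorph0 mul0r.
by rewrite rmorph0 mul0r add0r addr0 !(rmorph1, invr1, mul1r, expr1).
Qed.

Lemma eqon_exp W P P' : factor_closed W -> P [::] = 0 -> P' [::] = 0 ->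
  eqon W P P' -> eqon W (exp P) (exp P').
Proof.
move=> cW P0 P0' h; apply: hs_eqon (hs_exp P0) (hs_exp P0') _ => n.
by apply: eqonZ; exact: eqonX.
Qed.

Lemma eqon_log W Q Q' : factor_closed W -> Q [::] = 1 -> Q' [::] = 1 ->
  eqon W Q Q' -> eqon W (log Q) (log Q').
Proof.
move=> cW Q1 Q1' h; apply: hs_eqon (hs_log Q1) (hs_log Q1') _ => n.
by apply: eqonZ; apply: eqonX => //; apply: eqonB.
Qed.

Lemma log1 : log 1 = 0.
Proof. by rewrite -exp0 log_exp. Qed.

Lemma log_order Q n : Q [::] = 1 -> ordge n (Q - 1) -> (0 < n)%N ->
  ordge n.*2 (log Q - (Q - 1)).
Proof.
move=> Q1 h n0 w hw.
rewrite cB (@logE _ _ (size w).+1) // big_ord_recl /= expr0 divr1 rmorph1 mul1r expr1.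
rewrite big1 ?addr0 ?subrr // => i _.
rewrite (@ordgeX _ _ n (Q - 1) (bump 0 i).+1) ?mulr0 //.
by rewrite /shorter (leq_trans hw) // -mul2n leq_mul2r /bump leq0n orbT.
Qed.

(** Apart from a constant, log Q - Q contains only powers of Q - 1 of exponent at least 2, in which
    a change of Q at length n is multiplied by a series without constant term. This lets [log_inj]
    proceed by induction on the length. *)
Lemma log_eq_upto Q Q' n : Q [::] = 1 -> Q' [::] = 1 -> (0 < n)%N ->
  eqon (shorter n) Q Q' -> eqon (shorter n.+1) (log Q - Q) (log Q' - Q').
Proof.
move=> Q1 Q1' n0 h w hw; rewrite !cB !(@logE _ w (size w).+1) //.
rewrite !big_ord_recl /= expr0 divr1 rmorph1 !mul1r !expr1 !cB.
have e (a b c : k) : a - b + c - a = c - b.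
  by rewrite addrAC (addrC a) addrK addrC.
rewrite !e; congr (_ - _); apply: eq_bigr => i _; congr (_ * _).
rewrite /bump leq0n add1n exprS [in RHS]exprS !exprS.
have hA : eqon (shorter n) (Q - 1) (Q' - 1) by apply: eqonB.
have h0 P : P [::] = 1 -> (P - 1) [::] = 0 by move=> P1; rewrite cB P1 c1 subrr.
apply/eqP; rewrite -subr_eq0 -cB; apply/eqP.
(* Telescoping writes a difference of powers as two products, each with one factor of order n and
   one of order 1. *)
have swap (A B C D : fps k I) : A * C - B * D = (A - B) * C + B * (C - D).
  by rewrite mulrBl mulrBr addrA subrK.
set A := Q - 1; set B := Q' - 1; set m := nat_of_ord i.
rewrite swap.
have o1 : ordge n (A - B) by apply: (ordgeP _ _ _).1.
have o2 : ordge n (A * A ^+ m - B * B ^+ m).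
  apply: (ordgeP _ _ _).1; apply: eqonM => //; first exact: shorter_closed.
  apply: eqonX => //; exact: shorter_closed.
have oA : ordge 1 (A * A ^+ m).
  by apply/ordge1P; rewrite cM_nil /A h0 // mul0r.
have oB : ordge 1 B by apply/ordge1P; rewrite /B h0.
have d1 := ordgeM o1 oA; have d2 := ordgeM oB o2.
rewrite addn1 in d1; rewrite add1n in d2.
by rewrite cD d1 // d2 // addr0.
Qed.

Lemma log_inj Q Q' : Q [::] = 1 -> Q' [::] = 1 -> log Q = log Q' -> Q = Q'.
Proof.
move=> Q1 Q1' e; apply: funext => w.
suff h n : eqon (shorter n.+1) Q Q' by apply: (h (size w)); rewrite /shorter.
elim: n => [[|//] _|n IH]; first by rewrite Q1 Q1'.
move=> u hu; have := log_eq_upto Q1 Q1' (ltn0Sn _) IH hu.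
by rewrite !cB e => /addrI /oppr_inj.
Qed.

(** Both sides have the same logarithm by [log_exp], so injectivity replaces a second computation
    with coefficients. *)
Lemma exp_log Q : Q [::] = 1 -> exp (log Q) = Q.
Proof.
move=> Q1; have l0 := log_nil Q1.
by apply: log_inj; rewrite ?exp_nil ?log_exp.
Qed.

End ExpLog.

(** * Shuffles: primitive and group-like series *)

Section Shuffle.
Variables (k : comPzRingType) (I : Type).
Implicit Types (P Q R : fps k I) (u v w : seq I).

(* The value at [P] of the shuffle product of [u] and [v]. *)
Fixpoint sh u : seq I -> fps k I -> k :=
  match u with
  | [::] => fun v P => P v
  | a :: u' => fix shu v P :=
      match v with
      | [::] => P (a :: u')
      | b :: v' => sh u' (b :: v') (lder a P) + shu v' (lder b P)
      end
  end.

Lemma sh_nill v P : sh [::] v P = P v. Proof. by []. Qed.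
Lemma sh_nilr u P : sh u [::] P = P u. Proof. by case: u. Qed.
Lemma sh_cons a u b v P : sh (a :: u) (b :: v) P =
  sh u (b :: v) (lder a P) + sh (a :: u) v (lder b P).
Proof. by []. Qed.

(** The induction that follows the nested recursion of [sh]. *)
Lemma sh_rec (F : seq I -> seq I -> Prop) :
  (forall v, F [::] v) -> (forall u, F u [::]) ->
  (forall a u b v, F u (b :: v) -> F (a :: u) v -> F (a :: u) (b :: v)) ->
  forall u v, F u v.
Proof. by move=> h0 h1 h; elim=> // a u IHu; elim=> // b v IHv; exact: h. Qed.

Lemma shD u v P Q : sh u v (P + Q) = sh u v P + sh u v Q.
Proof.
move: u v P Q; apply: sh_rec => [v|u|a u b v IH1 IH2] P Q; rewrite ?sh_nilr //.
by rewrite !sh_cons IH1 IH2 addrACA.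
Qed.

Lemma shZ u v c P : sh u v (c *: P) = c * sh u v P.
Proof.
move: u v P; apply: sh_rec => [v|u|a u b v IH1 IH2] P; rewrite ?sh_nilr //.
by rewrite !sh_cons IH1 IH2 mulrDr.
Qed.

Lemma shN u v P : sh u v (- P) = - sh u v P.
Proof. by rewrite -scaleN1r shZ mulN1r. Qed.

Lemma sh0 u v : sh u v 0 = 0.
Proof. by rewrite -[X in sh u v X](scale0r 0) shZ mul0r. Qed.

Lemma sh_sum (T : Type) (r : seq T) (F : T -> fps k I) u v :
  sh u v (\sum_(i <- r) F i) = \sum_(i <- r) sh u v (F i).
Proof.
by elim: r => [|a r IH]; rewrite ?big_nil ?sh0 // !big_cons shD IH.
Qed.

Lemma hs_lder (J : Type) (P : J -> fps k I) S a :
  hs P S -> hs (fun j => lder a (P j)) (lder a S).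
Proof. by move=> h w; exact: h. Qed.

Lemma hs_sh (J : Type) (P : J -> fps k I) S u v :
  hs P S -> fs (fun j => sh u v (P j)) (sh u v S).
Proof.
move: u v P S; apply: sh_rec => [v|u|a u b v IH1 IH2] P S h.
- exact: h.
- rewrite sh_nilr; apply: fs_ext (h u) => j; by rewrite sh_nilr.
- by apply: fs_add; [apply: IH1 | apply: IH2]; exact: hs_lder.
Qed.

(** All words in the shuffle of [u] and [v] have length [size u + size v]. *)
Lemma sh_shorter u v P Q :
  eqon (shorter (size u + size v).+1) P Q -> sh u v P = sh u v Q.
Proof.
move: u v P Q; apply: sh_rec => [v|u|a u b v IH1 IH2] P Q h.
- by apply: h; rewrite /shorter.
- by rewrite !sh_nilr; apply: h; rewrite /shorter addn0.
- rewrite !sh_cons; congr (_ + _).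
    by apply: IH1 => w hw; apply: h; rewrite /shorter /= addSn ltnS.
  by apply: IH2 => w hw; apply: h; move: hw; rewrite /shorter /= addnS ltnS.
Qed.

Lemma lderM a P Q : lder a (P * Q) = P [::] *: lder a Q + lder a P * Q.
Proof. exact: lder_smul. Qed.

(** Shuffles are compatible with deconcatenation: the coproduct dual to the shuffle product is a
    ring morphism. Closure of group-like series under products and of primitive ones under brackets
    rests on this. *)
Lemma shM u v P Q : sh u v (P * Q) =
  \sum_(n < (size u).+1) \sum_(m < (size v).+1)
    sh (take n u) (take m v) P * sh (drop n u) (drop m v) Q.
Proof.
move: u v P Q; apply: sh_rec => [v|u|a u b v IH1 IH2] P Q.
- by rewrite big_ord1.
- rewrite sh_nilr cM; apply: eq_bigr => n _.
  by rewrite big_ord1 /= !sh_nilr.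
(* The terms with an empty prefix of [a :: u] or of [b :: v] are split off, because the recursion of
   [sh] degenerates there; the other terms match one by one. *)
rewrite sh_cons !lderM !shD !shZ IH1 IH2 [RHS]big_ord_recl.
rewrite [X in _ = X + _]big_ord_recl.
rewrite [size (a :: u)]/= [X in (_ + X) + _ = _](eq_bigr (fun n : 'I_(size u).+1 =>
   sh (take n u) [::] (lder a P) * sh (drop n u) (b :: v) Q +
   \sum_(m < (size v).+1) sh (take n u) (b :: take m v) (lder a P) * sh (drop n u) (drop m v) Q)); last first.
  by move=> n _; rewrite big_ord_recl.
rewrite [X in _ + (_ + X) = _]big_ord_recl /=.
rewrite [X in _ = _ + X](eq_bigr (fun n : 'I_(size u).+1 =>
   sh (take n u) [::] (lder a P) * sh (drop n u) (b :: v) Q +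
   ((\sum_(m < (size v).+1) sh (take n u) (b :: take m v) (lder a P) * sh (drop n u) (drop m v) Q) +
    \sum_(m < (size v).+1) sh (a :: take n u) (take m v) (lder b P) * sh (drop n u) (drop m v) Q))); last first.
  move=> n _; rewrite big_ord_recl /= sh_nilr; congr (_ + _).
  by rewrite -big_split; apply: eq_bigr => m _; exact: mulrDl.
rewrite !big_split /=; ring.
Qed.

(** The coproduct dual to the shuffle sends P to P (x) 1 + 1 (x) P, read at the pair (u, v); the
    unit series tests whether a word is empty. *)
Definition prim P := forall u v,
  sh u v P = P u * (1 : fps k I) v + (1 : fps k I) u * P v.

Definition grouplike Q := Q [::] = 1 /\ forall u v, sh u v Q = Q u * Q v.

(** In coordinates: (f (x) g)(f' (x) g') = f f' (x) g g' in the tensor square of the series ring. *)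
Lemma sh_tensorM (f g f' g' : fps k I) u v :
  \sum_(n < (size u).+1) \sum_(m < (size v).+1)
    (f (take n u) * g (take m v)) * (f' (drop n u) * g' (drop m v)) =
  (f * f') u * (g * g') v.
Proof.
rewrite !cM big_distrlr /=; apply: eq_bigr => n _; apply: eq_bigr => m _.
by rewrite mulrACA.
Qed.

Lemma grouplike1 : grouplike 1.
Proof.
split=> // u v; move: u v; apply: sh_rec => [v|u|a u b v _ _].
- by rewrite sh_nill c1 mul1r.
- by rewrite sh_nilr c1 mulr1.
- have e c : lder c (1 : fps k I) = 0 by [].
  by rewrite sh_cons !e !sh0 addr0 c1 mul0r.
Qed.

Lemma grouplikeM P Q : grouplike P -> grouplike Q -> grouplike (P * Q).
Proof.
move=> [P1 hP] [Q1 hQ]; split=> [|u v]; first by rewrite cM_nil P1 Q1 mulr1.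
rewrite shM -sh_tensorM; apply: eq_bigr => n _; apply: eq_bigr => m _.
by rewrite hP hQ mulrACA.
Qed.

Lemma grouplikeX Q n : grouplike Q -> grouplike (Q ^+ n).
Proof.
move=> h; elim: n => [|n IH]; first exact: grouplike1.
by rewrite exprS; exact: grouplikeM.
Qed.

Lemma grouplike_loc Q :
  (forall w, exists2 R, grouplike R & eqon (factor_of w) Q R) -> Q [::] = 1.
Proof. by move=> /(_ [::])[R [R1 _] ->] //; exact: factor_of_refl. Qed.

Lemma prim_nil P : prim P -> P [::] = 0.
Proof.
move=> h; have := h [::] [::]; rewrite sh_nill c1 mulr1 mul1r => e.
by apply: (@addrI _ (P [::])); rewrite -e addr0.
Qed.

Lemma primP P : P [::] = 0 ->
  (forall a u b v, sh (a :: u) (b :: v) P = 0) -> prim P.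
Proof.
move=> P0 h [|a u] [|b v]; rewrite ?sh_nilr ?sh_nill ?c1 ?P0 ?mulr0 ?mul0r ?addr0 //.
- by rewrite mul1r add0r.
- by rewrite mulr1.
Qed.

(** The expansion of (P (x) 1 + 1 (x) P)(Q (x) 1 + 1 (x) Q). *)
Lemma prim_tensor P Q u v : prim P -> prim Q ->
  sh u v (P * Q) = (P * Q) u * (1 : fps k I) v + P u * Q v +
    (Q u * P v + (1 : fps k I) u * (P * Q) v).
Proof.
move=> hP hQ; rewrite shM.
under eq_bigr => n _ do under eq_bigr => m _ do rewrite hP hQ mulrDl !mulrDr.
under eq_bigr => n _ do rewrite !big_split /=.
by rewrite !big_split /= !sh_tensorM !(mulr1, mul1r).
Qed.

(** The mixed terms P (x) Q + Q (x) P are symmetric in P and Q, hence cancel in the bracket. *)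
Lemma prim_bracket P Q : prim P -> prim Q -> prim (P * Q - Q * P).
Proof.
move=> hP hQ u v; rewrite shD shN !prim_tensor // !cB mulrBl mulrBr.
ring.
Qed.

End Shuffle.

(** * Exponentials of primitive series and logarithms of group-like series *)

Section ExpLogShuffle.
Variables (k : comPzRingType) (q : {rmorphism rat -> k}) (I : Type).
Implicit Types (P Q R : fps k I) (u v w : seq I).

Local Notation exp P := (sexp q (P : fps k I) : fps k I).
Local Notation log Q := (slog q (Q : fps k I) : fps k I).
Local Notation ifact n := (q (n`!%:R^-1)).

(** The inductive step of the binomial formula, in the form needed for [sh_primX]. *)
Lemma pascal_sum (g : nat -> nat -> k) n :
  \sum_(j < n.+1) (g (n - j).+1 j + g (n - j)%N j.+1) * 'C(n, j)%:R =
  \sum_(j < n.+2) g (n.+1 - j)%N j * 'C(n.+1, j)%:R.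
Proof.
rewrite [RHS]big_ord_recl /= subn0 bin0 mulr1.
under [X in _ = _ + X]eq_bigr => j _ do rewrite /bump leq0n add1n subSS binS natrD mulrDr.
rewrite big_split /= addrA.
under eq_bigr => j _ do rewrite mulrDl.
rewrite big_split /=; congr (_ + _).
rewrite [X in _ = _ + X]big_ord_recr /= bin_small // mulr0 addr0 big_ord_recl /= subn0 bin0 mulr1.
by congr (_ + _); apply: eq_bigr => j _; rewrite /bump leq0n add1n subnSK.
Qed.

(** The binomial theorem for P (x) 1 and 1 (x) P, which commute. *)
Lemma sh_primX P n u v : prim P ->
  sh u v (P ^+ n) = \sum_(j < n.+1) (P ^+ (n - j)) u * (P ^+ j) v * 'C(n, j)%:R.
Proof.
move=> hP; elim: n u v => [|n IH] u v.
  by rewrite big_ord1 !expr0 mulr1; case: (grouplike1 k I) => _ ->.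
rewrite -(pascal_sum (fun i j => (P ^+ i) u * (P ^+ j) v)) exprS shM.
under eq_bigr => i _ do under eq_bigr => m _ do rewrite hP IH mulr_sumr.
under eq_bigr => i _ do rewrite exchange_big /=.
rewrite exchange_big /=; apply: eq_bigr => j _.
have e1 : (P ^+ (n - j).+1) u * (P ^+ j) v = \sum_(i < (size u).+1) \sum_(m < (size v).+1)
    (P (take i u) * (1 : fps k I) (take m v)) * ((P ^+ (n - j)) (drop i u) * (P ^+ j) (drop m v)).
  by rewrite sh_tensorM -exprS mul1r.
have e2 : (P ^+ (n - j)) u * (P ^+ j.+1) v = \sum_(i < (size u).+1) \sum_(m < (size v).+1)
    ((1 : fps k I) (take i u) * P (take m v)) * ((P ^+ (n - j)) (drop i u) * (P ^+ j) (drop m v)).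
  by rewrite sh_tensorM -exprS mul1r.
rewrite e1 e2.
rewrite -big_split mulr_suml; apply: eq_bigr => i _.
rewrite -big_split mulr_suml; apply: eq_bigr => m _ /=.
ring.
Qed.

(** In tensor notation, exp(P (x) 1 + 1 (x) P) = exp P (x) exp P. *)
Lemma grouplike_exp P : prim P -> grouplike (exp P).
Proof.
move=> hP; have P0 := prim_nil hP; split; first exact: exp_nil.
move=> u v; have h := hs_sh u v (hs_exp q P0); apply: fs_fun h _.
have := fs_conv (F := fun i j => (ifact i * (P ^+ i) u) * (ifact j * (P ^+ j) v))
  (fs_pair (hs_exp q P0 u) (hs_exp q P0 v)).
apply: fs_ext => n; rewrite shZ sh_primX // mulr_sumr; apply: eq_bigr => i _.
rewrite mulrACA -ifactM; last by rewrite -ltnS.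
ring.
Qed.

(** Every Q^n is group-like, so its value on a shuffle of two nonempty words is a product of two
    polynomials in n without constant term. The linear coefficient of such a product, which is the
    value of log Q, is 0. *)
Lemma prim_log Q : grouplike Q -> prim (log Q).
Proof.
move=> hQ; have [Q1 _] := hQ; apply: primP; first exact: log_nil.
(* One bound for both purposes: it exceeds the length of the shuffled words and the degree of the
   product of the two polynomials. *)
move=> a u b v; set N := (size (a :: u) + size (b :: v)).+1.
have [c hc] := linear_coef_extractor N.
have -> : sh (a :: u) (b :: v) (log Q) =
    sh (a :: u) (b :: v) (\sum_(n < N) q (c n) *: Q ^+ n).
  apply: sh_shorter => w hw; rewrite (log_linear_coef q Q1 hw hc) csum.
  by apply: eq_bigr => n _; rewrite cZ.
rewrite sh_sum.
pose x (i : nat) := ((Q - 1) ^+ i) (a :: u); pose y (i : nat) := ((Q - 1) ^+ i) (b :: v).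
transitivity (\sum_(i < (size u).+2) \sum_(j < (size v).+2) \sum_(n < N)
   q (c n * ((binpoly i * binpoly j).[n%:R])) * (x i * y j)).
  rewrite (eq_bigr (fun i : 'I_(size u).+2 => \sum_(n < N) \sum_(j < (size v).+2)
     q (c n * ((binpoly i * binpoly j).[n%:R])) * (x i * y j))); last first.
    by move=> i _; rewrite exchange_big.
  rewrite exchange_big; apply: eq_bigr => n _.
  rewrite shZ; have [_ ->] := grouplikeX n hQ.
  rewrite (pow_binpoly q n Q1 (ltnSn (size (a :: u)))) (pow_binpoly q n Q1 (ltnSn (size (b :: v)))).
  rewrite big_distrlr /= mulr_sumr; apply: eq_bigr => i _.
  rewrite mulr_sumr; apply: eq_bigr => j _.
  by rewrite hornerM !rmorphM /x /y; ring.
apply: big1 => i _; apply: big1 => j _.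
rewrite -mulr_suml -rmorph_sum hc; last first.
  apply: leq_trans (size_polyMleq _ _) _.
  have /= si := size_binpoly i; have /= sj := size_binpoly j.
  have hi := ltn_ord i; have hj := ltn_ord j.
  by rewrite /N /=; lia.
case: (posnP i) => [->|i0]; first by rewrite /x expr0 c1 mul0r mulr0.
case: (posnP j) => [->|j0]; first by rewrite /y expr0 c1 !mulr0.
rewrite coefM big_ord_recl big_ord1 /= !coef0_binpoly // mul0r mulr0 addr0.
by rewrite rmorph0 mul0r.
Qed.

End ExpLogShuffle.

(** * The Dynkin operator and Lie series *)

Section Dynkin.
Variables (k : comPzRingType) (I : Type).
Implicit Types (P Q R : fps k I) (u v w : seq I).

Local Notation X := (sX k : I -> fps k I).

(** The sum of X_i R_i over i, given explicitly: it exists for every family R because a word has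
    only one first letter. [rmulX] is the analogue for the last letter. *)
Definition lmulX (R : I -> fps k I) : fps k I :=
  fun u => if u is a :: u' then R a u' else 0.
Definition rmulX (R : I -> fps k I) : fps k I :=
  fun u => if u is a :: u' then R (last a u') (belast a u') else 0.

Lemma cX1 i j : X i [:: j] = (`[< j = i >])%:R.
Proof. by rewrite /sX; congr (_%:R); congr nat_of_bool; apply/asboolP/asboolP => [[]|->]. Qed.

Lemma cX_nil i : X i [::] = 0.
Proof. by rewrite /sX; case: asboolP. Qed.

Lemma cX_cons2 i a b u : X i [:: a, b & u] = 0.
Proof. by rewrite /sX; case: asboolP. Qed.

Lemma lderX i a : lder a (X i) = (`[< a = i >])%:R.
Proof.
apply: funext => -[|b u]; rewrite /lder.
  by rewrite cX1; case: asboolP.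
by rewrite cX_cons2; case: asboolP.
Qed.

Lemma cXM i R u : (X i * R) u = if u is a :: u' then
  (if `[< a = i >] then R u' else 0) else 0.
Proof.
case: u => [|a u]; first by rewrite cM_nil cX_nil mul0r.
rewrite cM_cons cX_nil mul0r add0r lderX; case: asboolP => _; first by rewrite mul1r.
by rewrite mul0r.
Qed.

Lemma cMX i R u b : (R * X i) (rcons u b) = if `[< b = i >] then R u else 0.
Proof.
elim: u R => [|a u IH] R /=.
  rewrite cM_cons cX1 cM_nil cX_nil mulr0 addr0.
  by case: asboolP; rewrite ?mulr1 ?mulr0.
rewrite cM_cons IH; case: u {IH} => [|c u]; rewrite cX_cons2 mulr0 add0r //.
Qed.

Lemma hs_lmulX (F : I -> fps k I) : hs (fun i => X i * F i) (lmulX F).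
Proof.
move=> [|a u].
  by apply: fs_ext (fs_zero k I) => i; rewrite cXM.
have -> : lmulX F (a :: u) = (X a * F a) (a :: u) by rewrite cXM asboolT.
by apply: fs_single => j ja; rewrite cXM asboolF // => /esym.
Qed.

Lemma hs_rmulX (F : I -> fps k I) : hs (fun i => F i * X i) (rmulX F).
Proof.
move=> [|a u].
  by apply: fs_ext (fs_zero k I) => i; rewrite cM_nil cX_nil mulr0.
have -> : rmulX F (a :: u) = (F (last a u) * X (last a u)) (a :: u).
  by rewrite [in RHS]lastI cMX asboolT.
by apply: fs_single => j ja; rewrite [in LHS]lastI cMX asboolF // => /esym.
Qed.

(* The Lie series [sum_w P(w) [X_w1, [X_w2, ...]]] over words of length [n + 1],
   split according to the first letter of [w]. *)
Fixpoint dynkin (n : nat) P : fps k I :=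
  match n with
  | 0 => lmulX (fun i => P [:: i] *: (1 : fps k I))
  | n'.+1 => lmulX (fun i => dynkin n' (lder i P)) -
             rmulX (fun i => dynkin n' (lder i P))
  end.

Lemma hs_dynkin0 P : hs (fun i => P [:: i] *: X i) (dynkin 0 P).
Proof.
by apply: hs_ext (hs_lmulX _) => i; rewrite -fps_scaleAr mulr1.
Qed.

Lemma hs_dynkinS n P : hs (fun i => X i * dynkin n (lder i P) -
  dynkin n (lder i P) * X i) (dynkin n.+1 P).
Proof. by apply: hs_add; [exact: hs_lmulX | apply: hs_opp; exact: hs_rmulX]. Qed.

Lemma in_LieX i : in_Lie (X i). Proof. exact: in_Lie_X. Qed.

Lemma in_Lie0 : in_Lie (0 : fps k I).
Proof. exact: (subsalg0 (in_Lie_subsalg k I)). Qed.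

Lemma in_LieD P Q : in_Lie P -> in_Lie Q -> in_Lie (P + Q).
Proof. exact: (subsalgD (in_Lie_subsalg k I)). Qed.

Lemma in_LieN P : in_Lie P -> in_Lie (- P).
Proof. exact: (subsalgN (in_Lie_subsalg k I)). Qed.

Lemma in_LieZ a P : in_Lie P -> in_Lie (a *: P).
Proof. exact: (subsalgZ (in_Lie_subsalg k I)). Qed.

Lemma in_Lie_bracket P Q : in_Lie P -> in_Lie Q -> in_Lie (P * Q - Q * P).
Proof. exact: (subsalgM (in_Lie_subsalg k I)). Qed.

Lemma in_Lie_sum (J : Type) (P : J -> fps k I) S :
  (forall j, in_Lie (P j)) -> hs P S -> in_Lie S.
Proof.
move=> h /hsP hs; apply: (subsalg_sum (in_Lie_subsalg k I) (v := P)) => //.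
Qed.

Lemma in_Lie_dynkin n P : in_Lie (dynkin n P).
Proof.
elim: n P => [|n IH] P.
  apply: in_Lie_sum (hs_dynkin0 P) => i; apply: in_LieZ; exact: in_LieX.
by apply: in_Lie_sum (hs_dynkinS n P) => i; apply: in_Lie_bracket.
Qed.

(* For [wt n = n], the coefficient of the Dynkin operator at [u], written with the
   antipode (reversal up to sign) and the shuffle product; for [wt n = 1], the
   convolution of the identity and the antipode, which vanishes. *)
Definition alt_sh (wt : nat -> k) P u : k :=
  \sum_(m < (size u).+1) (-1) ^+ (size u - m) * wt m *
     sh (take m u) (rev (drop m u)) P.

(** The first letter of a shuffle of a prefix with the reversed suffix is either the first letter of
    the word or its last one. Removing the last one shortens the suffix, whence the sign. *)
Lemma alt_sh_cons wt P a u :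
  alt_sh wt P (a :: u) = alt_sh (wt \o succn) (lder a P) u -
    alt_sh wt (lder (last a u) P) (belast a u).
Proof.
set b := last a u; set s := belast a u.
have eu : a :: u = rcons s b by rewrite /s /b -lastI.
have ss : size s = size u by rewrite /s size_belast.
pose A m := sh (take m u) (rev (drop m u)) (lder a P).
pose B m := sh (take m s) (rev (drop m s)) (lder b P).
(* At the two extreme cuts one of the shuffled words is empty and only one of the two terms
   survives. *)
have e m : (m <= (size u).+1)%N -> sh (take m (a :: u)) (rev (drop m (a :: u))) P =
   (if m is m'.+1 then A m' else 0) + (if (m <= size u)%N then B m else 0).
  case: m => [_|m].
    by rewrite /= add0r /B take0 drop0 sh_nill eu rev_rcons.
  rewrite ltnS leq_eqVlt => /orP[/eqP ->|mu].
    by rewrite /A take_oversize // drop_oversize // ltnn addr0 take_size drop_size !sh_nilr.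
  have -> : drop m.+1 (a :: u) = rcons (drop m.+1 s) b.
    by rewrite eu drop_rcons // ss.
  rewrite mu rev_rcons [take _ _]/= sh_cons; congr (_ + _).
    rewrite /A; congr sh; rewrite -rev_rcons -drop_rcons ?ss // -eu //.
  rewrite /B; congr sh; rewrite -[LHS]/(take m.+1 (a :: u)) eu.
  by rewrite -cats1 takel_cat // ss.
rewrite /alt_sh [size (a :: u)]/=.
rewrite (eq_bigr (fun m : 'I_(size u).+2 =>
    (-1) ^+ ((size u).+1 - m) * wt m * (if nat_of_ord m is m'.+1 then A m' else 0) +
    (-1) ^+ ((size u).+1 - m) * wt m * (if (m <= size u)%N then B m else 0))); last first.
  by move=> m _; rewrite e ?mulrDr // -ltnS.
rewrite big_split /=; congr (_ + _).
  by rewrite big_ord_recl mulr0 add0r; apply: eq_bigr => m _; rewrite /= /bump leq0n add1n subSS.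
rewrite big_ord_recr /= ltnn mulr0 addr0 ss -sumrN; apply: eq_bigr => m _.
by rewrite -ltnS ltn_ord subSn -1?ltnS // exprS !mulN1r !mulNr.
Qed.

Lemma alt_sh_cst P a u : alt_sh (fun=> 1) P (a :: u) = 0.
Proof.
have [n] := ubnP (size u); elim: n P a u => // n IH P a u.
rewrite alt_sh_cons; case: u => [|b u] /=; first by rewrite subrr.
by move=> hu; rewrite !IH ?subrr // size_belast.
Qed.

Lemma alt_sh_id_cons P a u : alt_sh (fun n => n%:R) P (a :: u) =
  (if u is [::] then P [:: a] else alt_sh (fun n => n%:R) (lder a P) u) -
    alt_sh (fun n => n%:R) (lder (last a u) P) (belast a u).
Proof.
rewrite alt_sh_cons; congr (_ - _).
have -> : alt_sh (GRing.natmul 1 \o succn) (lder a P) u =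
   alt_sh (fun n => n%:R) (lder a P) u + alt_sh (fun=> 1) (lder a P) u.
  rewrite /alt_sh -big_split; apply: eq_bigr => m _ /=.
  by rewrite -natr1 mulrDr mulrDl.
case: u => [|b u]; last by rewrite alt_sh_cst addr0.
by rewrite /alt_sh !big_ord1 /= !mul1r mul0r add0r.
Qed.

(** Both sides satisfy the recursion of [alt_sh_id_cons]: left multiplication by a variable reads
    the first letter, right multiplication the last. *)
Lemma dynkinE n P u : dynkin n P u =
  if size u == n.+1 then alt_sh (fun n => n%:R) P u else 0.
Proof.
elim: n P u => [|n IH] P [|a u] //=.
- case: u => [|b u] /=; last by rewrite cZ c1 mulr0.
  rewrite cZ c1 mulr1 alt_sh_id_cons /= /alt_sh big_ord1 /= mulr0 mul0r subr0 //.
- rewrite cB subr0 //.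
- rewrite cB /= !IH size_belast eqSS; case: eqP => [e|]; last by rewrite subr0.
  by case: u e => // b u _; rewrite [RHS]alt_sh_id_cons.
Qed.

(** The Dynkin-Specht-Wever identity: a primitive series vanishes on proper shuffles and the empty
    prefix has weight 0, so only the full prefix, of weight n + 1, contributes. *)
Lemma dynkin_prim n P u : prim P ->
  dynkin n P u = if size u == n.+1 then n.+1%:R * P u else 0.
Proof.
move=> hP; rewrite dynkinE; case: eqP => // e.
rewrite /alt_sh e big_ord_recr /= subnn expr0 mul1r.
rewrite take_oversize ?e // drop_oversize ?e // sh_nilr big1 ?add0r // => m _.
case: (posnP m) => [->|m0]; first by rewrite mulr0 mul0r.
suff -> : sh (take m u) (rev (drop m u)) P = 0 by rewrite mulr0.
have hm := ltn_ord m.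
have : (0 < size (take m u))%N by rewrite size_take e; case: ifP.
have : (0 < size (rev (drop m u)))%N by rewrite size_rev size_drop e subn_gt0.
rewrite hP; case: (take m u) => // ? ?; case: (rev _) => // ? ? _ _.
by rewrite !c1 mulr0 mul0r addr0.
Qed.

Lemma prim0 : prim (0 : fps k I).
Proof. by move=> u v; rewrite sh0 mul0r mulr0 addr0. Qed.

Lemma primD P Q : prim P -> prim Q -> prim (P + Q).
Proof.
by move=> hP hQ u v; rewrite shD hP hQ !cD mulrDl mulrDr addrACA.
Qed.

Lemma primZ a P : prim P -> prim (a *: P).
Proof. by move=> hP u v; rewrite shZ hP !cZ; ring. Qed.

Lemma prim_sum (J : Type) (P : J -> fps k I) S :
  (forall j, prim (P j)) -> hs P S -> prim S.
Proof.
move=> hP h u v; apply: fs_fun (hs_sh u v h) _; rewrite (mulrC (S u)).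
apply: fs_ext (fs_add (fs_scale ((1 : fps k I) v) (h u)) (fs_scale ((1 : fps k I) u) (h v))) => j.
by rewrite hP (mulrC (P j u)).
Qed.

Lemma prim_subsalg : @is_subsalg k (series_lie k I) (@prim k I).
Proof.
split.
- exact: prim0.
- exact: primD.
- by move=> P hP; have := primZ (-1) hP; rewrite scaleN1r.
- exact: primZ.
- exact: prim_bracket.
- by move=> J P S hP /hsP; exact: prim_sum.
Qed.

Lemma prim_X i : prim (X i).
Proof.
apply: primP; first exact: cX_nil.
move=> a u b v; rewrite sh_cons !lderX.
have nat1 (c : bool) u' : (c%:R : fps k I) u' = c%:R * (1 : fps k I) u'.
  by case: c; rewrite ?mul1r ?mul0r.
have e (c : bool) s t : sh s t (c%:R : fps k I) = c%:R * ((1 : fps k I) s * (1 : fps k I) t).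
  by case: c; rewrite ?sh0 ?mul0r // mul1r; case: (grouplike1 k I).
by rewrite !e !c1 /= !(mulr0, mul0r) addr0.
Qed.

Lemma in_Lie_prim P : in_Lie P -> prim P.
Proof. by move=> h; apply: h prim_subsalg prim_X. Qed.

End Dynkin.

(** * Friedrichs' criterion *)

Section LieGroup.
Variables (k : comPzRingType) (q : {rmorphism rat -> k}) (I : Type).
Implicit Types (P Q R : fps k I) (u v w : seq I).

Local Notation exp P := (sexp q (P : fps k I) : fps k I).
Local Notation log Q := (slog q (Q : fps k I) : fps k I).

Lemma invnK n : q (n.+1%:R^-1) * n.+1%:R = 1.
Proof. by rewrite -(rmorph_nat q) -rmorphM mulVf ?rmorph1 // pnatr_eq0. Qed.

(** By [dynkin_prim], P is the sum over n of [dynkin n P] divided by n + 1, and each of these is a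
    Lie series. The division needs the rationals in [k]. *)
Lemma prim_in_Lie P : prim P -> in_Lie P.
Proof.
move=> hP.
have h : hs (fun n => q (n.+1%:R^-1) *: dynkin n P) P.
  move=> u; have P0 := prim_nil hP.
  (* For the empty word the predecessor is 0, and both sides vanish because P has no constant
     term. *)
  have -> : P u = (q ((size u).-1.+1%:R^-1) *: dynkin (size u).-1 P) u.
    rewrite cZ dynkin_prim //; case: u => [|a u] /=; first by rewrite P0 mulr0.
    by rewrite eqxx mulrA invnK mul1r.
  apply: (fs_single (f := fun n => (q (n.+1%:R^-1) *: dynkin n P) u)) => n hn.
  rewrite cZ dynkin_prim //; case: eqP => [e|]; last by rewrite mulr0.
  by case: hn; rewrite e.
by apply: in_Lie_sum h => n; apply: in_LieZ; exact: in_Lie_dynkin.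
Qed.

Lemma in_LieP P : in_Lie P <-> prim P.
Proof. by split; [exact: in_Lie_prim | exact: prim_in_Lie]. Qed.

Lemma in_Lie_nil P : in_Lie P -> P [::] = 0.
Proof. by move=> /in_Lie_prim /prim_nil. Qed.

Lemma in_GrP Q : in_Gr q Q <-> grouplike Q.
Proof.
split=> [[P /in_LieP hP ->]|hQ]; first exact: grouplike_exp.
exists (log Q); first by apply/in_LieP; exact: prim_log.
by rewrite exp_log //; case: hQ.
Qed.

Lemma in_Gr_nil Q : in_Gr q Q -> Q [::] = 1.
Proof. by move=> /in_GrP[]. Qed.

Lemma in_Lie_log Q : in_Gr q Q -> in_Lie (log Q).
Proof. by move=> /in_GrP h; apply/in_LieP; exact: prim_log. Qed.

Lemma in_Gr_exp P : in_Lie P -> in_Gr q (exp P).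
Proof. by move=> h; exists P. Qed.

Lemma in_GrM Q R : in_Gr q Q -> in_Gr q R -> in_Gr q (Q * R).
Proof. by move=> /in_GrP h /in_GrP h'; apply/in_GrP; exact: grouplikeM. Qed.

Lemma in_Gr1 : in_Gr q (1 : fps k I).
Proof. by apply/in_GrP; exact: grouplike1. Qed.

Lemma in_Gr_prod (T : Type) (r : seq T) (F : T -> fps k I) :
  (forall i, in_Gr q (F i)) -> in_Gr q (\prod_(i <- r) F i).
Proof.
move=> h; elim: r => [|a r IH]; rewrite ?big_nil ?big_cons; first exact: in_Gr1.
exact: in_GrM.
Qed.

End LieGroup.

(** * Infinite ordered products *)

Section LinearOrders.
Variable J : los.
Implicit Types (s t : seq {classic J}) (a b i j : {classic J}).
Local Notation incr s := (@increasing J s).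
Local Notation "x \ll y" := (@los_lt J x y) (at level 70).

Lemma los_irr a : ~ a \ll a.
Proof. exact: lin_irr (los_lin J) a. Qed.

Lemma los_trans b a c : a \ll b -> b \ll c -> a \ll c.
Proof. exact: (lin_trans (los_lin J)). Qed.

Lemma los_total a b : a \ll b \/ a = b \/ b \ll a.
Proof. exact: (lin_total (los_lin J)). Qed.

Lemma incr_nil : incr [::]. Proof. exact: SSorted_nil. Qed.

Lemma incr_cons a s : incr (a :: s) <-> (forall b, b \in s -> a \ll b) /\ incr s.
Proof.
have FP : List.Forall (@los_lt J a) s <-> (forall b, b \in s -> a \ll b).
  elim: s => [|c s IH]; first by split=> // _; exact: List.Forall_nil.
  split=> [h b|h].
    inversion h; subst; rewrite inE => /orP[/eqP->//|]; exact: (IH.1 H2).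
  apply: List.Forall_cons; first by apply: h; rewrite inE eqxx.
  by apply: IH.2 => b bs; apply: h; rewrite inE bs orbT.
split=> [h|[h1 h2]].
  by have [h1 h2] := StronglySorted_inv h; split=> //; exact: FP.1 h2.
by apply: SSorted_cons => //; exact: FP.2.
Qed.

Lemma incr_notin a s : incr (a :: s) -> a \notin s.
Proof. by move=> /incr_cons[h _]; apply/negP => /h; exact: los_irr. Qed.

Lemma incr_uniq s : incr s -> uniq s.
Proof.
elim: s => // a s IH h /=; rewrite (incr_notin h) /=.
by apply: IH; case/incr_cons: h.
Qed.

Lemma incr_insert a t : incr t ->
  exists2 t' : seq {classic J}, incr t' & forall b, (b \in t') = (b == a) || (b \in t).
Proof.
elim: t => [|c t IH] h.
  by exists [:: a] => [|b]; [apply/incr_cons; split=> //; exact: incr_nil | rewrite inE in_nil orbF].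
have [ct ht] := (incr_cons c t).1 h.
case: (los_total a c) => [ac|[->|ca]].
- exists [:: a, c & t] => [|b]; last by rewrite !inE.
  apply/incr_cons; split=> // b; rewrite inE => /orP[/eqP->//|/ct cb].
  exact: los_trans cb.
- by exists (c :: t) => // b; rewrite !inE orbA orbb.
- have [t' ht' et'] := IH ht; exists (c :: t') => [|b]; last by rewrite !inE et' orbCA.
  by apply/incr_cons; split=> // b; rewrite et' => /orP[/eqP->//|/ct].
Qed.

Lemma incr_exists s : exists2 t : seq {classic J}, incr t & t =i s.
Proof.
elim: s => [|a s [t ht et]]; first by exists [::] => //; exact: incr_nil.
have [t' ht' et'] := incr_insert a ht; exists t' => // b.
by rewrite et' inE et.
Qed.

(** These lists index the terms in the expansion of a finite ordered product of factors 1 + y_j. *)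
Fixpoint sublists s : seq (seq {classic J}) :=
  if s is a :: s' then sublists s' ++ map (cons a) (sublists s') else [:: [::]].

Lemma nil_sublists s : [::] \in sublists s.
Proof. by elim: s => // a s IH; rewrite mem_cat IH. Qed.

Lemma sublistsP s t : incr s ->
  (t \in sublists s) <-> incr t /\ {subset t <= s}.
Proof.
elim: s t => [|a s IH] t h.
  rewrite inE; split=> [/eqP->|[_]]; first by split=> //; exact: incr_nil.
  by case: t => // b t /(_ b); rewrite inE eqxx => /(_ isT).
have [as_ hs] := (incr_cons a s).1 h.
rewrite /= mem_cat; split=> [/orP[/(IH t hs)[ht st]|/mapP[t' /(IH t' hs)[ht' st'] ->]]|[ht st]].
- by split=> // b /st bs; rewrite inE bs orbT.
- split; first by apply/incr_cons; split=> // b /st' /as_.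
  by move=> b; rewrite !inE => /orP[->//|/st' ->]; rewrite orbT.
- case: t ht st => [|b t] ht st; first by rewrite nil_sublists.
  have [bt ht'] := (incr_cons b t).1 ht; apply/orP.
  have := st b (mem_head _ _); rewrite inE => /orP[/eqP e|bs].
    right; apply/mapP; exists t; last by rewrite e.
    apply/(IH _ hs); split=> // c ct.
    have := st c; rewrite !inE ct orbT => /(_ isT) /orP[/eqP ec|//].
    by have := bt c ct; rewrite ec e => /los_irr.
  left; apply/(IH _ hs); split=> // c cbt.
  have ac : a \ll c.
    move: cbt; rewrite inE => /orP[/eqP->|/bt]; first exact: as_.
    exact: (los_trans (as_ _ bs)).
  have := st c cbt; rewrite inE => /orP[/eqP ec|//].
  by move: ac; rewrite ec => /los_irr.
Qed.

Lemma sublists_uniq s : incr s -> uniq (sublists s).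
Proof.
elim: s => // a s IH h; have [as_ hs] := (incr_cons a s).1 h.
rewrite /= cat_uniq IH // map_inj_uniq ?IH // => [|t t' []//].
rewrite andbT; apply/hasP => -[t /mapP[t' _ ->]] /= /(sublistsP _ hs)[_ st].
by have := incr_notin h; rewrite st ?mem_head.
Qed.

End LinearOrders.

(** * Identities between infinite products of series *)

Section Products.
Variables (k : comPzRingType) (I : Type).
Implicit Types (w : seq I).

Local Notation iprod J Q := (@series_prod k I J Q : fps k I).

Definition multipl (J : Type) (Q : J -> fps k I) := summ (fun j => Q j - 1).

Lemma eqon_subr0 W (P Q : fps k I) : eqon W (P - Q) 0 <-> eqon W P Q.
Proof.
split=> h w hw; last by rewrite cB h // subrr.
by apply/eqP; rewrite -subr_eq0; apply/eqP; exact: h.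
Qed.

Lemma multipl_loc (J : Type) (Q : J -> fps k I) : multipl Q <->
  forall w, exists r : seq {classic J},
    forall j, j \notin r -> eqon (factor_of w) (Q j) 1.
Proof.
split=> [/summ_loc h w|h].
  by have [r hr] := h w; exists r => j /hr /eqon_subr0.
apply/summ_loc => w; have [r hr] := h w; exists r => j /hr h'.
exact/eqon_subr0.
Qed.

Lemma eqon_multipl (J : Type) (P Q : J -> fps k I) : multipl P ->
  (forall w j, eqon (factor_of w) (P j) 1 -> eqon (factor_of w) (Q j) 1) ->
  multipl Q.
Proof.
move=> h h'; apply: eqon_summ h _ => w j /eqon_subr0 hj.
by apply/eqon_subr0; exact: h'.
Qed.

Lemma prod_add1 (J : los) (y : J -> fps k I) (s : seq {classic J}) :
  \prod_(j <- s) (1 + y j) = \sum_(t <- sublists s) \prod_(j <- t) y j.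
Proof.
elim: s => [|a s IH] /=; first by rewrite big_seq1 !big_nil.
by rewrite big_cons IH big_cat big_map mulrDl mul1r mulr_sumr; congr (_ + _);
  apply: eq_bigr => t _; rewrite big_cons.
Qed.

Lemma eqon_prod0 W (J : los) (y : J -> fps k I) (s : seq {classic J}) a :
  factor_closed W -> a \in s -> eqon W (y a) 0 -> eqon W (\prod_(j <- s) y j) 0.
Proof.
move=> cW; elim: s => // b s IH; rewrite inE big_cons => /orP[/eqP<-|as_] h.
  by rewrite -(mul0r (\prod_(j <- s) y j)); exact: eqonM.
by rewrite -(mulr0 (y b)); apply: eqonM => //; exact: IH.
Qed.

(** An increasing sequence that leaves [F] contributes a product with a factor congruent to 0. The
    others are the sublists of [F], and their terms add up to the expanded finite product. *)
Lemma fs_series_prod W (J : los) (Q : J -> fps k I) (F : seq {classic J}) w :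
  factor_closed W -> W w -> @increasing J F ->
  (forall j, j \notin F -> eqon W (Q j) 1) ->
  fs (fun s : {s : seq J | increasing s} => (\prod_(j <- sval s) (Q j - 1)) w)
     ((\prod_(j <- F) Q j) w).
Proof.
move=> cW hw hF h.
apply: (@fs_sub k (seq J) (@increasing J) (fun s => (\prod_(j <- s) (Q j - 1)) w) _).2.
exists (map (id : seq {classic J} -> {classic seq J}) (sublists F)); split.
- by rewrite map_inj_uniq ?sublists_uniq.
- move=> s sF; case: asboolP => // hs.
  have [a as_ aF] : exists2 a : {classic J}, a \in (s : seq {classic J}) & a \notin F.
    apply: contrapT => hn; case/negP: sF; apply/mapP; exists s => //.
    apply/(sublistsP _ hF); split=> // a as_; apply: contrapT => /negP aF.
    by apply: hn; exists a.
  by apply: (eqon_prod0 cW as_) hw; apply/eqon_subr0; exact: h.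
- rewrite big_map (eq_bigr (fun j => 1 + (Q j - 1))); last by move=> j _; rewrite addrC subrK.
  rewrite (prod_add1 (fun j => Q j - 1)) csum big_seq [RHS]big_seq.
  by apply: eq_bigr => t /(sublistsP _ hF)[ht _]; rewrite asboolT.
Qed.

Lemma hs_series_prod (J : los) (Q : J -> fps k I) : multipl Q ->
  hs (fun s : {s : seq J | increasing s} => \prod_(j <- sval s) (Q j - 1))
    (iprod _ Q).
Proof.
move=> /multipl_loc h; apply: hs_sum => w.
have [r hr] := h w; have [F hF eF] := incr_exists r.
apply: fs_supp; apply: (fs_series_prod (@factor_of_closed I w) (factor_of_refl w) hF).
by move=> j; rewrite eF => /hr.
Qed.

Lemma prodE W (J : los) (Q : J -> fps k I) (F : seq {classic J}) :
  factor_closed W -> multipl Q -> @increasing J F ->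
  (forall j, j \notin F -> eqon W (Q j) 1) ->
  eqon W (iprod _ Q) (\prod_(j <- F) Q j).
Proof.
move=> cW mQ hF h w hw; apply: fs_fun (hs_series_prod mQ w) _.
exact: (fs_series_prod cW hw hF h).
Qed.

Lemma series_prod_fin (J : los) (Q : J -> fps k I) (F : seq {classic J}) :
  @increasing J F -> (forall j, j \notin F -> Q j = 1) ->
  multipl Q /\ iprod _ Q = \prod_(j <- F) Q j.
Proof.
move=> hF h; have mQ : multipl Q.
  by apply/multipl_loc => w; exists F => j /h ->.
split=> //; apply/eqonP => w.
apply: prodE => //; [exact: factor_of_closed | by move=> j /h ->].
Qed.

Section Reindexing.
Variables (J : los) (Q : J -> fps k I).
Hypothesis mQ : multipl Q.

Lemma multipl_loc_incr w : exists2 F : seq {classic J}, @increasing J F &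
  forall j, j \notin F -> eqon (factor_of w) (Q j) 1.
Proof.
have [r hr] := (multipl_loc Q).1 mQ w; have [F hF eF] := incr_exists r.
by exists F => // j; rewrite eF => /hr.
Qed.

Lemma multipl_if (P : J -> Prop) :
  multipl (fun j => if `[< P j >] then Q j else 1).
Proof. by apply: eqon_multipl mQ _ => w j h; case: asboolP. Qed.

Lemma series_prod_iso (J' : los) (phi : J' -> J) : bijective phi ->
  (forall i i', los_lt (phi i) (phi i') <-> los_lt i i') ->
  iprod _ (Q \o phi) = iprod _ Q.
Proof.
move=> bphi hphi; have inj := bij_inj bphi.
have mQ' : multipl (Q \o phi) by apply: (@summ_comp _ _ _ _ phi (fun j => Q j - 1)).
apply/eqonP => w.
have [r hr] := (multipl_loc (Q \o phi)).1 mQ' w; have [F hF eF] := incr_exists r.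
pose f : {classic J'} -> {classic J} := phi.
have hF' : @increasing J (map f F).
  elim: F hF {eF} => [|a F IH] h; first exact: incr_nil.
  have [aF hF] := (incr_cons _ _).1 h.
  apply/(@incr_cons J); split; last exact: IH.
  by move=> b /mapP[c /aF ac ->]; apply/hphi.
apply: (eqon_trans (Q := \prod_(j <- F) Q (phi j))).
  by apply: prodE => //; [exact: factor_of_closed | move=> j; rewrite eF => /hr].
apply: eqon_sym; rewrite -(big_map f xpredT Q); apply: prodE => //.
  exact: factor_of_closed.
have [psi fK psiK] := bphi => j jF; have -> : Q j = (Q \o phi) (psi j) by rewrite /= psiK.
apply: hr; rewrite -eF; apply: contraNN jF => jF; apply/mapP.
by exists (psi j); rewrite // /f psiK.
Qed.

Lemma multipl_sub (P : J -> Prop) : multipl (fun j : sub_los P => Q (sval j)).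
Proof.
by apply: (@summ_comp _ _ _ _ (@sval J P) (fun j => Q j - 1)) => // x y; exact: sval_eq.
Qed.

(** Replacing the missing factors by 1 keeps the index set, so that products over different subsets
    can be compared along one finite list. *)
Lemma series_prod_sub (P : J -> Prop) :
  iprod _ (fun j : sub_los P => Q (sval j)) =
  iprod _ (fun j => if `[< P j >] then Q j else 1).
Proof.
have mQ' := multipl_sub P; apply/eqonP => w.
have [r hr] := (multipl_loc _).1 mQ' w; have [F hF eF] := incr_exists r.
pose f : {classic sub_los P} -> {classic J} := sval.
have hF' : @increasing J (map f F).
  elim: F hF {eF} => [|a F IH] h; first exact: incr_nil.
  have [aF hF] := (incr_cons _ _).1 h.
  apply/(@incr_cons J); split; last exact: IH.
  by move=> b /mapP[c /aF ac ->].
apply: (eqon_trans (Q := \prod_(j <- F) Q (sval j))).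
  by apply: prodE => //; [exact: factor_of_closed | move=> j; rewrite eF => /hr].
apply: eqon_sym.
have -> : \prod_(j <- F) Q (sval j) = \prod_(j <- map f F) (if `[< P j >] then Q j else 1).
  by rewrite big_map; apply: eq_bigr => j _; rewrite asboolT //; exact: svalP.
apply: prodE => //; [exact: factor_of_closed | exact: multipl_if |].
move=> j jF; case: asboolP => // Pj.
apply: (hr (exist _ j Pj)); rewrite -eF; apply: contraNN jF => jF; apply/mapP.
by exists (exist _ j Pj).
Qed.

Lemma multipl_conj (g g' : fps k I) : g * g' = 1 ->
  multipl (fun j => g * Q j * g').
Proof.
move=> gg'; apply: eqon_multipl mQ _ => w j h; rewrite -gg' -[X in eqon _ _ (X * _)]mulr1.
by apply: eqonM => //; [exact: factor_of_closed|apply: eqonM => //; exact: factor_of_closed].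
Qed.

Lemma series_prod_conj (g g' : fps k I) : g * g' = 1 -> g' * g = 1 ->
  iprod _ (fun j => g * Q j * g') = g * iprod _ Q * g'.
Proof.
move=> gg' g'g; have mc := multipl_conj gg'; apply/eqonP => w.
have cW := @factor_of_closed I w.
have [F hF h] := multipl_loc_incr w.
have e : \prod_(j <- F) (g * Q j * g') = g * \prod_(j <- F) Q j * g'.
  elim: F {hF h} => [|a F IH]; first by rewrite !big_nil mulr1.
  by rewrite !big_cons IH !mulrA -[_ * g' * g]mulrA g'g mulr1.
apply: (eqon_trans (Q := \prod_(j <- F) (g * Q j * g'))).
  apply: prodE => // j /h hj; rewrite -gg' -[X in eqon _ _ (X * _)]mulr1.
  by do 2 apply: eqonM => //.
by rewrite e; do 2 apply: eqonM => //; apply: eqon_sym; apply: prodE.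
Qed.

Lemma multipl_inv (Qi : J -> fps k I) : (forall j, Q j * Qi j = 1) -> multipl Qi.
Proof.
move=> hi; apply: eqon_multipl mQ _ => w j h.
rewrite -[Qi j]mul1r -[X in eqon _ _ X](hi j).
by apply: eqonM => //; [exact: factor_of_closed | exact: eqon_sym].
Qed.

Lemma series_prod_rev (Qi : J -> fps k I) :
  (forall j, Qi j * Q j = 1) -> (forall j, Q j * Qi j = 1) ->
  iprod (rev_los J) Qi * iprod _ Q = 1 /\
  iprod _ Q * iprod (rev_los J) Qi = 1.
Proof.
move=> hi1 hi2; have mi := multipl_inv hi2.
suff h w : exists F : seq {classic J},
    eqon (factor_of w) (iprod _ Q) (\prod_(j <- F) Q j) /\
    eqon (factor_of w) (iprod (rev_los J) Qi) (\prod_(j <- rev F) Qi j).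
  split; apply/eqonP => w; have [F [h1 h2]] := h w; have cW := @factor_of_closed I w.
    have <- : \prod_(j <- rev F) Qi j * \prod_(j <- F) Q j = 1.
      elim: F {h1 h2} => [|a F IH]; first by rewrite !big_nil mulr1.
      rewrite rev_cons -cats1 big_cat big_seq1 big_cons -mulrA (mulrA (Qi a)).
      by rewrite hi1 mul1r.
    exact: eqonM.
  have <- : \prod_(j <- F) Q j * \prod_(j <- rev F) Qi j = 1.
    elim: F {h1 h2} => [|a F IH]; first by rewrite !big_nil mulr1.
    rewrite rev_cons -cats1 big_cat big_seq1 big_cons -mulrA (mulrA (\prod_(j <- F) _)).
    by rewrite IH mul1r.
  exact: eqonM.
have [F hF hFw] := multipl_loc_incr w; exists F; have cW := @factor_of_closed I w.
split; first exact: prodE.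
apply: (@prodE _ (rev_los J)) => //.
- elim: F hF {hFw} => [|a F IH] h; first exact: (@incr_nil (rev_los J)).
  have [aF hF] := (incr_cons _ _).1 h.
  have app (s : seq {classic J}) : @increasing (rev_los J) s ->
      (forall b, b \in s -> @los_lt J a b) -> @increasing (rev_los J) (rcons s a).
    elim: s => [|c s IHs] hs has.
      apply: (incr_cons (J := rev_los J) a [::]).2; split; last exact: (@incr_nil (rev_los J)).
      by move=> b; rewrite in_nil.
    have [cs hs'] := (incr_cons (J := rev_los J) c s).1 hs.
    apply: (incr_cons (J := rev_los J) c (rcons s a)).2; split.
      move=> b; rewrite mem_rcons inE => /orP[/eqP->|/cs//].
      by apply: has; rewrite mem_head.
    by apply: IHs => // b bs; apply: has; rewrite inE bs orbT.
  rewrite rev_cons; apply: app; first exact: IH.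
  by move=> b; rewrite mem_rev => /aF.
- move=> j; rewrite mem_rev => /hFw hj.
  rewrite -[Qi j]mul1r -[X in eqon _ _ X](hi2 j).
  by apply: eqonM => //; exact: eqon_sym.
Qed.

End Reindexing.

Section TwoFamilies.
Variables (J : los) (f g x y : J -> fps k I).
Hypothesis (mf : multipl f) (mg : multipl g).
Hypothesis y_def : forall i, y i = iprod _ (fun j : sub_los (los_lt i) => f (sval j)).
Hypothesis (xy : forall i, x i * y i = 1) (yx : forall i, y i * x i = 1).

Lemma multiplM : multipl (fun i => f i * g i).
Proof.
apply/multipl_loc => w.
have [[r hr] [r' hr']] := ((multipl_loc f).1 mf w, (multipl_loc g).1 mg w).
exists (r ++ r') => j; rewrite mem_cat negb_or => /andP[/hr h /hr' h'].
by rewrite -[1]mulr1; apply: eqonM => //; exact: factor_of_closed.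
Qed.

Lemma multipl_twist : multipl (fun i => x i * g i * y i).
Proof.
apply: eqon_multipl mg _ => w i h; rewrite -(xy i) -[X in eqon _ _ (X * _)]mulr1.
have cW := @factor_of_closed I w.
by do 2 apply: eqonM => //.
Qed.

(** The finite model is f1 g1 f2 g2 = (f1 f2) (f2^-1 g1 f2) g2: each g_i moves to the right past the
    later factors of f, whose product is [y i], with inverse [x i]. *)
Lemma series_prod_twist :
  iprod _ (fun i => f i * g i) =
  iprod _ f * iprod _ (fun i => x i * g i * y i).
Proof.
apply/eqonP => w; have cW := @factor_of_closed I w.
have [[r hr] [r' hr']] := ((multipl_loc f).1 mf w, (multipl_loc g).1 mg w).
have [F hF eF] := incr_exists (r ++ r').
have hf j : j \notin F -> eqon (factor_of w) (f j) 1.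
  by rewrite eF mem_cat negb_or => /andP[/hr].
have hg j : j \notin F -> eqon (factor_of w) (g j) 1.
  by rewrite eF mem_cat negb_or => /andP[_ /hr'].
apply: (eqon_trans (Q := \prod_(j <- F) (f j * g j))).
  apply: prodE => // [|j jF]; first exact: multiplM.
  by rewrite -[1]mulr1; apply: eqonM => //; [exact: hf|exact: hg].
apply: (eqon_trans (Q := \prod_(j <- F) f j * \prod_(j <- F) (x j * g j * y j))); last first.
  apply: eqon_sym; apply: eqonM => //; first exact: prodE.
  apply: prodE => //; first exact: multipl_twist.
  move=> j /hg hj; rewrite -(xy j) -[X in eqon _ _ (X * _)]mulr1.
  by do 2 apply: eqonM => //.
(* Modulo the words considered, [y a] is the product of f over the part of [F] after [a]. This holds
   for every splitting of [F], hence is inherited by tails in the induction below. *)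
have hy (s1 s2 : seq {classic J}) a : F = s1 ++ a :: s2 ->
    eqon (factor_of w) (y a) (\prod_(j <- s2) f j).
  move=> e; rewrite y_def series_prod_sub //.
  have -> : \prod_(j <- s2) f j = \prod_(j <- s2) (if `[< los_lt a j >] then f j else 1).
    rewrite big_seq [RHS]big_seq; apply: eq_bigr => j js.
    rewrite asboolT //; move: hF; rewrite e; elim: s1 {e} => [|b s1 IH] /incr_cons[h h'].
      exact: h.
    exact: IH.
  have hs2 : @increasing J s2.
    by move: hF; rewrite e; elim: s1 {e} => [|b s1 IH] /incr_cons[h h'] //; exact: IH.
  apply: prodE => //; first exact: multipl_if.
  move=> j js; case: asboolP => // aj; apply: hf.
  rewrite e mem_cat inE negb_or negb_or js andbT; apply/andP; split; last first.
    by apply/eqP => ej; move: aj; rewrite ej => /los_irr.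
  apply/negP => js1; have : @los_lt J j a.
    move: hF; rewrite e; elim: s1 js1 {e} => // b s1 IH; rewrite inE => /orP[/eqP->|js1] /incr_cons[h h'].
      by apply: h; rewrite mem_cat mem_head orbT.
    exact: IH.
  by move/(los_trans aj)/los_irr.
elim: {hF eF hf hg} F hy => [|a F IH] hy; first by rewrite !big_nil mulr1.
rewrite !big_cons.
have {}IH := IH (fun s1 s2 b e => hy (a :: s1) s2 b (congr1 (cons a) e)).
have ya := hy [::] F a erefl.
set A := \prod_(j <- F) f j in ya IH *; set B := \prod_(j <- F) (x j * g j * y j) in IH *.
have -> : f a * A * (x a * g a * y a * B) = f a * ((A * x a) * g a * (y a * B)) by rewrite !mulrA.
rewrite -mulrA; apply: eqonM => //.
rewrite -[X in eqon _ (X * _)]mul1r; apply: eqonM => //.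
  by apply: eqonM => //; rewrite -(yx a); apply: eqonM.
apply: eqon_trans IH _; apply: eqonM => //; exact: eqon_sym.
Qed.

End TwoFamilies.

Section Blocks.
Variables (K J : los) (P : J -> K -> Prop) (g : K -> fps k I) (h : J -> fps k I).
Hypothesis mg : multipl g.
Hypothesis P_total : forall i, exists j, P j i.
Hypothesis P_lt : forall j j' i i',
  los_lt j j' -> P j i -> P j' i' -> los_lt i i'.
Hypothesis h_def : forall j, h j = iprod _ (fun i : sub_los (P j) => g (sval i)).

Lemma block_unique j j' i : P j i -> P j' i -> j = j'.
Proof.
move=> pj pj'; case: (los_total j j') => [l|[//|l]].
  by case: (los_irr (P_lt l pj pj')).
by case: (los_irr (P_lt l pj' pj)).
Qed.

(** All blocks before [b] are trivial, so a factor put at the head of block [b] can be moved to the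
    very front. *)
Lemma prod_insert_block (T : seq {classic J}) b c (A : J -> fps k I) :
  @increasing J T -> (b : {classic J}) \in T -> (forall j, los_lt j b -> A j = 1) ->
  \prod_(j <- T) ((if `[< b = j >] then c else 1) * A j) = c * \prod_(j <- T) A j.
Proof.
elim: T => // t T IH /incr_cons[tT hT]; rewrite inE !big_cons => /orP[/eqP e|bT] hA.
  rewrite asboolT // -mulrA; congr (_ * (_ * _)); rewrite big_seq [RHS]big_seq.
  apply: eq_bigr => j /tT tj; rewrite asboolF ?mul1r // => bj.
  by move: tj; rewrite -e bj => /los_irr.
have tb := tT _ bT; rewrite asboolF ?mul1r => [|e]; last by move: tb; rewrite e => /los_irr.
by rewrite IH // hA // !mul1r.
Qed.

Lemma multipl_blocks : multipl h.
Proof.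
apply/multipl_loc => w; have cW := @factor_of_closed I w.
have [F hF hFw] := multipl_loc_incr mg w; have [b hb] := choice P_total.
exists (map (b : {classic K} -> {classic J}) F) => j jF.
rewrite h_def series_prod_sub //.
have e : \prod_(i <- F) (if `[< P j i >] then g i else 1) = 1.
  rewrite big_seq; apply: big1 => i iF; case: asboolP => // pji.
  case/negP: jF; apply/mapP; exists i => //; exact: block_unique (hb i).
rewrite -[X in eqon _ _ X]e; apply: prodE => //; first exact: multipl_if.
by move=> i /hFw hi; case: asboolP.
Qed.

Lemma series_prod_blocks : iprod _ h = iprod _ g.
Proof.
apply/eqonP => w; have cW := @factor_of_closed I w.
have [F hF hFw] := multipl_loc_incr mg w; have [b hb] := choice P_total.
have [T hT eT] := @incr_exists J (map (b : {classic K} -> {classic J}) F).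
pose A (F : seq {classic K}) j := \prod_(i <- F) (if `[< P j i >] then g i else 1).
have hA j : eqon (factor_of w) (h j) (A F j).
  rewrite h_def series_prod_sub //; apply: prodE => //; first exact: multipl_if.
  by move=> i /hFw hi; case: asboolP.
have A1 j : j \notin T -> A F j = 1.
  move=> jT; rewrite /A big_seq; apply: big1 => i iF; case: asboolP => // pji.
  case/negP: jT; rewrite eT; apply/mapP; exists i => //; exact: block_unique (hb i).
apply: (eqon_trans (Q := \prod_(j <- T) A F j)).
  apply: (eqon_trans (Q := \prod_(j <- T) h j)); last exact: eqon_prod.
  apply: prodE => //; first exact: multipl_blocks.
  by move=> j /A1 <-.
apply: eqon_sym; have -> : \prod_(j <- T) A F j = \prod_(i <- F) g i; last exact: prodE.
have sub : {subset map (b : {classic K} -> {classic J}) F <= T} by move=> j; rewrite eT.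
(* Induction removes the least index [a]: it heads its own block, and no later element lies in an
   earlier block. *)
elim: F hF sub {eT hFw hA A1} => [|a F IH] /= hF sub.
  by rewrite /A; under eq_bigr do rewrite big_nil; rewrite big1_eq big_nil.
have [aF hF'] := (incr_cons _ _).1 hF.
rewrite big_cons -IH // => [|j jF]; last by apply: sub; rewrite inE jF orbT.
rewrite -(prod_insert_block (b := b a)) //.
- apply: eq_bigr => j _; rewrite /A big_cons; congr (_ * _).
  case: asboolP => p1; case: asboolP => p2 //.
    by case: p2; exact: block_unique (hb a) p1.
  by case: p1; rewrite -p2.
- by apply: sub; rewrite mem_head.
- move=> j jb; rewrite /A big_seq; apply: big1 => i iF; case: asboolP => // pji.
  have := P_lt jb pji (hb a); have := aF i iF => l1 l2.
  by case: (los_irr (los_trans l1 l2)).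
Qed.

End Blocks.

End Products.

(** * Infinite products of group-like series *)

Section GroupLikeProducts.
Variables (k : comPzRingType) (q : {rmorphism rat -> k}) (I : Type).

Local Notation iprod J Q := (@series_prod k I J Q : fps k I).

(** A shuffle involves finitely many words; their concatenation has all of them as factors. *)
Lemma sh_factors (u v : seq I) : exists w : seq I, forall P Q : fps k I,
  eqon (factor_of w) P Q -> sh u v P = sh u v Q.
Proof.
have [l hl] : exists l : seq (seq I), forall P Q : fps k I,
    (forall w, List.In w l -> P w = Q w) -> sh u v P = sh u v Q.
  move: u v; apply: sh_rec => [v|u|a u b v [l1 h1] [l2 h2]].
  - by exists [:: v] => P Q h; apply: h; left.
  - by exists [:: u] => P Q h; rewrite !sh_nilr; apply: h; left.
  - exists (map (cons a) l1 ++ map (cons b) l2) => P Q h; rewrite !sh_cons.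
    congr (_ + _); [apply: h1|apply: h2] => w hw; apply: h; apply: List.in_or_app.
      by left; exact: List.in_map.
    by right; exact: List.in_map.
exists (flatten l) => P Q h; apply: hl => w hw; apply: h.
elim: l hw => // a l IH [->|/IH[x [y e]]]; first by exists [::], (flatten l).
by exists (a ++ x), y; rewrite /= e catA.
Qed.

Lemma in_Gr_series_prod (J : los) (Q : J -> fps k I) : multipl Q ->
  (forall j, in_Gr q (Q j)) -> in_Gr q (iprod J Q).
Proof.
move=> mQ hQ; apply/in_GrP.
have loc w : exists2 R, grouplike R & eqon (factor_of w) (iprod J Q) R.
  have [F hF hFw] := multipl_loc_incr mQ w; exists (\prod_(j <- F) Q j).
    by apply/in_GrP; exact: in_Gr_prod.
  apply: prodE => //; exact: factor_of_closed.
split; first exact: grouplike_loc loc.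
move=> u v; have [w hw] := sh_factors u v.
(* A single word whose factors include the words of the shuffle as well as [u] and [v], so one
   finite product serves for all three values. *)
have [R [_ gR] h] := loc (w ++ u ++ v).
rewrite (hw _ R); last first.
  by move=> x [a [b e]]; apply: h; exists a, (b ++ u ++ v); rewrite e !catA.
rewrite gR !h //.
- by exists (w ++ u), [::]; rewrite cats0 catA.
- by exists w, v.
Qed.

End GroupLikeProducts.

(** * Substitution *)

Section Substitution.
Variables (k : comPzRingType) (q : {rmorphism rat -> k}) (I J : Type).
Variable P : J -> fps k I.

Implicit Types (Q R : fps k J).

Definition subst (Q : fps k J) : fps k I :=
  @series_sum k I (seq J) (fun w => Q w *: (\prod_(j <- w) P j : fps k I)).

Hypothesis (P0 : forall j, P j [::] = 0) (sP : summ P).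

Local Notation exp P := (sexp q P).
Local Notation log Q := (slog q Q).
Local Notation pw w := (\prod_(j <- w) P j : fps k I).

Lemma pw_order w : ordge (size w) (pw w).
Proof.
elim: w => [//|a w IH]; rewrite big_cons [size _]/= -add1n; apply: ordgeM => //.
exact/ordge1P.
Qed.

(** As no P_j has a constant term, only words of length at most [size u] contribute at [u]; their
    letters lie in the finite set of j for which P_j is nonzero on some factor of [u]. *)
Lemma pw_supp u : exists2 r : seq {classic seq J}, uniq r &
  forall w, w \notin r -> pw w u = 0.
Proof.
have [F hF] := (summ_loc P).1 sP u.
pose fix wd n : seq (seq {classic J}) :=
  if n is n'.+1 then [::] :: [seq a :: w | a <- F, w <- wd n'] else [:: [::]].
have hwd n (w : seq {classic J}) : (size w <= n)%N -> {subset w <= F} -> w \in wd n.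
  elim: n w => [|n IH] [|a w] //= hw sw; rewrite inE; apply/orP; right.
  apply/allpairsP; exists (a, w); split=> //=; first by apply: sw; rewrite mem_head.
  by apply: IH => // b bw; apply: sw; rewrite inE bw orbT.
exists (undup (map (id : seq {classic J} -> {classic seq J}) (wd (size u)))).
  exact: undup_uniq.
move=> w; rewrite mem_undup => hw.
case: (leqP (size w) (size u)) => sw; last exact: pw_order.
have [a aw aF] : exists2 a : {classic J}, a \in (w : seq {classic J}) & a \notin F.
  apply: contrapT => hn; case/negP: hw; apply/mapP; exists w => //.
  apply: hwd => // a aw; apply: contrapT => /negP aF; by apply: hn; exists a.
have cW := @factor_of_closed I u.
suff : eqon (factor_of u) (pw w) 0 by apply; exact: factor_of_refl.
elim: {hw sw} (w : seq {classic J}) aw => // b s IH; rewrite inE big_cons => /orP[/eqP<-|as_].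
  by rewrite -(mul0r (pw s)); apply: eqonM => //; exact: hF.
by rewrite -(mulr0 (P b)); apply: eqonM => //; exact: IH.
Qed.

Lemma hs_subst Q : hs (fun w => Q w *: pw w) (subst Q).
Proof.
apply: hs_sum => u; have [r _ hr] := pw_supp u.
by exists r => w /hr h; rewrite cZ h mulr0.
Qed.

(** The list [r] does not depend on Q: each coefficient of a substitution is one finite linear form
    in Q. Linearity and compatibility with infinite sums follow. *)
Lemma subst_coef u : exists r : seq {classic seq J}, forall Q,
  subst Q u = \sum_(w <- r) Q w * pw w u.
Proof.
have [r ur hr] := pw_supp u; exists r => Q.
apply: fs_fun (hs_subst Q u) _; exists r; split=> // w /hr h.
by rewrite cZ h mulr0.
Qed.

Lemma substD Q R : subst (Q + R) = subst Q + subst R.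
Proof.
apply: funext => u; have [r hr] := subst_coef u; rewrite cD !hr -big_split.
by apply: eq_bigr => w _; rewrite cD mulrDl.
Qed.

Lemma substZ a Q : subst (a *: Q) = a *: subst Q.
Proof.
apply: funext => u; have [r hr] := subst_coef u; rewrite cZ !hr mulr_sumr.
by apply: eq_bigr => w _; rewrite cZ mulrA.
Qed.

Lemma substN Q : subst (- Q) = - subst Q.
Proof. by rewrite -!scaleN1r substZ. Qed.

Lemma substB Q R : subst (Q - R) = subst Q - subst R.
Proof. by rewrite substD substN. Qed.

Lemma subst_hs (T : Type) (R : T -> fps k J) S :
  hs R S -> hs (fun t => subst (R t)) (subst S).
Proof.
move=> h u; have [r hr] := subst_coef u; rewrite hr.
apply: (fs_ext (f := fun t => \sum_(w <- r) pw w u * R t w)) => [t|].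
  by rewrite hr; apply: eq_bigr => w _; rewrite mulrC.
under eq_bigr do rewrite mulrC.
by apply: fs_bigsum => w; exact: fs_scale.
Qed.

Lemma pw_nil w : w <> [::] -> pw w [::] = 0.
Proof. by case: w => // a w _; rewrite big_cons cM_nil P0 mul0r. Qed.

Lemma subst_nil Q : subst Q [::] = Q [::].
Proof.
apply: fs_fun (hs_subst Q [::]) _.
have -> : Q [::] = (Q [::] *: pw [::]) [::] by rewrite big_nil cZ c1 mulr1.
apply: (fs_single (f := fun w => (Q w *: pw w) [::])) => w /pw_nil h.
by rewrite cZ h mulr0.
Qed.

Lemma subst1 : subst 1 = 1.
Proof.
apply: (hs_fun (hs_subst 1)).
have e : 1 = (1 : fps k J) [::] *: pw [::] by rewrite big_nil c1 scale1r.
rewrite [X in hs _ X]e; apply: (hs_single (P := fun w => (1 : fps k J) w *: pw w)).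
by case=> // a w _; rewrite c1 scale0r.
Qed.

Lemma subst0 : subst 0 = 0.
Proof. by have := substZ 0 0; rewrite !scale0r. Qed.

Lemma substX j : subst (sX k j) = P j.
Proof.
apply: (hs_fun (hs_subst _)).
have e : P j = (sX k j : fps k J) [:: j] *: pw [:: j].
  by rewrite big_seq1 cX1 asboolT // scale1r.
rewrite [X in hs _ X]e.
apply: (hs_single (P := fun w => (sX k j : fps k J) w *: pw w)) => w wj.
by rewrite /sX asboolF // scale0r.
Qed.

Lemma substM Q R : subst (Q * R) = subst Q * subst R.
Proof.
apply: hs_fun (hs_subst _) _.
(* The double sum over pairs of words is grouped by their concatenation. *)
apply: (hs_fubini (phi := fun p : seq J * seq J => p.1 ++ p.2)
  (hs_mul (hs_subst Q) (hs_subst R))) => w.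
pose G p := if `[< p.1 ++ p.2 = w >] then (Q p.1 *: pw p.1) * (R p.2 *: pw p.2)
  else 0 : fps k I.
pose g n : {classic seq J * seq J} := (take n w, drop n w).
have -> : (Q * R) w *: pw w = \sum_(p <- map g (iota 0 (size w).+1)) G p.
  rewrite big_map -[X in iota 0 X]subn0 -/(index_iota 0 (size w).+1) big_mkord.
  rewrite cM scaler_suml; apply: eq_bigr => n _.
  rewrite /G /= cat_take_drop asboolT // -fps_scaleAl -fps_scaleAr scalerA.
  by rewrite -big_cat cat_take_drop.
apply: hs_seq.
  rewrite map_inj_in_uniq ?iota_uniq // => m n; rewrite !mem_iota !add0n !ltnS => hm hn.
  by move=> [/(congr1 size)]; rewrite !size_takel.
move=> [w1 w2]; apply: contraNeq; rewrite /G; case: asboolP => [e _|]; last by rewrite eqxx.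
have {}e : w1 ++ w2 = w by [].
apply/mapP; exists (size w1); first by rewrite mem_iota ltnS -e size_cat leq_addr.
by rewrite /g -e take_size_cat // drop_size_cat.
Qed.

Lemma substXn Q n : subst (Q ^+ n) = subst Q ^+ n.
Proof.
elim: n => [|n IH]; first by rewrite !expr0 subst1.
by rewrite !exprS substM IH.
Qed.

Lemma subst_bigprod (T : Type) (s : seq T) (F : T -> fps k J) :
  subst (\prod_(t <- s) F t) = \prod_(t <- s) subst (F t).
Proof.
elim: s => [|a s IH]; first by rewrite !big_nil subst1.
by rewrite !big_cons substM IH.
Qed.

Lemma subst_exp R : R [::] = 0 -> subst (exp R) = exp (subst R).
Proof.
move=> R0; have sR0 : subst R [::] = 0 by rewrite subst_nil.
apply: hs_fun (hs_exp q sR0); apply: hs_ext (subst_hs (hs_exp q R0)) => n.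
by rewrite substZ substXn.
Qed.

Lemma subst_log Q : Q [::] = 1 -> subst (log Q) = log (subst Q).
Proof.
move=> Q1; have sQ1 : subst Q [::] = 1 by rewrite subst_nil.
apply: hs_fun (hs_log q sQ1); apply: hs_ext (subst_hs (hs_log q Q1)) => n.
by rewrite substZ substXn substB subst1.
Qed.

Lemma subst_multipl (T : Type) (Q : T -> fps k J) :
  multipl Q -> multipl (fun t => subst (Q t)).
Proof.
move=> /hs_ex[S /subst_hs /hs_summ]; rewrite /multipl.
by under [X in _ -> summ X]eq_fun do rewrite -[1]subst1 -substB.
Qed.

Lemma subst_series_prod (T : los) (Q : T -> fps k J) : multipl Q ->
  subst (series_prod Q) = series_prod (fun t => subst (Q t)).
Proof.
move=> mQ; apply: hs_fun (hs_series_prod (subst_multipl mQ)).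
apply: hs_ext (subst_hs (hs_series_prod mQ)) => s; rewrite subst_bigprod.
by apply: eq_bigr => t _; rewrite substB subst1.
Qed.

(** The series whose substitution is a Lie series form a summability subalgebra containing the
    variables, so minimality of Lie<<J>> applies. *)
Lemma subst_in_Lie Q : (forall j, in_Lie (P j)) -> in_Lie Q -> in_Lie (subst Q).
Proof.
move=> hP hQ; apply: (hQ (fun R => in_Lie (subst R))); last by move=> j; rewrite substX.
split.
- by have := @in_Lie0 k I; rewrite -subst0.
- by move=> x y hx hy; have := in_LieD hx hy; rewrite -substD.
- by move=> x hx; have := in_LieN hx; rewrite -substN.
- by move=> a x hx; have := in_LieZ a hx; rewrite -substZ.
- by move=> x y hx hy; have := in_Lie_bracket hx hy; rewrite -!substM -substB.
- move=> T v s hv /hsP h; apply: in_Lie_sum (subst_hs h) => t; exact: hv.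
Qed.

Lemma subst_in_Gr Q : (forall j, in_Lie (P j)) -> in_Gr q Q -> in_Gr q (subst Q).
Proof.
move=> hP [R hR ->]; rewrite subst_exp; last exact: in_Lie_nil.
by apply: in_Gr_exp; exact: subst_in_Lie.
Qed.

End Substitution.

(** * Topological generation of the group of Lie exponentials *)

(** Index sets of summable families carry no order, whereas every product requires one; a
    well-ordering supplies it. *)
Lemma linear_order_exists (T : Type) : exists lt : T -> T -> Prop, is_linear lt.
Proof.
have [R wR] := well_ordering_principle {classic T}.
have min (A : pred {classic T}) x : A x -> exists2 z, A z & forall y, A y -> R z y.
  move=> Ax; have [z [[Az hz] _]] := wR A (ex_intro _ x Ax).
  by exists z => // y; exact: hz.
have refl x : R x x.
  by have [z /eqP -> /(_ x (eqxx x))] := min (pred1 x) x (eqxx x).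
(* The order axioms come from the least elements of sets with two or three members. *)
have tot x y : R x y \/ R y x.
  have [|z /orP[] /eqP -> h] := min (pred2 x y) x; first by rewrite /= eqxx.
    by left; apply: h; rewrite /= eqxx orbT.
  by right; apply: h; rewrite /= eqxx.
have anti x y : R x y -> R y x -> x = y.
  move=> xy yx; have [|z [_ uz]] := wR (pred2 x y); first by exists x; rewrite unfold_in /= eqxx.
  rewrite -(uz x); first apply: uz; split; rewrite ?unfold_in /= ?eqxx ?orbT //.
    by move=> t; rewrite unfold_in => /orP[] /eqP ->.
  by move=> t; rewrite unfold_in => /orP[] /eqP ->.
have trans x y z : R x y -> R y z -> R x z.
  move=> xy yz; have [|t /or3P[] /eqP -> h] := min (pred3 x y z) x; first by rewrite /= eqxx.
  - by apply: h; rewrite /= eqxx !orbT.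
  - have yx : R y x by apply: h; rewrite /= eqxx.
    by rewrite (anti x y).
  - have zy : R z y by apply: h; rewrite /= eqxx !orbT.
    by rewrite (anti z y).
exists (fun x y : {classic T} => R x y /\ x <> y); split.
- by move=> x [].
- move=> y x z [xy nxy] [yz nyz]; split; first exact: trans yz.
  by move=> e; apply: nxy; apply: anti => //; rewrite e.
- move=> x y; have [->|/eqP n] := eqVneq (x : {classic T}) y; first by auto.
  by case: (tot x y); auto.
Qed.

Lemma nat_lin : is_linear (fun m n : nat => (m < n)%N).
Proof.
split.
- by move=> n; rewrite ltnn.
- by move=> n m p; exact: ltn_trans.
- by move=> m n; case: (ltngtP m n); auto.
Qed.

Definition nat_los : los := Los nat_lin.

Lemma incr_iota m n : @increasing nat_los (iota m n).
Proof.
elim: n m => [|n IH] m; first exact: (@incr_nil nat_los).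
apply: (incr_cons (J := nat_los) m (iota m.+1 n)).2; split=> // b.
by rewrite mem_classic mem_iota /= => /andP[].
Qed.

Section Generation.
Variables (k : comPzRingType) (q : {rmorphism rat -> k}) (I : Type).
Implicit Types (P Q R A B : fps k I) (w : seq I).

Local Notation exp P := (sexp q (P : fps k I) : fps k I).
Local Notation log Q := (slog q (Q : fps k I) : fps k I).
Local Notation X := (sX k : I -> fps k I).
Local Notation iprod J Q := (@series_prod k I J Q : fps k I).

(** The inverse as the power of exponent -1, which makes it visibly the exponential of a Lie
    series. *)
Definition sinv Q : fps k I := exp (- log Q).

Lemma sinv_nil Q : Q [::] = 1 -> sinv Q [::] = 1.
Proof. by move=> Q1; rewrite /sinv exp_nil // cN log_nil // oppr0. Qed.

Lemma sinvl Q : Q [::] = 1 -> sinv Q * Q = 1.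
Proof. by move=> Q1; rewrite -{2}(exp_log q Q1) expNl // log_nil. Qed.

Lemma sinvr Q : Q [::] = 1 -> Q * sinv Q = 1.
Proof. by move=> Q1; rewrite -{1}(exp_log q Q1) expNr // log_nil. Qed.

Lemma in_Gr_sinv Q : in_Gr q Q -> in_Gr q (sinv Q).
Proof. by move=> h; apply: in_Gr_exp; apply: in_LieN; exact: in_Lie_log. Qed.

Lemma sinv_unique A B : A [::] = 1 -> A * B = 1 -> B = sinv A.
Proof. by move=> A1 AB; rewrite -[LHS]mul1r -(sinvl A1) -mulrA AB mulr1. Qed.

Definition scomm A B : fps k I := A * B * sinv A * sinv B.

Lemma in_Gr_scomm A B : in_Gr q A -> in_Gr q B -> in_Gr q (scomm A B).
Proof.
move=> hA hB; apply: in_GrM; last exact: in_Gr_sinv.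
by apply: in_GrM; [exact: in_GrM | exact: in_Gr_sinv].
Qed.

Lemma ordgeD n P Q : ordge n P -> ordge n Q -> ordge n (P + Q).
Proof. by move=> h h' w hw; rewrite cD h // h' // addr0. Qed.

Lemma ordgeN n P : ordge n P -> ordge n (- P).
Proof. by move=> h w hw; rewrite cN h // oppr0. Qed.

Lemma ordgeB n P Q : ordge n P -> ordge n Q -> ordge n (P - Q).
Proof. by move=> h h'; apply: ordgeD => //; exact: ordgeN. Qed.

Lemma ordge_hs n (J : Type) (P : J -> fps k I) S :
  hs P S -> (forall j, ordge n (P j)) -> ordge n S.
Proof. by move=> h hP; exact: (hs_eqon h (@hs_zero k I J) hP). Qed.

Lemma ordge_sub1 Q : Q [::] = 1 -> ordge 1 (Q - 1).
Proof. by move=> Q1; apply/ordge1P; rewrite cB Q1 c1 subrr. Qed.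

Lemma comm_sub1 A B : (A - 1) * (B - 1) - (B - 1) * (A - 1) = A * B - B * A.
Proof.
have c3 (a b c : fps k I) : (a - c) - (b - c) = a - b by rewrite opprB addrA subrK.
rewrite mulrBl mul1r [X in _ - X]mulrBr mulr1 c3.
by rewrite mulrBr mulr1 mulrBl mul1r c3.
Qed.

Lemma comm_sub A B P Q : A * B - B * A - (P * Q - Q * P) =
  (A - P) * B + P * (B - Q) - ((B - Q) * A + Q * (A - P)).
Proof.
have e (a b c d : fps k I) : (a - b) * c + b * (c - d) = a * c - b * d.
  by rewrite mulrBl mulrBr addrA subrK.
rewrite !e opprB [in RHS]opprB [LHS]addrACA [RHS]addrACA.
by congr (_ + _); rewrite addrC.
Qed.

(* Up to higher order, [scomm A B - 1] is the bracket of [A - 1] and [B - 1],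
   because it equals [(A * B - B * A) * (sinv A * sinv B)]. *)
Lemma scomm_leading n A B (D Y : fps k I) : A [::] = 1 -> B [::] = 1 ->
  ordge 2 (A - 1 - Y) -> ordge n.+1 (B - 1) -> ordge n.+2 (B - 1 - D) ->
  ordge n.+3 (scomm A B - 1 - (Y * D - D * Y)).
Proof.
move=> A1 B1 hA oB hB; have oA := ordge_sub1 A1.
set x := A - 1 in hA oA; set y := B - 1 in oB hB.
have oY : ordge 1 Y.
  have -> : Y = x - (x - Y) by rewrite opprB addrC subrK.
  apply: ordgeB => //; exact: ordge_le hA.
have oD : ordge n.+1 D.
  have -> : D = y - (y - D) by rewrite opprB addrC subrK.
  apply: ordgeB => //; exact: ordge_le hB.
set E := sinv A * sinv B.
have oE : ordge 1 (E - 1).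
  by apply: ordge_sub1; rewrite /E cM_nil !sinv_nil // mulr1.
have e1 : scomm A B - 1 = (x * y - y * x) * E.
  have -> : x * y - y * x = A * B - B * A by exact: comm_sub1.
  rewrite mulrBl /E /scomm !mulrA; congr (_ - _).
  by rewrite -[B * A * _]mulrA sinvr // mulr1 sinvr.
have e2 (c F d : fps k I) : c * F - d = c * (F - 1) + (c - d).
  by rewrite mulrBr mulr1 addrA subrK.
rewrite e1 (e2 (x * y - y * x) E) (comm_sub x y Y D).
have o n1 n2 (P Q : fps k I) m : ordge n1 P -> ordge n2 Q -> (m <= n1 + n2)%N -> ordge m (P * Q).
  by move=> h1 h2 hm; apply: ordge_le hm _; exact: ordgeM.
apply: ordgeD.
  apply: (o n.+2 1%N) => //; last by rewrite addn1.
  apply: ordgeB; first exact: (o 1%N n.+1).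
  by apply: (o n.+1 1%N) => //; rewrite addn1.
apply: ordgeB; apply: ordgeD.
- exact: (o 2%N n.+1).
- exact: (o 1%N n.+2).
- by apply: (o n.+2 1%N) => //; rewrite addn1.
- by apply: (o n.+1 2%N) => //; rewrite addn2.
Qed.

(** A product of two of the factors minus 1 has order at least 2(n + 1), hence at least n + 2; up to
    that order the product minus 1 is the sum of the Q_j - 1. *)
Lemma prod_first_order n (J : los) (Q D : J -> fps k I) S : multipl Q ->
  (forall j, ordge n.+1 (Q j - 1)) -> (forall j, ordge n.+2 (Q j - 1 - D j)) ->
  hs D S -> ordge n.+2 (iprod J Q - 1 - S).
Proof.
move=> mQ oQ oD hS.
have [T hT] := hs_ex mQ.
have oT : ordge n.+2 (T - S).
  apply: ordge_hs (hs_add hT (hs_opp hS)) _ => j; exact: oD.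
suff o : ordge n.+2 (iprod J Q - 1 - T).
  have -> : iprod J Q - 1 - S = (iprod J Q - 1 - T) + (T - S) by rewrite addrA subrK.
  exact: ordgeD.
move=> w hw; have cW := @factor_of_closed I w.
have [F hF hFw] := multipl_loc_incr mQ w.
have -> : (iprod J Q - 1 - T) w = (\prod_(j <- F) Q j - 1 - \sum_(j <- F) (Q j - 1)) w.
  rewrite 4!cB (prodE cW mQ hF hFw (factor_of_refl w)); congr (_ - _).
  rewrite csum; apply: (fs_seq _ _ (hT w)); first exact: incr_uniq.
  by move=> j /hFw /eqon_subr0; apply; exact: factor_of_refl.
suff [] : ordge n.+1 (\prod_(j <- F) Q j - 1) /\
    ordge n.+2 (\prod_(j <- F) Q j - 1 - \sum_(j <- F) (Q j - 1)) by move=> _; apply.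
elim: {hF hFw} F => [|a F [IH1 IH2]]; first by rewrite !big_nil subrr subr0.
rewrite !big_cons; move: (\prod_(j <- F) Q j) IH1 IH2 => A IH1 IH2.
have e : Q a * A - 1 = (Q a - 1) * (A - 1) + ((Q a - 1) + (A - 1)).
  by rewrite mulrBr mulr1 addrA subrK mulrBl mul1r addrA subrK.
have o2 : ordge n.+2 ((Q a - 1) * (A - 1)).
  by apply: (@ordge_le _ _ _ (n.+1 + n.+1)); [rewrite addSnnS leq_addl | exact: ordgeM].
split; rewrite e.
  by apply: ordgeD; [exact: ordge_le o2 | exact: ordgeD].
have e' (x y b c : fps k I) : x + (y + b) - (y + c) = x + (b - c).
  by rewrite -addrA opprD addrACA subrr add0r.
by rewrite e'; apply: ordgeD.
Qed.

Lemma X_loc w i : ~ List.In i w -> eqon (factor_of w) (X i) 0.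
Proof.
move=> hi u [a [b e]]; rewrite /sX; case: asboolP => // eu; case: hi.
by rewrite e eu; apply: List.in_or_app; right; left.
Qed.

(** At a word [w] only its own letters matter, so such families converge even over infinitely many
    variables. *)
Lemma multipl_X (F : I -> fps k I) :
  (forall w i, eqon (factor_of w) (X i) 0 -> eqon (factor_of w) (F i) 1) -> multipl F.
Proof.
move=> h; apply/multipl_loc => w; exists w => i iw; apply: h; apply: X_loc => hi.
case/negP: iw; elim: w hi => // a w IH [->|/IH]; rewrite inE ?eqxx // => ->.
by rewrite orbT.
Qed.

Lemma eqon_expX W i c : factor_closed W -> eqon W (X i) 0 -> eqon W (exp (c *: X i)) 1.
Proof.
move=> cW h; rewrite -(exp0 q I); apply: eqon_exp => //.
  by rewrite cZ cX_nil mulr0.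
by rewrite -(scaler0 _ c); exact: eqonZ.
Qed.

Lemma eqon_sinv W Q R : factor_closed W -> Q [::] = 1 -> R [::] = 1 ->
  eqon W Q R -> eqon W (sinv Q) (sinv R).
Proof.
move=> cW Q1 R1 h; apply: eqon_exp; rewrite ?cN ?log_nil ?oppr0 //.
by apply: eqonN; exact: eqon_log.
Qed.

Lemma exp_order P : P [::] = 0 -> ordge 2 (exp P - 1 - P).
Proof.
move=> P0; have o : ordge 1 (exp P - 1) by apply: ordge_sub1; rewrite exp_nil.
have := log_order q (exp_nil q P0) o (ltnSn 0).
by rewrite log_exp // => /ordgeN; rewrite opprB.
Qed.

Section Realize.
Variables (lt : I -> I -> Prop) (lin : is_linear lt).
Variable T : fps k I -> Prop.
Hypothesis T_Gr : forall Q, T Q -> in_Gr q Q.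

(** The class S of the result is kept apart from the class T of the given factors, so that a product
    of commutators with arbitrary group elements can be recorded as such. *)
Lemma dynkin_realize_step (S : fps k I -> Prop) n P (R : I -> fps k I) :
  (forall i Q, T Q -> S (scomm (exp (X i)) Q)) ->
  (forall Q : I -> fps k I, multipl Q -> (forall i, S (Q i)) -> S (iprod (Los lin) Q)) ->
  (forall i, T (R i) /\ ordge n.+2 (R i - 1 - dynkin n (lder i P))) ->
  (forall i, ordge n.+1 (R i - 1)) ->
  exists2 Q, S Q & ordge n.+3 (Q - 1 - dynkin n.+1 P).
Proof.
move=> Sc Sp hR oR; pose Q i := scomm (exp (X i)) (R i).
have X0 i := cX_nil k i.
have E1 i : exp (X i) [::] = 1 by exact: exp_nil.
have R1 i : R i [::] = 1 by apply: (in_Gr_nil (q := q)); apply: T_Gr; case: (hR i).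
have mQ : multipl Q.
  apply: multipl_X => w i h; have cW := @factor_of_closed I w.
  have h1 : eqon (factor_of w) (exp (X i)) 1 by have := eqon_expX 1 cW h; rewrite scale1r.
  have s1 : sinv 1 = 1 by rewrite /sinv log1 oppr0 exp0.
  rewrite -[1](sinvr (R1 i)) /Q /scomm; apply: eqonM => //.
  rewrite -[X in eqon _ _ X]mulr1 -s1; apply: eqonM => //.
    by rewrite -[X in eqon _ _ X]mul1r; apply: eqonM.
  by apply: eqon_sinv => //; rewrite c1.
have oQ i : ordge n.+3 (Q i - 1 - (X i * dynkin n (lder i P) - dynkin n (lder i P) * X i)).
  by apply: scomm_leading => //; [exact: exp_order | exact: (hR i).2].
exists (iprod (Los lin) Q); first by apply: Sp => // i; apply: Sc; case: (hR i).
apply: (prod_first_order (J := Los lin)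
  (D := fun i => X i * dynkin n (lder i P) - dynkin n (lder i P) * X i)) => //.
  move=> i; rewrite -[Q i - 1](subrK (X i * dynkin n (lder i P) - dynkin n (lder i P) * X i)).
  have oD : ordge n.+1 (dynkin n (lder i P)) by move=> u hu; rewrite dynkinE ltn_eqF.
  have oX : ordge 1 (X i) by apply/ordge1P.
  apply: ordgeD; first exact: ordge_le (oQ i).
  by apply: ordgeB; [rewrite -add1n | rewrite -addn1]; exact: ordgeM.
exact: hs_dynkinS.
Qed.

Hypothesis T_exp : forall i c, T (exp (c *: X i)).
Hypothesis T_comm : forall i Q, T Q -> T (scomm (exp (X i)) Q).
Hypothesis T_prod : forall Q : I -> fps k I, multipl Q ->
  (forall i, T (Q i)) -> T (iprod (Los lin) Q).

Lemma dynkin_order n P : ordge n.+1 (dynkin n P).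
Proof. by move=> u hu; rewrite dynkinE ltn_eqF. Qed.

Lemma dynkin_realize n P :
  exists2 Q, T Q & ordge n.+2 (Q - 1 - dynkin n P).
Proof.
elim: n P => [|n IH] P.
  have mQ : multipl (fun i => exp (P [:: i] *: X i)).
    by apply: multipl_X => w i h; apply: eqon_expX => //; exact: factor_of_closed.
  exists (iprod (Los lin) (fun i => exp (P [:: i] *: X i))); first exact: T_prod.
  have h0 i : (P [:: i] *: X i) [::] = 0 by rewrite cZ cX_nil mulr0.
  apply: (prod_first_order (J := Los lin) mQ _ _ (hs_dynkin0 P)) => i.
    by apply: ordge_sub1; exact: exp_nil.
  exact: exp_order.
have /choice[R hR] : forall i, exists Q, T Q /\ ordge n.+2 (Q - 1 - dynkin n (lder i P)).
  by move=> i; have [Q h1 h2] := IH (lder i P); exists Q.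
apply: (dynkin_realize_step (R := R)) => // i.
have -> : R i - 1 = (R i - 1 - dynkin n (lder i P)) + dynkin n (lder i P) by rewrite subrK.
by apply: ordgeD; [exact: ordge_le (hR i).2 | exact: dynkin_order].
Qed.

End Realize.

(** Q and log Q have the same leading term, and log Q is primitive; [dynkin n] multiplies its part
    of degree n + 1 by n + 1, which is divided out beforehand. *)
Lemma leading_term_realize n (S : fps k I -> Prop) Q :
  (forall P, exists R, [/\ S R, in_Gr q R & ordge n.+2 (R - 1 - dynkin n P)]) ->
  in_Gr q Q -> ordge n.+1 (Q - 1) ->
  exists R, [/\ S R, in_Gr q R & ordge n.+2 (Q - R)].
Proof.
move=> h hQ oQ; have Q1 := in_Gr_nil hQ.
have pL : prim (log Q) by apply: in_Lie_prim; exact: in_Lie_log.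
have [R [SR gR oR]] := h (q n.+1%:R^-1 *: log Q).
exists R; split=> //.
have o1 : ordge n.+2 (log Q - (Q - 1)).
  by apply: ordge_le (log_order q Q1 oQ (ltn0Sn n)); rewrite doubleS !ltnS -addnn leq_addr.
have oL : ordge n.+1 (log Q).
  rewrite -(subrK (Q - 1) (log Q)); apply: ordgeD => //; exact: ordge_le o1.
have o2 : ordge n.+2 (dynkin n (q n.+1%:R^-1 *: log Q) - log Q).
  move=> u hu; rewrite cB dynkin_prim; last exact: primZ.
  rewrite cZ mulrA mulrC; move: hu; rewrite /shorter ltnS leq_eqVlt => /orP[e|hu].
    by rewrite e [_ * q _]mulrC invnK mulr1 subrr.
  by rewrite ltn_eqF // oL ?subr0 // sub0r oppr0.
have e (A B L D : fps k I) : A - B = - (L - (A - 1)) - (B - 1 - D) - (D - L).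
  have h3 (a b c : fps k I) : a - b + (b - c) = a - c by rewrite addrA subrK.
  by rewrite !opprB [X in _ = X + _]addrC -addrA [RHS]addrC addrA h3 subrK h3.
rewrite (e Q R (log Q) (dynkin n (q n.+1%:R^-1 *: log Q))).
by apply: ordgeB => //; apply: ordgeB => //; exact: ordgeN.
Qed.

(* Peel off leading terms: [Q = R_m * R_(m+1) * ... ] with [R_n] realizing the
   leading term of the remaining factor. *)
Lemma topological_generation m (S : fps k I -> Prop) Q :
  (forall n P, (m <= n)%N ->
     exists R, [/\ S R, in_Gr q R & ordge n.+2 (R - 1 - dynkin n P)]) ->
  (forall F : nat -> fps k I, multipl F -> (forall n, S (F n)) -> S (iprod nat_los F)) ->
  in_Gr q Q -> ordge m.+1 (Q - 1) -> S Q.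
Proof.
move=> h Sp hQ oQ.
(* The choice is made for all pairs, with the arbitrary value 0 where the conditions fail, so that
   the recursion for the remainders [Qs] carries no proofs. *)
have /choice[f hf] : forall nQ : nat * fps k I, exists R, (m <= nQ.1)%N ->
    in_Gr q nQ.2 -> ordge nQ.1.+1 (nQ.2 - 1) ->
    [/\ S R, in_Gr q R & ordge nQ.1.+2 (nQ.2 - R)].
  move=> [n Q'] /=; case: (pselect [/\ (m <= n)%N, in_Gr q Q' & ordge n.+1 (Q' - 1)]) => [[h1 h2 h3]|hn].
    by have [R hR] := leading_term_realize (fun P => h n P h1) h2 h3; exists R.
  by exists 0 => h1 h2 h3; case: hn.
pose fix Qs n := if n is n'.+1 then sinv (f (m + n', Qs n')%N) * Qs n' else Q.
pose Rs n := f ((m + n)%N, Qs n).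
have inv n : in_Gr q (Qs n) /\ ordge (m + n).+1 (Qs n - 1).
  elim: n => [|n [IH1 IH2]]; first by rewrite addn0.
  have [SR gR oR] := hf ((m + n)%N, Qs n) (leq_addr _ _) IH1 IH2.
  split=> /=; first by apply: in_GrM => //; exact: in_Gr_sinv.
  have R1 := in_Gr_nil gR.
  rewrite -[X in _ - X](sinvl R1) -mulrBr addnS -[_.+2]add0n.
  exact: ordgeM.
have hR n : [/\ S (Rs n), in_Gr q (Rs n) & ordge (m + n).+2 (Qs n - Rs n)].
  by have [h1 h2] := inv n; apply: (hf ((m + n)%N, Qs n)) => //; exact: leq_addr.
have oR n : ordge (m + n).+1 (Rs n - 1).
  have [_ _ o] := hR n; have [_ o'] := inv n.
  have -> : Rs n - 1 = (Qs n - 1) - (Qs n - Rs n) by rewrite opprB [RHS]addrC addrA subrK.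
  by apply: ordgeB => //; exact: ordge_le o.
have fsub w n P : (size w < n)%N -> eqon (shorter n) P 1 -> eqon (factor_of w) P 1.
  move=> hw o u [a [b e]]; apply: o; rewrite /shorter; apply: leq_ltn_trans hw.
  by rewrite e !size_cat addnCA leq_addr.
have locR w n : (size w <= n)%N -> eqon (factor_of w) (Rs n) 1.
  move=> hn; apply: (fsub _ (m + n).+1); first by rewrite ltnS (leq_trans hn) ?leq_addl.
  by apply/ordgeP.
have mR : multipl Rs.
  apply/multipl_loc => w; exists (iota 0 (size w)) => n.
  by rewrite mem_classic mem_iota add0n -leqNgt => /locR.
have -> : Q = iprod nat_los Rs.
  apply/eqonP => w; have cW := @factor_of_closed I w; apply: eqon_sym.
  apply: (eqon_trans (Q := \prod_(n <- iota 0 (size w)) Rs n)).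
    apply: prodE => //; first exact: incr_iota.
    by move=> n; rewrite mem_classic mem_iota add0n -leqNgt => /locR.
  have {1}-> : Q = \prod_(n <- iota 0 (size w)) Rs n * Qs (size w).
    elim: (size w) => [|n IH]; first by rewrite big_nil mul1r.
    rewrite -[n.+1]addn1 iotaD big_cat big_seq1 add0n addn1 /= -mulrA (mulrA (Rs n)).
    by rewrite sinvr ?mul1r //; apply: (in_Gr_nil (q := q)); case: (hR n).
  rewrite -[X in eqon _ X _]mulr1; apply: eqonM => //.
  apply: eqon_sym; apply: (fsub _ (m + size w).+1); first by rewrite ltnS leq_addl.
  by apply/ordgeP; case: (inv (size w)).
by apply: Sp => // n; case: (hR n).
Qed.

Theorem Gr_generation (S : fps k I -> Prop) :
  (forall P Q, in_Gr q P -> in_Gr q Q -> S P -> S Q -> S (P * Q)) ->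
  (forall P, in_Gr q P -> S P -> S (sinv P)) ->
  (forall (J : los) (F : J -> fps k I), multipl F -> (forall j, in_Gr q (F j)) ->
     (forall j, S (F j)) -> S (iprod J F)) ->
  (forall i c, S (exp (c *: X i))) ->
  forall Q, in_Gr q Q -> S Q.
Proof.
move=> SM SV Sp SX Q hQ.
have [lt lin] := linear_order_exists I.
pose T Q := in_Gr q Q /\ S Q.
have gX i c : in_Gr q (exp (c *: X i)).
  by apply: in_Gr_exp; apply: in_LieZ; exact: in_LieX.
have TP (J : los) (F : J -> fps k I) : multipl F -> (forall j, T (F j)) -> T (iprod J F).
  move=> mF hF; have gF j : in_Gr q (F j) by case: (hF j).
  split; first exact: in_Gr_series_prod.
  by apply: Sp => // j; case: (hF j).
have TC i R : T R -> T (scomm (exp (X i)) R).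
  move=> [gR SR]; have := gX i 1; have := SX i 1; rewrite scale1r => Si gi.
  have gsi := in_Gr_sinv gi; have gsR := in_Gr_sinv gR.
  split; first exact: in_Gr_scomm.
  have g1 := in_GrM gi gR; have g2 := in_GrM g1 gsi.
  by apply: (SM _ _ g2 gsR); [apply: (SM _ _ g1 gsi); [exact: SM | exact: SV] | exact: SV].
suff : T Q by case.
have o1 : ordge 1 (Q - 1) by apply: ordge_sub1; exact: in_Gr_nil hQ.
apply: (topological_generation (m := 0)) o1 => // [n P _|F]; last exact: (TP nat_los).
have [R TR oR] := @dynkin_realize lt lin T (fun _ h => h.1) (fun i c => conj (gX i c) (SX i c))
  TC (TP (Los lin)) n P.
by exists R; split=> //; case: TR.
Qed.

(** In degree at least 2 the Dynkin operator is a sum of brackets with a variable, so no factor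
    exp(c X_i) is required: the peeling starts at m = 1. The element R ranges over the whole group,
    since in each commutator only one entry has to be a generator. *)
Theorem Gr_commutator_generation (S : fps k I -> Prop) :
  (forall (J : los) (F : J -> fps k I), multipl F -> (forall j, in_Gr q (F j)) ->
     (forall j, S (F j)) -> S (iprod J F)) ->
  (forall i R, in_Gr q R -> S (scomm (exp (X i)) R)) ->
  forall Q, in_Gr q Q -> ordge 2 (Q - 1) -> S Q.
Proof.
move=> Sp SC Q hQ oQ.
have [lt lin] := linear_order_exists I.
have gX i c : in_Gr q (exp (c *: X i)).
  by apply: in_Gr_exp; apply: in_LieZ; exact: in_LieX.
have gX1 i : in_Gr q (exp (X i)) by have := gX i 1; rewrite scale1r.
pose T Q := in_Gr q Q /\ S Q.
have TP (J : los) (F : J -> fps k I) : multipl F -> (forall j, T (F j)) -> T (iprod J F).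
  move=> mF hF; have gF j : in_Gr q (F j) by case: (hF j).
  split; first exact: in_Gr_series_prod.
  by apply: Sp => // j; case: (hF j).
suff : T Q by case.
apply: (topological_generation (m := 1)) => // [[//|n] P _|F]; last exact: (TP nat_los).
have real n' P' := @dynkin_realize lt lin (@in_Gr k q I) (fun _ => id) gX
  (fun i R => in_Gr_scomm (gX1 i)) (fun F mF hF => in_Gr_series_prod (J := Los lin) mF hF) n' P'.
have /choice[R hR] : forall i, exists Q, in_Gr q Q /\ ordge n.+2 (Q - 1 - dynkin n (lder i P)).
  by move=> i; have [Q' h1 h2] := real n (lder i P); exists Q'.
have [||||Q' [gQ' SQ'] oQ'] := @dynkin_realize_step lt lin (@in_Gr k q I) (fun _ => id) T n P R.
- by move=> i Q' gQ'; split; [exact: in_Gr_scomm | exact: SC].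
- by move=> F; exact: (TP (Los lin)).
- exact: hR.
- move=> i; have -> : R i - 1 = (R i - 1 - dynkin n (lder i P)) + dynkin n (lder i P) by rewrite subrK.
  by apply: ordgeD; [exact: ordge_le (hR i).2 | exact: dynkin_order].
- by exists Q'; split.
Qed.

End Generation.

(** * Evaluations in a summability Lie algebra *)

Lemma theE (T : Type) (x0 x : T) (P : T -> Prop) :
  P x -> (forall y, P y -> y = x) -> the x0 P = x.
Proof.
move=> Px h; rewrite /the; case: pselect => [ex|[]]; last by exists x.
exact: h (projT2 (cid ex)).
Qed.

Lemma finite_classic (T : finType) (A : set {classic T}) : finite_set A.
Proof.
apply: (@sub_finite_set _ A [set` (enum T : seq {classic T})]%classic).
  by move=> x _; rewrite /= mem_classic mem_enum.
exact: finite_seq.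
Qed.

Section EvLie.
Variables (k : comPzRingType) (q : {rmorphism rat -> k}) (L : salg k).
Hypothesis (slieL : is_slie L) (evL : has_evLie L).

Let aL := slie_salg slieL.
Let modL := salg_module aL.
Let sumL := salg_summability aL.

Lemma sa_addI (x y : L) : sa_add x y = x -> y = sa_zero L.
Proof.
move=> h; rewrite -(sa_add0 modL y) -(sa_addN modL x) -(sa_addA modL) h.
by rewrite (sa_addN modL).
Qed.

Lemma sa_scale0 (x : L) : sa_scale 0 x = sa_zero L.
Proof. by apply: (sa_addI (x := sa_scale 0 x)); rewrite -(sa_scaleDl modL) addr0. Qed.

Lemma sa_scaleN1 (x : L) : sa_scale (-1) x = sa_opp x.
Proof.
rewrite -[LHS](sa_add0 modL) -(sa_addN modL x) -(sa_addA modL).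
rewrite -{2}(sa_scale1 modL x) -(sa_scaleDl modL) subrr sa_scale0.
by rewrite (sa_addC modL) (sa_add0 modL).
Qed.

Lemma summable_fin (T : finType) (v : T -> L) : summable v.
Proof. by eexists; apply: (sm1 sumL (I := T)); exact: finite_classic. Qed.

Section Eval.
Variables (I : Type) (a : I -> L).
Hypothesis sa : summable a.
Implicit Types (P Q : fps k I).

Local Notation ev P := (evLie a (P : fps k I)).

Lemma evLieE : exists e, is_evLie a e /\
  forall P (hP : in_Lie P), ev P = e (exist _ P hP).
Proof.
have [e [he ue]] := evL sa; exists e; split=> // P hP; rewrite /evLie.
apply: theE; first by exists e => //; exists (exist _ P hP).
by move=> y [e' /ue <- [p ep <-]]; congr e; apply: sval_eq.
Qed.

Lemma evLieD P Q : in_Lie P -> in_Lie Q -> ev (P + Q) = sa_add (ev P) (ev Q).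
Proof.
move=> hP hQ; have [e [[[eD _ _ _] _] eE]] := evLieE.
rewrite (eE _ hP) (eE _ hQ) (eE _ (in_LieD hP hQ)) -eD.
by congr e; apply: sval_eq.
Qed.

Lemma evLieZ c P : in_Lie P -> ev (c *: P) = sa_scale c (ev P).
Proof.
move=> hP; have [e [[[_ eZ _ _] _] eE]] := evLieE.
by rewrite (eE _ hP) (eE _ (in_LieZ c hP)) -eZ; congr e; apply: sval_eq.
Qed.

Lemma evLieM P Q : in_Lie P -> in_Lie Q ->
  ev (P * Q - Q * P) = sa_mul (ev P) (ev Q).
Proof.
move=> hP hQ; have [e [[[_ _ eM _] _] eE]] := evLieE.
rewrite (eE _ hP) (eE _ hQ) (eE _ (in_Lie_bracket hP hQ)) -eM.
by congr e; apply: sval_eq.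
Qed.

Lemma evLie_sum (J : Type) (P : J -> fps k I) S : (forall j, in_Lie (P j)) ->
  hs P S -> sa_sum (fun j => ev (P j)) (ev S).
Proof.
move=> hP hS; have [e [[[_ _ _ eS] _] eE]] := evLieE.
rewrite (eE _ (in_Lie_sum hP hS)).
have -> : (fun j => ev (P j)) = e \o (fun j => exist _ (P j) (hP j) : LieSeries k I).
  by apply: funext => j; rewrite (eE _ (hP j)).
by apply: eS; apply/hsP.
Qed.

Lemma evLieX i : ev (sX k i) = a i.
Proof.
have [e [[_ eX] eE]] := evLieE; rewrite -eX (eE _ (in_LieX (k := k) i)).
by congr e; apply: sval_eq.
Qed.

Lemma evLie0 : ev 0 = sa_zero L.
Proof. by rewrite -(scale0r 0) evLieZ ?sa_scale0 //; exact: in_Lie0. Qed.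

Lemma evLieN P : in_Lie P -> ev (- P) = sa_opp (ev P).
Proof. by move=> hP; rewrite -scaleN1r evLieZ // sa_scaleN1. Qed.

Lemma evLie_unique (F : fps k I -> L) :
  (forall P Q, in_Lie P -> in_Lie Q -> F (P + Q) = sa_add (F P) (F Q)) ->
  (forall c P, in_Lie P -> F (c *: P) = sa_scale c (F P)) ->
  (forall P Q, in_Lie P -> in_Lie Q -> F (P * Q - Q * P) = sa_mul (F P) (F Q)) ->
  (forall (J : Type) (P : J -> fps k I) S, (forall j, in_Lie (P j)) ->
    hs P S -> sa_sum (fun j => F (P j)) (F S)) ->
  (forall i, F (sX k i) = a i) ->
  forall P, in_Lie P -> F P = ev P.
Proof.
move=> FD FZ FM FS FX P hP; have [e [ie eE]] := evLieE; rewrite (eE P hP).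
have [e' [_ ue]] := evL sa.
have <- : e' = e by apply: ue.
have -> : e' = fun p => F (sval p); last by [].
apply: ue; split; last by move=> i; exact: FX.
split.
- by move=> [x hx] [y hy]; exact: FD.
- by move=> c [x hx]; exact: FZ.
- by move=> [x hx] [y hy]; exact: FM.
- by move=> J v s /hsP h; apply: FS h => j; exact: svalP.
Qed.

End Eval.

Lemma evLie_subst (I J : Type) (a : I -> L) (P : J -> fps k I) R : summable a ->
  (forall j, in_Lie (P j)) -> summ P -> in_Lie R ->
  evLie a (subst P R) = evLie (fun j => evLie a (P j)) R.
Proof.
move=> sa hP sP; have P0 j := in_Lie_nil (hP j).
have hL Q := @subst_in_Lie k I J P P0 sP Q hP.
have sb : summable (fun j => evLie a (P j)).
  by have [S hS] := hs_ex sP; exists (evLie a S); exact: evLie_sum.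
move: R; apply: (evLie_unique sb).
- by move=> Q R hQ hR; rewrite substD // evLieD //; exact: hL.
- by move=> c Q hQ; rewrite substZ // evLieZ //; exact: hL.
- by move=> Q R hQ hR; rewrite substB // !substM // evLieM //; exact: hL.
- move=> T Q S hQ hS; apply: evLie_sum => //; first by move=> t; exact: hL.
  exact: subst_hs.
- by move=> j; rewrite substX.
Qed.

(** * The group attached to a Lie algebra *)

Local Notation exp P := (sexp q P).
Local Notation log Q := (slog q Q).
Local Notation G := (Gr q L).

Section EvalGroup.
Variables (I : Type) (a : I -> L).
Hypothesis sa : summable a.
Implicit Types (P Q R : fps k I).

(** The candidate for the group evaluation in Gr(L). The lemmas below show that it respects all
    operations, so identities between series become identities in Gr(L). *)
Definition evlog Q : G := evLie a (log Q).

Lemma multipl_exp (J : Type) (P : J -> fps k I) :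
  (forall j, P j [::] = 0) -> summ P -> multipl (fun j => exp (P j) : fps k I).
Proof.
move=> P0 /summ_loc h; apply/multipl_loc => w; have [r hr] := h w.
exists r => j /hr hj; rewrite -(exp0 q I); apply: eqon_exp => //.
exact: factor_of_closed.
Qed.

Lemma summ_log (J : Type) (Q : J -> fps k I) :
  (forall j, Q j [::] = 1) -> multipl Q -> summ (fun j => log (Q j) : fps k I).
Proof.
move=> Q1 /multipl_loc h; apply/summ_loc => w; have [r hr] := h w.
exists r => j /hr hj; rewrite -(log1 q I); apply: eqon_log => //.
exact: factor_of_closed.
Qed.

Lemma summ_X (J : Type) : summ (fun j : J => sX k j : fps k J).
Proof.
move=> w; exists (w : seq {classic J}) => j jw; rewrite /sX asboolF // => e.
by move: jw; rewrite e inE eqxx.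
Qed.

Lemma multipl_expX (J : Type) : multipl (fun j : J => exp (sX k j) : fps k J).
Proof.
move/(@summ_loc _ _ _ _): (@summ_X J) => h; apply/multipl_loc => w.
have [r hr] := h w; exists r => j /hr hj; rewrite -(exp0 q J).
by apply: eqon_exp => //; [exact: factor_of_closed | exact: cX_nil].
Qed.

Lemma in_Gr_expX (J : Type) (j : J) : in_Gr q (exp (sX k j)).
Proof. by apply: in_Gr_exp; exact: in_LieX. Qed.

Lemma summ_fin (T : finType) (P : T -> fps k I) : summ P.
Proof. by move=> w; exists (enum T : seq {classic T}) => j; rewrite mem_classic mem_enum. Qed.

(** Substituting log Q and log R for the two variables turns log(exp X0 exp X1) into log(Q R). *)
Lemma evlogM Q R : in_Gr q Q -> in_Gr q R ->
  pg_mul (evlog Q) (evlog R) = evlog (Q * R).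
Proof.
move=> hQ hR; have [Q1 R1] := (in_Gr_nil hQ, in_Gr_nil hR).
pose P : 'I_2 -> fps k I := pair2 (log Q : fps k I) (log R : fps k I).
have hP i : in_Lie (P i) by rewrite /P /pair2; case: ifP => _; exact: in_Lie_log.
have P0 i := in_Lie_nil (hP i).
have sP : summ P := summ_fin P.
have Xz i : (sX k i : fps k 'I_2) [::] = 0 by exact: cX_nil.
have gr : in_Gr q ((exp (X0 k) : fps k _) * exp (X1 k) : fps k 'I_2).
  by apply: in_GrM; exact: in_Gr_expX.
rewrite /evlog /=.
have -> : pair2 (evLie a (log Q)) (evLie a (log R)) = fun i => evLie a (P i).
  by apply: funext => i; rewrite /P /pair2; case: ifP.
rewrite -evLie_subst //; last exact: in_Lie_log.
rewrite subst_log //; last exact: in_Gr_nil gr.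
rewrite substM // !subst_exp //; try exact: Xz.
rewrite -[X0 k]/(sX k _ : fps k 'I_2) -[X1 k]/(sX k _ : fps k 'I_2) !substX //.
by rewrite /P /pair2 /= !exp_log.
Qed.

Lemma evlog_prod (J : los) (Q : J -> fps k I) : multipl Q ->
  (forall j, in_Gr q (Q j)) ->
  @pg_prod k G J (fun j => evlog (Q j)) (evlog (series_prod Q)).
Proof.
move=> mQ hQ; pose P j : fps k I := log (Q j).
have Q1 j := in_Gr_nil (hQ j).
have hP j : in_Lie (P j) by exact: in_Lie_log.
have P0 j := in_Lie_nil (hP j).
have sP : summ P by exact: summ_log.
have mX := @multipl_expX J.
have gr : in_Gr q (series_prod (fun j : J => exp (sX k j))).
  by apply: in_Gr_series_prod => // j; exact: in_Gr_expX.
split; first by have [S hS] := hs_ex sP; exists (evLie a S); exact: evLie_sum.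
rewrite /evlog -[RHS](evLie_subst (P := P)) //; last exact: in_Lie_log.
rewrite subst_log //; last exact: in_Gr_nil gr.
rewrite subst_series_prod //; congr (evLie a (log (series_prod _))).
apply: funext => j; rewrite subst_exp ?cX_nil // substX //.
by rewrite exp_log.
Qed.

Lemma evlog_exp P : P [::] = 0 -> evlog (exp P) = evLie a P.
Proof. by move=> P0; rewrite /evlog log_exp. Qed.

Lemma evlogX i : evlog (exp (sX k i)) = a i.
Proof. by rewrite evlog_exp ?evLieX ?cX_nil. Qed.

Lemma evlog1 : evlog 1 = pg_one G.
Proof. by rewrite /evlog log1 evLie0. Qed.

Lemma evlog_pow Q c : in_Gr q Q ->
  pg_pow (evlog Q) c = evlog (exp (c *: (log Q : fps k I))).
Proof.
move=> hQ; rewrite evlog_exp; last by rewrite cZ log_nil ?mulr0 //; exact: in_Gr_nil hQ.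
by rewrite evLieZ //; exact: in_Lie_log.
Qed.

Lemma evlog_inv Q : in_Gr q Q -> pg_inv (evlog Q) = evlog (sinv q Q).
Proof.
move=> hQ; rewrite /sinv evlog_exp; last by rewrite cN log_nil ?oppr0 //; exact: in_Gr_nil hQ.
by rewrite evLieN //; exact: in_Lie_log.
Qed.

Lemma evlog_prod_eq (J : los) (Q : J -> fps k I) p : multipl Q ->
  (forall j, in_Gr q (Q j)) ->
  @pg_prod k G J (fun j => evlog (Q j)) p -> p = evlog (series_prod Q).
Proof. by move=> mQ hQ [_ ->]; have [_ ->] := evlog_prod mQ hQ. Qed.

End EvalGroup.

End EvLie.

(** * Coefficients at single letters, and conjugation *)

Section Letters.
Variables (k : comPzRingType) (q : {rmorphism rat -> k}) (I : Type).
Implicit Types (P Q R : fps k I).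
Local Notation exp P := (sexp q (P : fps k I) : fps k I).
Local Notation log Q := (slog q (Q : fps k I) : fps k I).

Lemma letterM Q R a : Q [::] = 1 -> R [::] = 1 ->
  (Q * R) [:: a] = Q [:: a] + R [:: a].
Proof. by move=> Q1 R1; rewrite cM_cons cM_nil Q1 R1 mul1r mulr1 addrC. Qed.

Lemma letter_exp P a : P [::] = 0 -> (exp P) [:: a] = P [:: a].
Proof.
move=> P0; apply/eqP; rewrite -subr_eq0; apply/eqP.
have := exp_order q P0 (w := [:: a]) isT.
by rewrite !cB c1 subr0.
Qed.

Lemma letter_log Q a : Q [::] = 1 -> (log Q) [:: a] = Q [:: a].
Proof. by move=> Q1; rewrite -{2}(exp_log q Q1) letter_exp // log_nil. Qed.

Lemma conjX (A B P : fps k I) n : A * B = 1 -> B * A = 1 ->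
  (A * P * B) ^+ n = A * P ^+ n * B.
Proof.
move=> AB BA; elim: n => [|n IH]; first by rewrite !expr0 mulr1.
by rewrite !exprS IH !mulrA -[A * P * B * A]mulrA BA mulr1.
Qed.

Lemma exp_conj (A B P : fps k I) : A * B = 1 -> B * A = 1 -> P [::] = 0 ->
  exp (A * P * B) = A * exp P * B.
Proof.
move=> AB BA P0; have c0 : (A * P * B) [::] = 0 by rewrite !cM_nil P0 mulr0 mul0r.
apply: hs_fun (hs_exp q c0) _; apply: hs_ext (hs_mulr _ (hs_mull _ (hs_exp q P0))) => n.
by rewrite conjX // -fps_scaleAr -fps_scaleAl.
Qed.

Lemma log_conj (A B Q : fps k I) : A * B = 1 -> B * A = 1 -> Q [::] = 1 ->
  log (A * Q * B) = A * log Q * B.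
Proof.
move=> AB BA Q1; have l0 := log_nil q Q1.
by rewrite -{1}(exp_log q Q1) -exp_conj // log_exp // !cM_nil l0 mulr0 mul0r.
Qed.

End Letters.

(** * The exponential group axioms for Gr(L) *)

Section GrAxioms.
Variables (k : comPzRingType) (q : {rmorphism rat -> k}) (L : salg k).
Hypothesis (slieL : is_slie L) (evL : has_evLie L).

Let modL := salg_module (slie_salg slieL).
Let sumL := salg_summability (slie_salg slieL).

Local Notation exp P := (sexp q (P : fps k _) : fps k _).
Local Notation log Q := (slog q (Q : fps k _) : fps k _).
Local Notation G := (Gr q L).
Local Notation E i := (exp (sX k i) : fps k _).

Let gX (J : Type) (j : J) : in_Gr q (exp (sX k j)) := in_Gr_expX q j.

Lemma Gr_in_dom (J : los) (g : J -> L) : @in_dom k G J g <-> summable g.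
Proof. by split=> [[p []]|h] //; eexists; split. Qed.

Lemma Gr_multipliable (J : Type) (g : J -> L) : @multipliable k G J g <-> summable g.
Proof.
split=> [[lt [lin /Gr_in_dom]]//|h].
by have [lt lin] := linear_order_exists J; exists lt, lin; apply/Gr_in_dom.
Qed.

(** Any three elements are the values of three free generators under one evaluation; [option bool]
    is just a set with three elements. *)
Lemma as_evlog3 (x y z : L) : exists a : option bool -> L,
  [/\ summable a, x = evlog q a (E None), y = evlog q a (E (Some true)) &
      z = evlog q a (E (Some false))].
Proof.
pose a (i : option bool) := match i with None => x | Some true => y | Some false => z end.
have sa : summable a := summable_fin slieL (T := option bool) a.
by exists a; rewrite !evlogX.
Qed.

Lemma Gr_mulA : associative (@pg_mul k G).
Proof.
move=> x y z; have [a [sa -> -> ->]] := as_evlog3 x y z.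
by rewrite !evlogM // ?mulrA //; exact: in_GrM.
Qed.

Lemma as_evlog1 (x : L) : exists a : unit -> L, summable a /\ x = evlog q a (E tt).
Proof.
have sa : summable (fun _ : unit => x) := summable_fin slieL (T := unit) _.
by exists (fun=> x); rewrite evlogX.
Qed.

Lemma as_evlog2 (x y : L) : exists a : bool -> L,
  [/\ summable a, x = evlog q a (E true) & y = evlog q a (E false)].
Proof.
have sa : summable (fun b : bool => if b then x else y) := summable_fin slieL (T := bool) _.
by exists (fun b : bool => if b then x else y); rewrite !evlogX.
Qed.

Lemma Gr_mul1g : left_id (pg_one G) (@pg_mul k G).
Proof.
move=> x; have [a [sa ->]] := as_evlog1 x.
by rewrite -(evlog1 q slieL evL sa) evlogM ?mul1r //; exact: in_Gr1.
Qed.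

Lemma Gr_mulg1 : right_id (pg_one G) (@pg_mul k G).
Proof.
move=> x; have [a [sa ->]] := as_evlog1 x.
by rewrite -(evlog1 q slieL evL sa) evlogM ?mulr1 //; exact: in_Gr1.
Qed.

Lemma Gr_mulVg : left_inverse (pg_one G) (@pg_inv k G) (@pg_mul k G).
Proof.
move=> x; have [a [sa ->]] := as_evlog1 x.
rewrite evlog_inv // evlogM //; last exact: in_Gr_sinv.
rewrite sinvl ?evlog1 //; exact: in_Gr_nil (gX tt).
Qed.

Lemma Gr_mulgV : right_inverse (pg_one G) (@pg_inv k G) (@pg_mul k G).
Proof.
move=> x; have [a [sa ->]] := as_evlog1 x.
rewrite evlog_inv // evlogM //; last exact: in_Gr_sinv.
rewrite sinvr ?evlog1 //; exact: in_Gr_nil (gX tt).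
Qed.

Lemma Gr_powD (f : G) (a b : k) : pg_pow f (a + b) = pg_mul (pg_pow f a) (pg_pow f b).
Proof.
have [c [sc ->]] := as_evlog1 f.
have gp d : in_Gr q (exp (d *: (log (E tt) : fps k _))).
  by apply: in_Gr_exp; apply: in_LieZ; exact: in_Lie_log.
rewrite !evlog_pow // evlogM // exp_scaleD // log_nil //; exact: in_Gr_nil (gX tt).
Qed.

Lemma Gr_powJ (f g : G) (a : k) :
  pg_pow (pg_mul (pg_mul f g) (pg_inv f)) a =
  pg_mul (pg_mul f (pg_pow g a)) (pg_inv f).
Proof.
have [c [sc -> ->]] := as_evlog2 f g.
have gV i := in_Gr_sinv (gX (i : bool)).
have E1 i := in_Gr_nil (gX (i : bool)).
have l0 i : (log (E (i : bool)) : fps k _) [::] = 0 by rewrite log_nil.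
have gp d : in_Gr q (exp (d *: (log (E false) : fps k _))).
  by apply: in_Gr_exp; apply: in_LieZ; exact: in_Lie_log.
have g2 := in_GrM (gX true) (gX false); have g3 := in_GrM g2 (gV true).
have g4 := in_GrM (gX true) (gp a).
rewrite evlog_inv // evlog_pow // !evlogM // evlog_pow //.
have AB := sinvr q (E1 true); have BA := sinvl q (E1 true).
rewrite (log_conj q AB BA (E1 false)).
have -> (A B P : fps k bool) : a *: (A * P * B) = A * (a *: P) * B.
  by rewrite fps_scaleAl fps_scaleAr.
by rewrite (exp_conj q AB BA) // cZ l0 mulr0.
Qed.

Lemma Gr_powM (f : G) (a b : k) : pg_pow (pg_pow f a) b = pg_pow f (a * b).
Proof. by rewrite /= (sa_scaleA modL) mulrC. Qed.

Lemma Gr_prod1 (J : los) : @pg_prod k G J (fun=> pg_one G) (pg_one G).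
Proof.
have sa : summable (fun _ : unit => sa_zero L) := summable_fin slieL (T := unit) _.
have [m1 e1] := @series_prod_fin k unit J (fun=> 1) [::] (incr_nil J) (fun _ _ => erefl).
have := evlog_prod evL sa m1 (fun _ => in_Gr1 q unit).
by rewrite e1 big_nil evlog1.
Qed.

(* The relation [f g = g f] does not lift to the variables, but the element
   [(f g)^a (g^a)^-1 (f^a)^-1] lifts to a series of order at least 2, hence to an
   infinite product of commutators of a generator with elements of the group; as
   the evaluations commute with [f] and [g], these commutators evaluate to 1. *)
Lemma Gr_powMg (f g : G) (a : k) : pg_mul f g = pg_mul g f ->
  pg_pow (pg_mul f g) a = pg_mul (pg_pow f a) (pg_pow g a).
Proof.
move=> fg; pose c b : L := if b then f else g.
have sc : summable c := summable_fin slieL (T := bool) c.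
have gV i := in_Gr_sinv (gX (i : bool)).
have E1 i := in_Gr_nil (gX (i : bool)).
have X0 i := cX_nil k (i : bool).
have ceq b : c b = evlog q c (E b) by rewrite evlogX.
have mulK (x y : G) : pg_mul (pg_mul x y) (pg_inv y) = x.
  by rewrite -Gr_mulA Gr_mulgV Gr_mulg1.
have mulVK (x y : G) : pg_mul (pg_mul x (pg_inv y)) y = x.
  by rewrite -Gr_mulA Gr_mulVg Gr_mulg1.
have com_conj (x y : G) : pg_mul x y = pg_mul y x <-> pg_mul (pg_mul x y) (pg_inv x) = y.
  split=> [->|h]; first by rewrite mulK.
  by rewrite -{2}h mulVK.
have com_pow (x y : G) (d : k) : pg_mul x y = pg_mul y x ->
    pg_mul x (pg_pow y d) = pg_mul (pg_pow y d) x.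
  by move=> /com_conj h; apply/com_conj; rewrite -Gr_powJ h.
have com_inv (x y : G) : pg_mul x y = pg_mul y x ->
    pg_mul x (pg_inv y) = pg_mul (pg_inv y) x.
  move=> h; rewrite -[RHS](mulK _ y) -(Gr_mulA (pg_inv y) x y) h Gr_mulA.
  by rewrite Gr_mulVg Gr_mul1g.
have commute_all Q : in_Gr q Q -> forall b, pg_mul (c b : G) (evlog q c Q) = pg_mul (evlog q c Q) (c b).
  move: Q; apply: Gr_generation.
  - move=> P Q hP hQ cP cQ b; rewrite -evlogM // Gr_mulA cP -!Gr_mulA; congr pg_mul; exact: cQ.
  - by move=> P hP cP b; rewrite -evlog_inv //; exact: com_inv.
  (* Conjugation by [c b] fixes every factor, and for series it commutes with infinite products. *)
  - move=> J F mF hF cF b; apply/com_conj; rewrite ceq evlog_inv // !evlogM //; first last.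
    + exact: in_Gr_series_prod.
    + by apply: in_GrM => //; exact: in_Gr_series_prod.
    have AB := sinvr q (E1 b); have BA := sinvl q (E1 b).
    rewrite -(series_prod_conj mF AB BA); apply: (evlog_prod_eq evL sc mF hF).
    have gJ j : in_Gr q (E b * F j * sinv q (E b)) by do 2 apply: in_GrM => //.
    have -> : (fun j => evlog q c (F j)) = fun j => evlog q c (E b * F j * sinv q (E b)).
      apply: funext => j; rewrite -!evlogM //; last exact: in_GrM.
      by rewrite -evlog_inv // -ceq cF mulK.
    exact: evlog_prod (multipl_conj mF AB) gJ.
  - move=> i d b; have -> : evlog q c (exp (d *: (sX k i : fps k bool))) = pg_pow (c i : G) d.
      by rewrite [in RHS]ceq evlog_pow // log_exp.
    apply: com_pow; case: b; case: i => //; by rewrite /c fg.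
have triv (Q : fps k bool) : in_Gr q Q -> ordge 2 (Q - 1) -> evlog q c Q = pg_one G.
  move: Q; apply: (@Gr_commutator_generation k q bool (fun Q => evlog q c Q = pg_one G)).
  - move=> J F mF hF F1; apply/esym; apply: (evlog_prod_eq evL sc mF hF).
    have -> : (fun j => evlog q c (F j)) = fun=> pg_one G by apply: funext.
    exact: Gr_prod1.
  - move=> i R gR; have gRV := in_Gr_sinv gR; have g1 := in_GrM (gX i) gR.
    rewrite /scomm -!evlogM //; last exact: in_GrM.
    have -> : evlog q c (E i) = c i by rewrite -ceq.
    rewrite (commute_all R gR i) -(evlog_inv slieL evL sc (gX i)) -(evlog_inv slieL evL sc gR).
    rewrite -(ceq i) mulK; exact: Gr_mulgV.
have gp i d : in_Gr q (exp (d *: (log (E (i : bool)) : fps k _))).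
  by apply: in_Gr_exp; apply: in_LieZ; exact: in_Lie_log.
have gtf := in_GrM (gX true) (gX false).
have tf1 := in_Gr_nil gtf.
have gp2 : in_Gr q (exp (a *: (log (E true * E false) : fps k _))).
  by apply: in_Gr_exp; apply: in_LieZ; exact: in_Lie_log.
have l0 i : (log (E (i : bool)) : fps k _) [::] = 0 by rewrite log_nil.
have lz i d : (d *: (log (E (i : bool)) : fps k _)) [::] = 0 by rewrite cZ l0 mulr0.
have ltf : (a *: (log (E true * E false) : fps k bool)) [::] = 0 by rewrite cZ log_nil // mulr0.
pose Q : fps k bool := exp (a *: (log (E true * E false) : fps k _)) *
  exp (- a *: (log (E false) : fps k _)) * exp (- a *: (log (E true) : fps k _)).
have g12 := in_GrM gp2 (gp false (- a)).
have gQ : in_Gr q Q.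
  rewrite /Q; apply: in_GrM.
    exact: g12.
  exact: gp.
(* The linear parts of the three factors are a(X_true + X_false), -a X_false and -a X_true, and
   their sum is 0. *)
have o2 : ordge 2 (Q - 1).
  move=> [|b [|//]] _; first by rewrite cB (in_Gr_nil gQ) c1 subrr.
  rewrite cB c1 subr0 /Q !letterM ?cM_nil ?exp_nil ?mulr1 // !letter_exp //.
  rewrite !cZ !letter_log // letterM // c0; ring.
have := triv Q gQ o2; rewrite /Q -(evlogM evL sc g12 (gp true (- a))).
rewrite -(evlogM evL sc gp2 (gp false (- a))) -(evlog_pow evL sc a gtf).
rewrite -(evlog_pow evL sc (- a) (gX false)) -(evlog_pow evL sc (- a) (gX true)).
rewrite -(evlogM evL sc (gX true) (gX false)) -!ceq.
rewrite -[c true]/f -[c false]/g.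
have pN (x : G) : pg_mul (pg_pow x (- a)) (pg_pow x a) = pg_one G.
  by rewrite -Gr_powD addNr; exact: sa_scale0.
move: (pg_pow (pg_mul f g) a) => x h.
rewrite -[RHS]Gr_mul1g -h -!Gr_mulA [X in pg_mul _ (pg_mul _ X)]Gr_mulA pN Gr_mul1g.
by rewrite pN Gr_mulg1.
Qed.

End GrAxioms.

(** * The multipliability axioms for Gr(L) *)

Section GrMultipliability.
Variables (k : comPzRingType) (q : {rmorphism rat -> k}) (L : salg k).
Hypothesis (slieL : is_slie L) (evL : has_evLie L).

Let sumL := salg_summability (slie_salg slieL).

Local Notation exp P := (sexp q (P : fps k _) : fps k _).
Local Notation log Q := (slog q (Q : fps k _) : fps k _).
Local Notation G := (Gr q L).
Local Notation E i := (exp (sX k i) : fps k _).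

Lemma Gr_expgroup_axioms : is_expgroup G.
Proof.
split.
- exact: Gr_mulA.
- exact: Gr_mul1g.
- exact: Gr_mulg1.
- exact: Gr_mulVg.
- exact: Gr_mulgV.
- exact: sa_scale1 (salg_module (slie_salg slieL)).
- exact: Gr_powD.
- exact: Gr_powM.
- exact: Gr_powMg.
- exact: Gr_powJ.
Qed.

Lemma evlog_prod_family (T : Type) (c : T -> L) (sc : summable c) (J : los)
    (Q : J -> fps k T) (g : J -> L) :
  multipl Q -> (forall j, in_Gr q (Q j)) -> (forall j, g j = evlog q c (Q j)) ->
  @pg_prod k G J g (evlog q c (series_prod Q)).
Proof. by move=> mQ gQ /funext ->; exact: evlog_prod. Qed.

Lemma evlog_prod_family_eq (T : Type) (c : T -> L) (sc : summable c) (J : los)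
    (Q : J -> fps k T) (g : J -> L) p :
  multipl Q -> (forall j, in_Gr q (Q j)) -> (forall j, g j = evlog q c (Q j)) ->
  @pg_prod k G J g p -> p = evlog q c (series_prod Q).
Proof. by move=> mQ gQ /funext ->; exact: evlog_prod_eq. Qed.

Lemma multipl_sinv (J : los) (T : Type) (F : J -> fps k T) : multipl F ->
  (forall j, in_Gr q (F j)) -> multipl (fun j => sinv q (F j)).
Proof. by move=> mF gF; apply: (multipl_inv mF) => j; apply: sinvr; exact: in_Gr_nil (gF j). Qed.

Lemma summable_sum (I J : Type) (f : I -> L) (g : J -> L) : summable f -> summable g ->
  summable (fun x : I + J => match x with inl i => f i | inr j => g j end).
Proof. exact: sm4. Qed.

Lemma summable_opp (I : Type) (f : I -> L) : summable f -> summable (fun i => sa_opp (f i)).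
Proof.
move=> [s hs]; exists (sa_scale (-1) s).
have -> : (fun i => sa_opp (f i)) = fun i => sa_scale (-1) (f i).
  by apply: funext => i; rewrite sa_scaleN1.
exact: sum_scale.
Qed.

Lemma multipl_E_comp (T J : Type) (phi : J -> T) : injective phi ->
  multipl (fun j => E (phi j)).
Proof.
move=> inj; apply: (@summ_comp _ _ _ _ phi (fun t => E t - 1)) => //.
exact: multipl_expX.
Qed.

(** With one copy of the variables for f and another for g, this is the image of
    [series_prod_twist]; summability over [I + I] makes the evaluation possible. *)
Lemma Gr_mg1 (I : los) (f g : I -> G) (p r : G) :
  pg_prod f p -> pg_prod g r ->
  exists (x y : I -> G) (t : G),
    [/\ forall i, @pg_prod k G (rev_los (sub_los (los_lt i)))
          (fun j => pg_inv (f (sval j))) (x i),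
        forall i, @pg_prod k G (sub_los (los_lt i))
          (fun j => f (sval j)) (y i),
        @pg_prod k G I (fun i => pg_mul (pg_mul (x i) (g i)) (y i)) t &
        @pg_prod k G I (fun i => pg_mul (f i) (g i)) (pg_mul p t)].
Proof.
move=> hf hg; have [[sf _] [sg _]] := (hf, hg).
pose c (x : I + I) : L := match x with inl i => f i | inr j => g j end.
have sc : summable c by exact: summable_sum.
pose F i : fps k (I + I) := E (inl i); pose H i : fps k (I + I) := E (inr i).
have inl_inj : injective (@inl I I) by move=> i j [].
have inr_inj : injective (@inr I I) by move=> i j [].
have mF : multipl F := multipl_E_comp inl_inj.
have mH : multipl H := multipl_E_comp inr_inj.
have gF i : in_Gr q (F i) by exact: in_Gr_expX.
have gH i : in_Gr q (H i) by exact: in_Gr_expX.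
have F1 i := in_Gr_nil (gF i).
have fE i : f i = evlog q c (F i) by rewrite evlogX.
have gE i : g i = evlog q c (H i) by rewrite evlogX.
have mV := multipl_sinv mF gF.
have gV i := in_Gr_sinv (gF i).
pose y i : fps k (I + I) := series_prod (fun j : sub_los (los_lt i) => F (sval j)).
pose x i : fps k (I + I) := @series_prod k (I + I) (rev_los (sub_los (los_lt i)))
  (fun j => sinv q (F (sval j))).
have mFs i := multipl_sub mF (los_lt i).
have mVs i := multipl_sub mV (los_lt i).
have gy i : in_Gr q (y i) by apply: (in_Gr_series_prod (mFs i)) => j; exact: gF.
have gx i : in_Gr q (x i).
  by apply: (in_Gr_series_prod (J := rev_los (sub_los (los_lt i))) (mVs i)) => j; exact: gV.
have xy i : x i * y i = 1 /\ y i * x i = 1.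
  apply: (series_prod_rev (J := sub_los (los_lt i)) (mFs i)) => j.
    exact: sinvl (F1 _).
  exact: sinvr (F1 _).
have xy1 i := (xy i).1; have xy2 i := (xy i).2.
have gxh i := in_GrM (gx i) (gH i); have gxhy i := in_GrM (gxh i) (gy i).
have gfh i := in_GrM (gF i) (gH i).
have mT : multipl (fun i => x i * H i * y i) := multipl_twist mH xy1.
have ep : p = evlog q c (series_prod F) by exact: evlog_prod_family_eq hf.
exists (fun i => evlog q c (x i)), (fun i => evlog q c (y i)),
  (evlog q c (series_prod (fun i => x i * H i * y i))); split.
- move=> i; apply: (evlog_prod_family sc (J := rev_los (sub_los (los_lt i))) (mVs i)) => j.
    exact: gV.
  by rewrite -(evlog_inv slieL evL sc (gF _)) -fE.
- by move=> i; apply: (evlog_prod_family sc (J := sub_los (los_lt i)) (mFs i)).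
- apply: (evlog_prod_family sc mT gxhy) => i.
  by rewrite gE (evlogM evL sc (gx i) (gH i)) (evlogM evL sc (gxh i) (gy i)).
- have gpF := in_Gr_series_prod mF gF; have gpT := in_Gr_series_prod mT gxhy.
  rewrite ep (evlogM evL sc gpF gpT).
  have <- := series_prod_twist mF mH (fun i => erefl (y i)) xy1 xy2.
  apply: (evlog_prod_family sc (multiplM mF mH) gfh) => i.
  by rewrite fE gE (evlogM evL sc (gF i) (gH i)).
Qed.

Lemma evlog_big (T J : Type) (c : T -> L) (sc : summable c) (Q : J -> fps k T) (s : seq J) :
  (forall j, in_Gr q (Q j)) ->
  \big[@pg_mul k G/pg_one G]_(j <- s) evlog q c (Q j) = evlog q c (\prod_(j <- s) Q j).
Proof.
move=> gQ; elim: s => [|a s IH]; first by rewrite !big_nil evlog1.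
by rewrite !big_cons IH (evlogM evL sc (gQ a) (in_Gr_prod s gQ)).
Qed.

Lemma Gr_mg2 (I : los) (g : I -> G) (s : seq I) :
  increasing s -> (forall i, List.In i s <-> g i <> pg_one G) ->
  pg_prod g (\big[@pg_mul k G/pg_one G]_(i <- s) g i).
Proof.
move=> hs gs.
have InP (i : {classic I}) (r : seq {classic I}) : List.In i r <-> i \in r.
  elim: r => // a r IH; rewrite inE; split=> [[->|/IH->]|/orP[/eqP->|/IH]]; rewrite ?eqxx ?orbT //.
    by left.
  by right.
have sg : summable g.
  eexists; apply: (sm1 sumL); apply/finite_seqP; exists (s : seq {classic I}).
  apply/seteqP; split=> i /=; first by move/gs/InP.
  by move/InP/gs.
(* Outside the support, [g i] is neutral and 1 has the same value as the variable's exponential;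
   with 1 the product of series is a finite one. *)
pose Q i : fps k I := if `[< List.In i s >] then E i else 1.
have gQ i : in_Gr q (Q i) by rewrite /Q; case: asboolP => _; [exact: in_Gr_expX | exact: in_Gr1].
have gE i : g i = evlog q g (Q i).
  rewrite /Q; case: asboolP => [_|h]; first by rewrite evlogX.
  by rewrite (evlog1 q slieL evL sg); apply: contrapT => /gs.
have [mQ eQ] : multipl Q /\ series_prod Q = \prod_(i <- s) Q i.
  apply: series_prod_fin => // i /negP hi; rewrite /Q asboolF // => /InP; exact: hi.
have := evlog_prod_family sg mQ gQ gE; rewrite eQ -(evlog_big sg) //.
by rewrite (eq_bigr g) // => i _; rewrite -gE.
Qed.

Lemma Gr_mg3 (I J : los) (phi : I -> J) (g : J -> G) (p : G) :
  bijective phi -> (forall i i', los_lt (phi i) (phi i') <-> los_lt i i') ->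
  pg_prod g p -> pg_prod (g \o phi) p.
Proof.
move=> bphi hphi hg; have [sg _] := hg.
have mE := @multipl_expX k q J; have gE := @in_Gr_expX k q J.
have eg j : g j = evlog q g (E j) by rewrite evlogX.
have -> : p = evlog q g (series_prod (fun j => E j)) by exact: evlog_prod_family_eq hg.
rewrite -(series_prod_iso mE bphi hphi); apply: evlog_prod_family => //.
- exact: multipl_E_comp (bij_inj bphi).
- by move=> i; exact: gE.
- by move=> i; exact: eg.
Qed.

Lemma Gr_mg4 (I J : los) (P : J -> I -> Prop) (g : I -> G) (p : G) :
  (forall i, exists j, P j i) ->
  (forall j j' i i', los_lt j j' -> P j i -> P j' i' -> los_lt i i') ->
  pg_prod g p ->
  exists h : J -> G,
    (forall j, @pg_prod k G (sub_los (P j)) (fun i => g (sval i)) (h j)) /\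
    pg_prod h p.
Proof.
move=> Pt Pl hg; have [sg _] := hg.
have mE := @multipl_expX k q I; have gE := @in_Gr_expX k q I.
have eg j : g j = evlog q g (E j) by rewrite evlogX.
have -> : p = evlog q g (series_prod (fun j => E j)) by exact: evlog_prod_family_eq hg.
pose h j : fps k I := series_prod (fun i : sub_los (P j) => E (sval i)).
have mEs j := multipl_sub mE (P j).
have gh j : in_Gr q (h j) by apply: (in_Gr_series_prod (mEs j)) => i; exact: gE.
exists (fun j => evlog q g (h j)); split.
  by move=> j; apply: evlog_prod_family.
rewrite -(series_prod_blocks mE Pt Pl (fun j => erefl (h j))).
apply: evlog_prod_family => //.
exact: multipl_blocks mE Pt Pl (fun j => erefl (h j)).
Qed.

Lemma Gr_mg6 (I : los) (g : I -> G) (p g0 : G) : pg_prod g p ->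
  @pg_prod k G I (fun i => pg_mul (pg_mul g0 (g i)) (pg_inv g0))
    (pg_mul (pg_mul g0 p) (pg_inv g0)).
Proof.
move=> hg; have [sg _] := hg.
pose c (x : I + unit) : L := match x with inl i => g i | inr _ => g0 end.
have sc : summable c.
  exact: (summable_sum sg (summable_fin slieL (T := unit) (fun=> g0))).
pose F i : fps k (I + unit) := E (inl i); pose A : fps k (I + unit) := E (inr tt).
have mF : multipl F by apply: multipl_E_comp => i j [].
have gF i : in_Gr q (F i) by exact: in_Gr_expX.
have gA : in_Gr q A by exact: in_Gr_expX.
have gAV := in_Gr_sinv gA.
have eF i : g i = evlog q c (F i) by rewrite evlogX.
have eA : g0 = evlog q c A by rewrite evlogX.
have eAV : @pg_inv k G g0 = evlog q c (sinv q A) by rewrite -(evlog_inv slieL evL sc gA) -eA.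
have AB := sinvr q (in_Gr_nil gA); have BA := sinvl q (in_Gr_nil gA).
have gP := in_Gr_series_prod mF gF.
have ep : p = evlog q c (series_prod F) by exact: evlog_prod_family_eq hg.
have g1 i := in_GrM gA (gF i); have g2 := in_GrM gA gP.
have -> : pg_mul (pg_mul g0 p) (pg_inv g0) = evlog q c (A * (series_prod F : fps k _) * sinv q A).
  by rewrite eAV ep {1}eA (evlogM evL sc gA gP) (evlogM evL sc g2 gAV).
rewrite -(series_prod_conj mF AB BA); apply: evlog_prod_family => //.
- exact: multipl_conj.
- by move=> i; exact: in_GrM.
- by move=> i; rewrite eAV eF {1}eA (evlogM evL sc gA (gF i)) (evlogM evL sc (g1 i) gAV).
Qed.

Lemma Gr_meg7 (I : los) (g : I -> G) (p : G) : pg_prod g p ->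
  @pg_prod k G (rev_los I) (fun i => pg_inv (g i)) (pg_inv p).
Proof.
move=> hg; have [sg _] := hg.
have mE := @multipl_expX k q I; have gE := @in_Gr_expX k q I.
have eg j : g j = evlog q g (E j) by rewrite evlogX.
have ep : p = evlog q g (series_prod (fun j => E j)) by exact: evlog_prod_family_eq hg.
have gP := in_Gr_series_prod mE gE; have P1 := in_Gr_nil gP.
have E1 j := in_Gr_nil (gE j).
have [_ h] := series_prod_rev mE (fun j => sinvl q (E1 j)) (fun j => sinvr q (E1 j)).
rewrite ep (evlog_inv slieL evL sg gP) -(sinv_unique q P1 h).
apply: (evlog_prod_family sg (J := rev_los I) (multipl_sinv mE gE)) => j.
  by apply: in_Gr_sinv.
by rewrite -(evlog_inv slieL evL sg (gE j)) -eg.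
Qed.

Lemma Gr_multipliability_axioms : is_multipliability G.
Proof.
split.
- by move=> I g p r [_ ->] [_ ->].
- by move=> I g /Gr_in_dom sg; apply/Gr_in_dom; exact: summable_opp.
- move=> I f g [p hp] [r hr]; have [x [y [t [_ _ _ h]]]] := Gr_mg1 hp hr.
  by exists (pg_mul p t).
- exact: Gr_mg1.
- exact: Gr_mg2.
- exact: Gr_mg3.
- exact: Gr_mg4.
- by move=> I J g h /Gr_in_dom sg /Gr_in_dom sh; apply/Gr_in_dom; exact: summable_sum.
- exact: Gr_mg6.
- exact: Gr_meg7.
- by move=> I g X f lt lin /Gr_in_dom sg; apply/Gr_in_dom; exact: (sm5 sumL).
- by move=> I lt lin g; split=> /Gr_in_dom h; apply/Gr_in_dom.
Qed.

End GrMultipliability.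

(** * Evaluations in a multipliability exponential group *)

Section EvGrUnique.
Variables (k : comPzRingType) (q : {rmorphism rat -> k}) (G : pgr k).
Hypothesis prodG : forall (I : los) (g : I -> G) (p r : G),
  pg_prod g p -> pg_prod g r -> p = r.
Variables (I : Type) (f : I -> G).
Local Notation exp P := (sexp q (P : fps k I) : fps k I).
Local Notation log Q := (slog q (Q : fps k I) : fps k I).

Lemma is_evGr_unique (ev ev' : {Q : series k I | in_Gr q Q} -> G) :
  is_evGr f ev -> is_evGr f ev' -> ev = ev'.
Proof.
move=> h h'; apply: funext => -[Q hQ].
pose S (Q : fps k I) := forall p : {Q : series k I | in_Gr q Q}, sval p = Q -> ev p = ev' p.
suff : S Q by apply.
apply: (Gr_generation (q := q)) => //.
- move=> P R hP hR SP SR p ep.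
  rewrite (evGrM h (P := exist _ P hP) (Q := exist _ R hR) ep).
  by rewrite (evGrM h' (P := exist _ P hP) (Q := exist _ R hR) ep) SP // SR.
- move=> P hP SP p ep.
  have e : sval p = sexp q (sscale (-1) (slog q (sval (exist _ P hP : {Q : series k I | in_Gr q Q})))).
    by rewrite ep /sinv -scaleN1r.
  by rewrite (evGrX h e) (evGrX h' e) SP.
- move=> J F mF hF SF p ep.
  pose F' j : {Q : series k I | in_Gr q Q} := exist _ (F j) (hF j).
  have m : @series_summable k I J (fun j => sadd (sval (F' j)) (sopp (sone k I))).
    exact: (summP _).1 mF.
  apply: prodG (evGr_prod h (Q := F') m ep) _.
  have -> : (fun j => ev (F' j)) = fun j => ev' (F' j) by apply: funext => j; apply: SF.
  exact: evGr_prod h' _ _ _ m ep.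
- move=> i c p ep.
  have hX := in_Gr_expX q i.
  have e : sval p = sexp q (sscale c (slog q (sval (exist _ _ hX : {Q : series k I | in_Gr q Q})))).
    by rewrite ep /= log_exp // cX_nil.
  rewrite (evGrX h e) (evGrX h' e); congr pg_pow.
  by rewrite (evGr_expX h (i := i)) // (evGr_expX h' (i := i)).
Qed.

Lemma evGrE (ev : {Q : series k I | in_Gr q Q} -> G) Q (hQ : in_Gr q Q) :
  is_evGr f ev -> evGr q f Q = ev (exist _ Q hQ).
Proof.
move=> h; rewrite /evGr; apply: theE; first by exists ev => //; exists (exist _ Q hQ).
move=> y [ev' h' [p ep <-]]; rewrite (is_evGr_unique h' h); congr ev.
exact: sval_eq.
Qed.

End EvGrUnique.

(** * Group evaluations in Gr(L) *)

Section GrEvaluations.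
Variables (k : comPzRingType) (q : {rmorphism rat -> k}) (L : salg k).
Hypothesis (slieL : is_slie L) (evL : has_evLie L).
Local Notation G := (Gr q L).

Lemma is_evGr_evlog (I : Type) (f : I -> L) : summable f ->
  @is_evGr k q G I f (fun p => evlog q f (sval p)).
Proof.
move=> sf; split.
- move=> [P hP] [Q hQ] R e; rewrite e; exact: esym (evlogM evL sf hP hQ).
- move=> [P hP] R a e; rewrite e; exact: esym (evlog_pow evL sf a hP).
- move=> J Q [R hR] /= m e; rewrite e; apply: (evlog_prod evL sf (Q := fun j => sval (Q j))).
    exact: (summP _).2 m.
  by move=> j; exact: svalP.
- by move=> i [R hR] /= ->; rewrite evlogX.
Qed.

Lemma Gr_has_evGr : has_evGr q G.
Proof.
move=> I f /Gr_multipliable sf; have h := is_evGr_evlog sf.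
exists (fun p => evlog q f (sval p)); split=> // ev' h'.
apply: is_evGr_unique h h' => J g p r.
exact: prod_fun (Gr_multipliability_axioms q slieL evL) _ _ _ _.
Qed.

Lemma evGr_Gr (I : Type) (f : I -> L) Q : summable f -> in_Gr q Q ->
  @evGr k q G I f Q = evLie f (slog q Q).
Proof.
move=> sf hQ; rewrite (evGrE _ hQ (is_evGr_evlog sf)) //.
exact: prod_fun (Gr_multipliability_axioms q slieL evL).
Qed.

End GrEvaluations.

Section GrMorphisms.
Variables (k : comPzRingType) (q : {rmorphism rat -> k}) (L M : salg k).
Hypothesis (slieL : is_slie L) (evL : has_evLie L).
Hypothesis (slieM : is_slie M) (evM : has_evLie M).
Variable phi : L -> M.
Hypothesis hphi : salg_hom phi.

Lemma summable_hom (I : Type) (a : I -> L) : summable a -> summable (phi \o a).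
Proof. by move=> [s hs]; exists (phi s); exact: salg_hom_sum hphi _ _ _ hs. Qed.

(** By uniqueness, the composite of an evaluation with a morphism is the evaluation at the image
    family. The product operations of Gr are evaluations at fixed series, so the same underlying map
    preserves them. *)
Lemma evLie_hom (I : Type) (a : I -> L) (P : fps k I) : summable a -> in_Lie P ->
  phi (evLie a P) = evLie (phi \o a) P.
Proof.
move=> sa; have sb := summable_hom sa; have [hD hZ hM hS] := hphi.
apply: (evLie_unique evM sb (F := fun P => phi (evLie a P))).
- by move=> R Q hR hQ; rewrite (evLieD evL sa hR hQ) hD.
- by move=> c R hR; rewrite (evLieZ evL sa c hR) hZ.
- by move=> R Q hR hQ; rewrite (evLieM evL sa hR hQ) hM.
- by move=> J R S hR h; apply: hS; exact: (evLie_sum evL sa hR h).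
- by move=> i; rewrite (evLieX evL sa).
Qed.

Lemma Gr_pgr_hom : @pgr_hom k (Gr q L) (Gr q M) phi.
Proof.
have gX (J : Type) (j : J) := in_Gr_expX q j.
split.
- move=> f g /=; have sp : summable (pair2 f g) := summable_fin slieL (T := 'I_2) _.
  rewrite (evLie_hom sp); last by apply: in_Lie_log; exact: (in_GrM (gX _ _) (gX _ _)).
  congr (evLie _ _); apply: funext => i; rewrite /pair2 /=; by case: ifP.
- by move=> f a; exact: (salg_homZ hphi).
- move=> I g p [sg ->]; split; first exact: summable_hom.
  rewrite (evLie_hom sg) //; apply: in_Lie_log; apply: in_Gr_series_prod.
    exact: multipl_expX.
  by move=> j; exact: gX.
Qed.

End GrMorphisms.

(** Two evaluations agree on a summability subalgebra containing the variables, which is everything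
    by minimality. *)
Lemma is_evLie_unique (k : comPzRingType) (L : salg k)
    (sum_unique : forall (J : Type) (v : J -> L) s t, sa_sum v s -> sa_sum v t -> s = t)
    (I : Type) (a : I -> L) (ev ev' : LieSeries k I -> L) :
  is_evLie a ev -> is_evLie a ev' -> ev = ev'.
Proof.
move=> [[eD eZ eM eS] eX] [[eD' eZ' eM' eS'] eX']; apply: funext => -[P hP].
have irr (e : LieSeries k I -> L) (Q : fps k I) (h h' : in_Lie Q) :
    e (exist _ Q h) = e (exist _ Q h').
  by congr e; exact: sval_eq.
pose S (Q : fps k I) := exists h : in_Lie Q, ev (exist _ Q h) = ev' (exist _ Q h).
suff [h e] : S P by rewrite (irr ev _ _ h) e (irr ev' _ _ h).
have SZ c (Q : fps k I) : S Q -> S (c *: Q).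
  move=> [h e]; exists (in_LieZ c h).
  have := eZ c (exist _ Q h); have := eZ' c (exist _ Q h); rewrite e => <-.
  by rewrite (irr ev _ _ (in_LieZ c h)) (irr ev' _ _ (in_LieZ c h)).
have Ssum (J : Type) (Q : J -> fps k I) T : (forall j, S (Q j)) -> hs Q T -> S T.
  move=> SQ hT; have LQ j : in_Lie (Q j) by case: (SQ j).
  exists (in_Lie_sum LQ hT).
  pose v j : LieSeries k I := exist _ (Q j) (LQ j).
  have hv : sa_sum v (exist _ T (in_Lie_sum LQ hT) : LieSeries k I) by exact: (hsP Q T).1.
  apply: sum_unique (eS _ _ _ hv) _.
  have -> : ev \o v = ev' \o v.
    by apply: funext => j /=; have [h ej] := SQ j; rewrite /v (irr ev _ _ h) ej (irr ev' _ _ h).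
  exact: eS' hv.
apply: (hP S); last first.
  move=> i; exists (in_LieX (k := k) i).
  by rewrite (irr ev _ _ (in_Lie_X i)) (irr ev' _ _ (in_Lie_X i)) eX eX'.
split.
- by apply: (Ssum void (fun=> 0)); [case | exact: hs_zero].
- move=> x y [hx ex] [hy ey]; exists (in_LieD hx hy).
  have := eD (exist _ x hx) (exist _ y hy); have := eD' (exist _ x hx) (exist _ y hy).
  rewrite ex ey => <-.
  by rewrite (irr ev _ _ (in_LieD hx hy)) (irr ev' _ _ (in_LieD hx hy)).
- by move=> x /(SZ (-1)); rewrite scaleN1r.
- exact: SZ.
- move=> x y [hx ex] [hy ey]; exists (in_Lie_bracket hx hy).
  have := eM (exist _ x hx) (exist _ y hy); have := eM' (exist _ x hx) (exist _ y hy).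
  rewrite ex ey => <-.
  by rewrite (irr ev _ _ (in_Lie_bracket hx hy)) (irr ev' _ _ (in_Lie_bracket hx hy)).
- by move=> J v s Sv /hsP; exact: Ssum.
Qed.

(** * The Lie algebra axioms and evaluations for Lie(G) *)

Section EvGroup.
Variables (k : comPzRingType) (q : {rmorphism rat -> k}) (G : pgr k).
Hypothesis (gG : is_expgroup G) (mG : is_multipliability G) (evG : has_evGr q G).

Let prodG := prod_fun mG.

Lemma mulgI (x y : G) : pg_mul x y = x -> y = pg_one G.
Proof.
move=> h; rewrite -(pg_mul1g gG y) -(pg_mulVg gG x) -(pg_mulA gG) h.
by rewrite (pg_mulVg gG).
Qed.

Lemma invg_unique (x y : G) : pg_mul x y = pg_one G -> y = pg_inv x.
Proof.
move=> h; rewrite -(pg_mul1g gG y) -(pg_mulVg gG x) -(pg_mulA gG) h.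
by rewrite (pg_mulg1 gG).
Qed.

Lemma in_dom_eta (J : los) (g : J -> G) :
  in_dom g <-> @in_dom k G (Los (los_lin J)) g.
Proof. by case: J g. Qed.

Lemma multipliable_in_dom (J : los) (g : J -> G) : @multipliable k G J g <-> in_dom g.
Proof.
split=> [[lt [lin h]]|h]; last by exists (@los_lt J), (los_lin J); exact: (in_dom_eta g).1.
by apply: (in_dom_eta g).2; exact: ((meg9 mG (I := Los lin) (los_lin J) g).1 h).
Qed.

Lemma multipliable_finsupp (T : Type) (g : T -> G) (r : seq {classic T}) :
  (forall t, t \notin r -> g t = pg_one G) -> multipliable g.
Proof.
move=> h; have [lt lin] := linear_order_exists T.
have [s hs es] := @incr_exists (Los lin) [seq t <- r | `[< g t <> pg_one G >]].
exists lt, lin; eexists; apply: (mg2 mG (I := Los lin) (s := s)) => // t.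
have InP (a : {classic T}) (l : seq {classic T}) : List.In a l <-> a \in l.
  elim: l => // b l IH; rewrite inE; split=> [[->|/IH->]|/orP[/eqP->|/IH]]; rewrite ?eqxx ?orbT //.
    by left.
  by right.
split=> [/InP|gt].
  by rewrite es mem_filter => /andP[/asboolP].
apply/InP; rewrite es mem_filter; apply/andP; split; first exact/asboolP.
by apply: contrapT => /negP /h.
Qed.

Lemma multipliable_fin (T : finType) (g : T -> G) : multipliable g.
Proof.
by apply: (multipliable_finsupp (r := enum T)) => t; rewrite mem_classic mem_enum.
Qed.

Lemma multipliable_sum (I J : Type) (f : I -> G) (g : J -> G) :
  multipliable f -> multipliable g ->
  multipliable (fun x : I + J => match x with inl i => f i | inr j => g j end).
Proof.
move=> [lt [lin h]] [lt' [lin' h']]; have hs := mg5 mG h h'.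
exact: (multipliable_in_dom (J := sum_los (Los lin) (Los lin')) _).2 hs.
Qed.

Section Eval.
Variables (I : Type) (f : I -> G).
Hypothesis mf : multipliable f.
Implicit Types (P Q R : fps k I).
Local Notation exp P := (sexp q (P : fps k I) : fps k I).
Local Notation log Q := (slog q (Q : fps k I) : fps k I).
Local Notation ev Q := (evGr q f (Q : fps k I)).

Lemma evGr_ex : exists e : {Q : series k I | in_Gr q Q} -> G, is_evGr f e /\
  forall Q (hQ : in_Gr q Q), ev Q = e (exist _ Q hQ).
Proof.
have [e [he _]] := evG mf; exists e; split=> // Q hQ.
exact: (evGrE prodG hQ he).
Qed.

Lemma evGrMul Q R : in_Gr q Q -> in_Gr q R -> ev (Q * R) = pg_mul (ev Q) (ev R).
Proof.
move=> hQ hR; have [e [he eE]] := evGr_ex.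
rewrite (eE Q hQ) (eE R hR) (eE _ (in_GrM hQ hR)).
exact: (evGrM he).
Qed.

Lemma evGrPow Q c : in_Gr q Q -> ev (exp (c *: log Q)) = pg_pow (ev Q) c.
Proof.
move=> hQ; have [e [he eE]] := evGr_ex.
have h : in_Gr q (exp (c *: log Q)) by apply: in_Gr_exp; apply: in_LieZ; exact: in_Lie_log.
by rewrite (eE Q hQ) (eE _ h); exact: (evGrX he).
Qed.

Lemma evGrProd (J : los) (Q : J -> fps k I) : multipl Q -> (forall j, in_Gr q (Q j)) ->
  pg_prod (fun j => ev (Q j)) (ev (series_prod Q)).
Proof.
move=> mQ hQ; have [e [he eE]] := evGr_ex.
rewrite (eE _ (in_Gr_series_prod mQ hQ)).
have -> : (fun j => ev (Q j)) = fun j => e (exist _ (Q j) (hQ j)).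
  by apply: funext => j; exact: eE.
by apply: (evGr_prod he) => //; exact: (summP _).1 mQ.
Qed.

Lemma evGrExpX i : ev (exp (sX k i)) = f i.
Proof.
have [e [he eE]] := evGr_ex; rewrite (eE _ (in_Gr_expX q i)).
exact: (evGr_expX he (i := i)).
Qed.

Lemma evGr1 : ev 1 = pg_one G.
Proof.
have h := in_Gr1 q I; apply: (mulgI (x := ev 1)).
by rewrite -evGrMul // mulr1.
Qed.

Lemma evGr_uniq (F : fps k I -> G) :
  (forall Q R, in_Gr q Q -> in_Gr q R -> F (Q * R) = pg_mul (F Q) (F R)) ->
  (forall c Q, in_Gr q Q -> F (exp (c *: log Q)) = pg_pow (F Q) c) ->
  (forall (J : los) (Q : J -> fps k I), multipl Q -> (forall j, in_Gr q (Q j)) ->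
     pg_prod (fun j => F (Q j)) (F (series_prod Q))) ->
  (forall i, F (exp (sX k i)) = f i) ->
  forall Q, in_Gr q Q -> F Q = ev Q.
Proof.
move=> FM FZ FP FX Q hQ; have [e [he eE]] := evGr_ex; rewrite (eE Q hQ).
suff h : @is_evGr k q G I f (fun p => F (sval p)).
  by rewrite -(is_evGr_unique prodG h he).
split.
- by move=> [P hP] [R hR] T e'; rewrite e'; exact: FM.
- by move=> [P hP] T c e'; rewrite e'; exact: FZ.
- move=> J P T m e'; rewrite e'; apply: FP; first exact: (summP _).2 m.
  by move=> j; exact: svalP.
- by move=> i T e'; rewrite e'; exact: FX.
Qed.

End Eval.

Lemma evGr_mult (I J : Type) (f : I -> G) (Q : J -> fps k I) : multipliable f ->
  multipl Q -> (forall j, in_Gr q (Q j)) -> multipliable (fun j => evGr q f (Q j)).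
Proof.
move=> mf mQ hQ; have [lt lin] := linear_order_exists J.
exists lt, lin; exists (evGr q f (series_prod (J := Los lin) Q)).
exact: (evGrProd mf (J := Los lin)).
Qed.

Local Notation lexp P := (sexp q (P : fps k _) : fps k _).

(** The counterpart of [evlog]: the group evaluation composed with exp, which turns out to be the
    Lie evaluation in Lie(G). *)
Definition evexp (I : Type) (f : I -> G) (P : fps k I) : Lie q G := evGr q f (lexp P).

Lemma evGr_subst (I J : Type) (f : I -> G) (P : J -> fps k I) R : multipliable f ->
  (forall j, in_Lie (P j)) -> summ P -> in_Gr q R ->
  evGr q f (subst P R) = evGr q (fun j => evexp f (P j) : G) R.
Proof.
move=> mf hP sP; have P0 j := in_Lie_nil (hP j).
have hG Q := @subst_in_Gr k q I J P P0 sP Q hP.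
have mb : multipliable (fun j => evexp f (P j) : G).
  apply: evGr_mult => //; first exact: multipl_exp.
  by move=> j; exact: in_Gr_exp.
move: R; apply: (evGr_uniq mb).
- by move=> Q R hQ hR; rewrite substM // (evGrMul mf) //; exact: hG.
- move=> c Q hQ; have Q1 := in_Gr_nil hQ.
  rewrite subst_exp //; last by rewrite cZ log_nil ?mulr0.
  by rewrite substZ // subst_log // (evGrPow mf) //; exact: hG.
- move=> T Q mQ hQ; rewrite subst_series_prod //; apply: (evGrProd mf).
    exact: subst_multipl.
  by move=> t; exact: hG.
- by move=> j; rewrite subst_exp ?cX_nil // substX.
Qed.

Section LieEval.
Variables (I : Type) (f : I -> G).
Hypothesis mf : multipliable f.
Implicit Types (P Q R : fps k I).

Lemma evexpX i : evexp f (sX k i) = f i.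
Proof. exact: evGrExpX. Qed.

Lemma evexp0 : evexp f 0 = sa_zero (Lie q G).
Proof. by rewrite /evexp exp0 evGr1. Qed.

Lemma evexp_pair P Q (R : fps k 'I_2) : in_Lie P -> in_Lie Q -> in_Lie R ->
  evGr q (pair2 (evexp f P : G) (evexp f Q)) (lexp R) = evexp f (subst (pair2 P Q) R).
Proof.
move=> hP hQ hR.
have hp i : in_Lie (pair2 P Q i) by rewrite /pair2; case: ifP.
have sp : summ (pair2 P Q) := summ_fin _.
have p0 i := in_Lie_nil (hp i).
have -> : pair2 (evexp f P : G) (evexp f Q) = fun i => evexp f (pair2 P Q i) : G.
  by apply: funext => i; rewrite /pair2; case: ifP.
rewrite -evGr_subst //; last exact: in_Gr_exp.
by rewrite subst_exp //; exact: in_Lie_nil.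
Qed.

Lemma evexpD P Q : in_Lie P -> in_Lie Q ->
  sa_add (evexp f P) (evexp f Q) = evexp f (P + Q).
Proof.
move=> hP hQ; have hX i := in_LieX (k := k) (i : 'I_2).
have hp i : in_Lie (pair2 P Q i) by rewrite /pair2; case: ifP.
have sp : summ (pair2 P Q) := summ_fin _.
have p0 i := in_Lie_nil (hp i).
have h : in_Lie ((sX k ord0 : fps k 'I_2) + sX k ord_max) by exact: in_LieD (hX _) (hX _).
rewrite -[LHS]/(evGr q (pair2 (evexp f P : G) (evexp f Q)) (lexp ((sX k ord0 : fps k 'I_2) + sX k ord_max))).
by rewrite evexp_pair // substD // !substX.
Qed.

Lemma evexpM P Q : in_Lie P -> in_Lie Q ->
  sa_mul (evexp f P) (evexp f Q) = evexp f (P * Q - Q * P).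
Proof.
move=> hP hQ; have hX i := in_LieX (k := k) (i : 'I_2).
have hp i : in_Lie (pair2 P Q i) by rewrite /pair2; case: ifP.
have sp : summ (pair2 P Q) := summ_fin _.
have p0 i := in_Lie_nil (hp i).
have h := in_Lie_bracket (hX ord0) (hX ord_max).
rewrite -[LHS]/(evGr q (pair2 (evexp f P : G) (evexp f Q))
  (lexp ((sX k ord0 : fps k 'I_2) * sX k ord_max -
    (sX k ord_max : fps k 'I_2) * sX k ord0))).
by rewrite evexp_pair // substB // !substM // !substX.
Qed.

Lemma evexpZ c P : in_Lie P -> sa_scale c (evexp f P) = evexp f (c *: P).
Proof.
move=> hP; have P0 := in_Lie_nil hP.
rewrite -[LHS]/(pg_pow (evGr q f (lexp P)) c) -(evGrPow mf c (in_Gr_exp q hP)).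
by rewrite log_exp.
Qed.

Lemma evexpN P : in_Lie P -> sa_opp (evexp f P) = evexp f (- P).
Proof.
move=> hP; have P0 := in_Lie_nil hP; apply/esym; apply: invg_unique.
rewrite /evexp -(evGrMul mf (in_Gr_exp q hP) (in_Gr_exp q (in_LieN hP))).
by rewrite expNr // evGr1.
Qed.

(** Substituting P_j for X_j turns the series that defines infinite sums, the exponential of the sum
    of the X_j, into exp S. *)
Lemma evexp_sum (J : Type) (P : J -> fps k I) S : (forall j, in_Lie (P j)) ->
  hs P S -> sa_sum (fun j => evexp f (P j)) (evexp f S).
Proof.
move=> hP hS; have sP := hs_summ hS; have P0 j := in_Lie_nil (hP j).
have [T hT] := hs_ex (@summ_X k J).
split.
  apply: evGr_mult => //; first exact: multipl_exp.
  by move=> j; exact: in_Gr_exp.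
have LT : in_Lie T by apply: in_Lie_sum hT => j; exact: in_LieX.
have [_ eT] := (hsP _ _).1 hT; rewrite -eT.
rewrite -[RHS]evGr_subst //; last exact: in_Gr_exp.
rewrite subst_exp //; last exact: in_Lie_nil.
congr (evGr q f (lexp _)); apply: hs_fun hS _.
have := subst_hs P0 sP hT; apply: hs_ext => j; exact: substX.
Qed.

End LieEval.

Lemma Lie_sum_fun (J : Type) (b : J -> Lie q G) s t : sa_sum b s -> sa_sum b t -> s = t.
Proof. by move=> [_ ->] [_ ->]. Qed.

Lemma Lie_summable (J : Type) (b : J -> Lie q G) :
  summable b <-> @multipliable k G J b.
Proof. by split=> [[s []]//|h]; eexists; split. Qed.

Lemma as_evexp3 (x y z : Lie q G) : exists a : option bool -> G,
  [/\ multipliable a, x = evexp a (sX k None), y = evexp a (sX k (Some true)) &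
      z = evexp a (sX k (Some false))].
Proof.
pose a (i : option bool) : G := match i with None => x | Some true => y | Some false => z end.
have ma : multipliable a := multipliable_fin (T := option bool) a.
by exists a; rewrite !evexpX.
Qed.

Lemma Lie_module : is_module (Lie q G).
Proof.
have LX (i : option bool) := in_LieX (k := k) i.
have LD i j := in_LieD (LX i) (LX j).
split.
- move=> x y z; have [a [ma -> -> ->]] := as_evexp3 x y z.
  by rewrite !(evexpD ma) // ?addrA //; exact: in_LieD.
- move=> x y; have [a [ma -> -> _]] := as_evexp3 x y x.
  by rewrite !(evexpD ma) // addrC.
- move=> x; have [a [ma -> _ _]] := as_evexp3 x x x.
  by rewrite -(evexp0 ma) (evexpD ma) // ?add0r //; exact: in_Lie0.
- move=> x; have [a [ma -> _ _]] := as_evexp3 x x x.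
  by rewrite -(evexp0 ma) (evexpN ma) // (evexpD ma) ?addNr //; exact: in_LieN.
- by move=> a b x; rewrite /= (pg_powM gG) mulrC.
- exact: pg_pow1 gG.
- move=> c x y; have [a [ma -> -> _]] := as_evexp3 x y x.
  have LZ i := in_LieZ c (LX i).
  by rewrite (evexpD ma) // !(evexpZ ma) // (evexpD ma) // scalerDr.
- move=> c d x; have [a [ma -> _ _]] := as_evexp3 x x x.
  have LZ e i := in_LieZ e (LX i).
  by rewrite !(evexpZ ma) // (evexpD ma) // scalerDl.
Qed.

Lemma Lie_bilinear : is_bilinear (Lie q G).
Proof.
have LX (i : option bool) := in_LieX (k := k) i.
have LD i j := in_LieD (LX i) (LX j).
have LB i j := in_Lie_bracket (LX i) (LX j).
split.
- move=> x y z; have [a [ma -> -> ->]] := as_evexp3 x y z.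
  rewrite (evexpD ma) // !(evexpM ma) // (evexpD ma) //; congr evexp.
  by rewrite mulrDl mulrDr opprD addrACA.
- move=> x y z; have [a [ma -> -> ->]] := as_evexp3 x y z.
  rewrite (evexpD ma) // !(evexpM ma) // (evexpD ma) //; congr evexp.
  by rewrite mulrDl mulrDr opprD addrACA.
- move=> c x y; have [a [ma -> -> _]] := as_evexp3 x y x.
  have LZ i := in_LieZ c (LX i).
  rewrite (evexpZ ma) // !(evexpM ma) // (evexpZ ma) //; congr evexp.
  by rewrite scalerBr fps_scaleAl fps_scaleAr.
- move=> c x y; have [a [ma -> -> _]] := as_evexp3 x y x.
  have LZ i := in_LieZ c (LX i).
  rewrite (evexpZ ma) // !(evexpM ma) // (evexpZ ma) //; congr evexp.
  by rewrite scalerBr fps_scaleAr [X in _ = _ - X]fps_scaleAl.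
Qed.

Lemma hs_partition (I J T : Type) (P : J -> I -> Prop) (v : I -> fps k T) S :
  (forall i, exists! j, P j i) -> hs v S ->
  exists w : J -> fps k T,
    (forall j, hs (fun i : {i | P j i} => v (sval i)) (w j)) /\ hs w S.
Proof.
move=> hP hS; have [phi hphi] := choice hP.
have sub j : summ (fun i : {i | P j i} => v (sval i)).
  by apply: (@summ_comp _ _ _ _ sval v) => [x y|]; [exact: sval_eq | exact: hs_summ hS].
have [w hw] := choice (fun j => hs_ex (sub j)).
exists w; split=> //; apply: (hs_fubini (phi := phi) hS) => j.
have /hs_sub := hw j; apply: hs_ext => i; have [p u] := hphi i.
have e : P j i <-> phi i = j by split=> [/u|<-].
by case: asboolP => h; case: asboolP => h' //; exfalso; tauto.
Qed.

Lemma Lie_summability : is_summability (Lie q G).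
Proof.
split.
- exact: Lie_sum_fun.
- move=> I; have mu : @multipliable k G unit (fun=> pg_one G) by exact: multipliable_fin.
  have := evexp_sum mu (P := fun _ : I => 0) (fun _ => @in_Lie0 k unit) (@hs_zero k unit I).
  by rewrite (evexp0 mu).
- move=> I v w s t hv hw; have [[mv _] [mw _]] := (hv, hw).
  have mc := multipliable_sum mv mw; set c := (fun x => _) in mc.
  have LX (x : I + I) := in_LieX (k := k) x.
  have ev i : v i = evexp c (sX k (inl i)) by rewrite evexpX.
  have ew i : w i = evexp c (sX k (inr i)) by rewrite evexpX.
  have [S1 h1] : exists S, hs (fun i => sX k (inl i : I + I) : fps k _) S.
    by apply: hs_ex; apply: (summ_comp (phi := inl)) (@summ_X k (I + I)) => i j [].
  have [S2 h2] : exists S, hs (fun i => sX k (inr i : I + I) : fps k _) S.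
    by apply: hs_ex; apply: (summ_comp (phi := inr)) (@summ_X k (I + I)) => i j [].
  have s1 := evexp_sum mc (fun i => LX (inl i)) h1.
  have s2 := evexp_sum mc (fun i => LX (inr i)) h2.
  have L1 := in_Lie_sum (fun i => LX (inl i)) h1.
  have L2 := in_Lie_sum (fun i => LX (inr i)) h2.
  rewrite -(funext ev) in s1; rewrite -(funext ew) in s2.
  rewrite (Lie_sum_fun hv s1) (Lie_sum_fun hw s2) (evexpD mc) //.
  have := evexp_sum mc (fun i => in_LieD (LX (inl i)) (LX (inr i))) (hs_add h1 h2).
  congr (sa_sum _ _); apply: funext => i; by rewrite ev ew (evexpD mc).
- move=> I a v s hv; have [mv _] := hv.
  have LX (x : I) := in_LieX (k := k) x.
  have [S hS] := hs_ex (@summ_X k I).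
  have ev : v = fun i => evexp v (sX k i) by apply: funext => i; rewrite evexpX.
  have s1 := evexp_sum mv LX hS; rewrite -ev in s1.
  rewrite (Lie_sum_fun hv s1) (evexpZ mv) //; last exact: in_Lie_sum hS.
  have := evexp_sum mv (fun i => in_LieZ a (LX i)) (hs_scale a hS).
  congr (sa_sum _ _); apply: funext => i; by rewrite -(evexpZ mv) // {2}ev.
- move=> I v fv; set r := finite_support _ _ _.
  have er i : (i \in r) = `[< v i <> sa_zero (Lie q G) >].
    rewrite /r in_finite_support; last by rewrite setTI.
    by rewrite setTI; apply/idP/asboolP => [/set_mem|h]; [|exact/mem_set].
  have ur : uniq r := finite_support_uniq _ _ _.
  have mv : @multipliable k G I v.
    by apply: (multipliable_finsupp (r := r)) => i; rewrite er => /asboolP; exact: contrapT.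
  (* Zero outside the support, where [v] has the neutral value anyway, so that the sum of series is
     literally finite. *)
  pose P i : fps k I := if i \in r then sX k i else 0.
  have LP i : in_Lie (P i) by rewrite /P; case: ifP => _; [exact: in_LieX | exact: in_Lie0].
  have hP : hs P (\sum_(i <- r) P i) by apply: hs_seq => // i ir; rewrite /P (negPf ir).
  have eP : (fun i => evexp v (P i)) = v.
    apply: funext => i; rewrite /P er; case: asboolP => [_|/contrapT ->]; first exact: evexpX.
    exact: evexp0.
  have := evexp_sum mv LP hP; rewrite eP; congr sa_sum.
  have big_ev (l : seq {classic I}) : evexp v (\sum_(i <- l) P i) =
      \big[@sa_add k (Lie q G)/sa_zero (Lie q G)]_(i <- l) v i.
    elim: l => [|j l IH]; first by rewrite !big_nil evexp0.
    rewrite !big_cons -IH -(evexpD mv) //; first by congr sa_add; exact: (congr1 (fun h => h j) eP).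
    by elim: l {IH} => [|j' l IH]; rewrite ?big_nil ?big_cons; [exact: in_Lie0 | exact: in_LieD].
  exact: big_ev.
- move=> I J phi v s bphi hv; have [mv _] := hv.
  have LX (x : J) := in_LieX (k := k) x.
  have [S hS] := hs_ex (@summ_X k J).
  have ev : v = fun i => evexp v (sX k i) by apply: funext => i; rewrite evexpX.
  have s1 := evexp_sum mv LX hS; rewrite -ev in s1.
  rewrite (Lie_sum_fun hv s1).
  have hS' : hs ((fun j => sX k j : fps k J) \o phi) S.
    apply: (hs_inj _ (bij_inj bphi) _).2 hS => j hj; have [psi _ K] := bphi.
    by case: (hj (psi j)); exact: K.
  have := evexp_sum mv (fun i => LX (phi i)) hS'.
  by congr (sa_sum _ _); apply: funext => i; rewrite /= evexpX.
- move=> I J P v s hP hv; have [mv _] := hv.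
  have LX (x : I) := in_LieX (k := k) x.
  have [S hS] := hs_ex (@summ_X k I).
  have ev : v = fun i => evexp v (sX k i) by apply: funext => i; rewrite evexpX.
  have s1 := evexp_sum mv LX hS; rewrite -ev in s1.
  rewrite (Lie_sum_fun hv s1).
  have [w [hw hwS]] := hs_partition hP hS.
  have Lw j : in_Lie (w j) := in_Lie_sum (fun i => LX (sval i)) (hw j).
  exists (fun j => evexp v (w j)); split; last exact: evexp_sum.
  move=> j; have := evexp_sum mv (fun i => LX (sval i)) (hw j).
  by congr (sa_sum _ _); apply: funext => i; rewrite evexpX.
- by move=> I J v w /Lie_summable mv /Lie_summable mw; apply/Lie_summable; exact: multipliable_sum.
- move=> I X f v /Lie_summable [lt [lin hv]]; apply/Lie_summable.
  have [lt' lin'] := linear_order_exists {i : I & X i}.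
  by exists lt', lin'; exact: (meg8 mG (I := Los lin) f lin' hv).
Qed.

Lemma hs_swap (I J T : Type) (P : I * J -> fps k T) S :
  hs P S -> hs (fun p : J * I => P (p.2, p.1)) S.
Proof.
move=> h; apply: (hs_inj (phi := fun p : J * I => (p.2, p.1)) S _ _).2 h.
  by move=> [x y] [x' y'] /= [-> ->].
by move=> [x y] h'; case: (h' (y, x)).
Qed.

Lemma Lie_slie_axioms : is_slie (Lie q G).
Proof.
split; first split.
- exact: Lie_module.
- exact: Lie_bilinear.
- exact: Lie_summability.
- move=> I J a b s t ha hb; have [[ma _] [mb _]] := (ha, hb).
  have mc := multipliable_sum ma mb; set c := (fun x => _) in mc.
  have LX (x : I + J) := in_LieX (k := k) x.
  have ea i : a i = evexp c (sX k (inl i)) by rewrite evexpX.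
  have eb j : b j = evexp c (sX k (inr j)) by rewrite evexpX.
  have [S1 h1] : exists S, hs (fun i => sX k (inl i : I + J) : fps k _) S.
    by apply: hs_ex; apply: (summ_comp (phi := inl)) (@summ_X k (I + J)) => i j [].
  have [S2 h2] : exists S, hs (fun j => sX k (inr j : I + J) : fps k _) S.
    by apply: hs_ex; apply: (summ_comp (phi := inr)) (@summ_X k (I + J)) => i j [].
  have s1 := evexp_sum mc (fun i => LX (inl i)) h1.
  have s2 := evexp_sum mc (fun i => LX (inr i)) h2.
  have L1 := in_Lie_sum (fun i => LX (inl i)) h1.
  have L2 := in_Lie_sum (fun i => LX (inr i)) h2.
  rewrite -(funext ea) in s1; rewrite -(funext eb) in s2.
  rewrite (Lie_sum_fun ha s1) (Lie_sum_fun hb s2) (evexpM mc) //.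
  (* The bracket of two sums is a difference of two double sums, the second indexed by [J * I] and
     swapped back. *)
  have h := hs_add (hs_mul h1 h2) (hs_opp (hs_swap (hs_mul h2 h1))).
  have := evexp_sum mc (fun p : I * J => in_Lie_bracket (LX (inl p.1)) (LX (inr p.2))) h.
  by congr (sa_sum _ _); apply: funext => p; rewrite ea eb (evexpM mc).
- move=> x; have [a [ma -> _ _]] := as_evexp3 x x x.
  have LX (i : option bool) := in_LieX (k := k) i.
  by rewrite (evexpM ma) // subrr evexp0.
- move=> x y z; have [a [ma -> -> ->]] := as_evexp3 x y z.
  have LX (i : option bool) := in_LieX (k := k) i.
  have LB i j := in_Lie_bracket (LX i) (LX j).
  have LB2 i j l := in_Lie_bracket (LX l) (LB i j).
  rewrite !(evexpM ma) // !(evexpD ma) //; last exact: in_LieD.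
  rewrite -(evexp0 ma); congr evexp.
  move: (sX k None : fps k _) (sX k (Some true) : fps k _) (sX k (Some false) : fps k _) => u v w.
  apply: funext => t; rewrite !(mulrBl, mulrBr) !mulrA !(cD, cN) c0; ring.
Qed.

Lemma Lie_has_evLie : has_evLie (Lie q G).
Proof.
move=> I a /Lie_summable ma.
have h : @is_evLie k (Lie q G) I a (fun p => evexp a (sval p)).
  split; last by move=> i; rewrite /= evexpX.
  split.
  - by move=> [P hP] [Q hQ]; rewrite (evexpD ma).
  - by move=> c [P hP]; rewrite (evexpZ ma).
  - by move=> [P hP] [Q hQ]; rewrite (evexpM ma).
  - by move=> J v s /hsP hs; apply: (evexp_sum ma (P := fun j => sval (v j))) hs => j; exact: svalP.
exists (fun p => evexp a (sval p)); split=> // ev' h'.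
by apply: (is_evLie_unique _ h h') => J v s t; exact: Lie_sum_fun.
Qed.

End EvGroup.

Section LieMorphisms.
Variables (k : comPzRingType) (q : {rmorphism rat -> k}) (G H : pgr k).
Hypothesis (gG : is_expgroup G) (mG : is_multipliability G) (evG : has_evGr q G).
Hypothesis (gH : is_expgroup H) (mH : is_multipliability H) (evH : has_evGr q H).
Variable phi : G -> H.
Hypothesis hphi : pgr_hom phi.

Lemma multipliable_hom (I : Type) (f : I -> G) : multipliable f -> multipliable (phi \o f).
Proof.
move=> [lt [lin [p hp]]]; exists lt, lin; exists (phi p).
exact: (pgr_hom_prod hphi (I := Los lin)).
Qed.

Lemma evGr_hom (I : Type) (f : I -> G) (Q : fps k I) : multipliable f -> in_Gr q Q ->
  phi (evGr q f Q) = evGr q (phi \o f) Q.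
Proof.
move=> mf; have mb := multipliable_hom mf; have [hM hX hP] := hphi.
apply: (evGr_uniq mH evH mb (F := fun Q => phi (evGr q f Q))).
- by move=> R T hR hT; rewrite (evGrMul mG evG mf hR hT) hM.
- by move=> c R hR; rewrite (evGrPow mG evG mf c hR) hX.
- by move=> J R mR hR; apply: hP; exact: (evGrProd mG evG mf mR hR).
- by move=> i; rewrite (evGrExpX mG evG mf).
Qed.

Lemma Lie_salg_hom : @salg_hom k (Lie q G) (Lie q H) phi.
Proof.
have LX (i : 'I_2) := in_LieX (k := k) i.
have pairE f g : phi \o pair2 f g = pair2 (phi f) (phi g).
  by apply: funext => i; rewrite /pair2 /=; case: ifP.
have mp (f g : G) : multipliable (pair2 f g) := multipliable_fin mG (T := 'I_2) _.
split.
- move=> f g; rewrite -[LHS]/(phi (evGr q (pair2 f g) _)) evGr_hom ?pairE //.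
  by apply: in_Gr_exp; exact: (in_LieD (LX _) (LX _)).
- by move=> c f; exact: (pgr_homX hphi).
- move=> f g; rewrite -[LHS]/(phi (evGr q (pair2 f g) _)) evGr_hom ?pairE //.
  by apply: in_Gr_exp; exact: (in_Lie_bracket (LX _) (LX _)).
- move=> I v s [mv ->]; split; first exact: multipliable_hom.
  rewrite evGr_hom //; apply: in_Gr_exp.
  by apply: in_Lie_sum (hs_sum (@summ_X k I)) => j; exact: in_LieX.
Qed.

End LieMorphisms.

(** * Mutually inverse constructions *)

Section Inverse.
Variables (k : comPzRingType) (q : {rmorphism rat -> k}).

Lemma Lie_GrK (L : salg k) : is_slie L -> has_evLie L -> Lie q (Gr q L) = L.
Proof.
move=> slieL evL.
have LX (I : Type) (i : I) := in_LieX (k := k) i.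
have eadd (a b : L) : @sa_add k (Lie q (Gr q L)) a b = sa_add a b.
  have sp : summable (pair2 a b) := summable_fin slieL (T := 'I_2) _.
  have h := in_LieD (LX _ (ord0 : 'I_2)) (LX _ ord_max).
  rewrite /= evGr_Gr //; last exact: in_Gr_exp h.
  rewrite log_exp; last exact: in_Lie_nil h.
  by rewrite (evLieD evL sp (LX _ ord0) (LX _ ord_max)) !(evLieX evL sp).
have emul (a b : L) : @sa_mul k (Lie q (Gr q L)) a b = sa_mul a b.
  have sp : summable (pair2 a b) := summable_fin slieL (T := 'I_2) _.
  have h := in_Lie_bracket (LX _ (ord0 : 'I_2)) (LX _ ord_max).
  rewrite /= evGr_Gr //; last exact: in_Gr_exp h.
  rewrite log_exp; last exact: in_Lie_nil h.
  by rewrite (evLieM evL sp (LX _ ord0) (LX _ ord_max)) !(evLieX evL sp).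
have esum (I : Type) (v : I -> L) s : @sa_sum k (Lie q (Gr q L)) I v s <-> sa_sum v s.
  have hX := hs_sum (@summ_X k I).
  have hL := in_Lie_sum (LX I) hX.
  have e (sv : summable v) : evGr q (v : I -> Gr q L) (sexp q (@series_sum k I I (fun j => sX k j))) =
      evLie v (@series_sum k I I (fun j => sX k j)).
    by rewrite evGr_Gr // ?log_exp //; [exact: in_Lie_nil hL | exact: in_Gr_exp].
  have hs (sv : summable v) : sa_sum v (evLie v (@series_sum k I I (fun j => sX k j))).
    have := evLie_sum evL sv (LX I) hX.
    by congr sa_sum; apply: funext => i; rewrite (evLieX evL sv).
  split=> [[/Gr_multipliable sv ->]|hv]; first by rewrite e //; exact: hs.
  have sv : summable v by exists s.
  split; first exact/Gr_multipliable.
  by rewrite e //; apply: (sum_fun (salg_summability (slie_salg slieL))) hv (hs sv).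
case: L slieL evL LX eadd emul esum => T z a o c m S slieL evL _ eadd emul esum.
have eadd' : @sa_add k (Lie q (Gr q (SAlg z a o c m S))) = a.
  by apply: funext => x; apply: funext => y; exact: eadd.
have emul' : @sa_mul k (Lie q (Gr q (SAlg z a o c m S))) = m.
  by apply: funext => x; apply: funext => y; exact: emul.
have esum' : @sa_sum k (Lie q (Gr q (SAlg z a o c m S))) = S.
  apply: functional_extensionality_dep => I; apply: funext => v; apply: funext => s.
  by apply: propext; exact: esum.
(* The remaining fields of [Lie q (Gr q L)] are convertible to those of [L]; only the three proved
   equal are rewritten. *)
transitivity (SAlg (k := k) (sa_car := T) z
  (@sa_add k (Lie q (Gr q (SAlg z a o c m S)))) o c
  (@sa_mul k (Lie q (Gr q (SAlg z a o c m S))))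
  (@sa_sum k (Lie q (Gr q (SAlg z a o c m S))))); first by [].
by rewrite eadd' emul' esum'.
Qed.

Lemma evLie_Lie (G : pgr k) (mG : is_multipliability G) (gG : is_expgroup G)
    (evG : has_evGr q G) (I : Type) (f : I -> G) (P : fps k I) :
  multipliable f -> in_Lie P -> @evLie k (Lie q G) I f P = evexp q f P.
Proof.
move=> mf hP; apply/esym.
have sf : @summable k (Lie q G) I f by apply/Lie_summable.
have h := @evLie_unique k (Lie q G) (Lie_has_evLie mG evG) I f sf (fun P => evexp q f P).
apply: h hP => //.
- by move=> R T hR hT; rewrite (evexpD mG evG mf).
- by move=> c R hR; rewrite (evexpZ mG evG mf).
- by move=> R T hR hT; rewrite (evexpM mG evG mf).
- by move=> J R S hR hS; exact: (evexp_sum mG evG mf hR hS).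
- by move=> i; exact: (evexpX mG evG mf).
Qed.

Lemma Gr_LieK (G : pgr k) : is_expgroup G -> is_multipliability G -> has_evGr q G ->
  Gr q (Lie q G) = G.
Proof.
move=> gG mG evG.
have gX (I : Type) (i : I) := in_Gr_expX q i.
have emul (a b : G) : @pg_mul k (Gr q (Lie q G)) a b = pg_mul a b.
  have mp : multipliable (pair2 a b) := multipliable_fin mG (T := 'I_2) _.
  have h := in_GrM (gX _ (ord0 : 'I_2)) (gX _ ord_max).
  rewrite /= evLie_Lie //; last exact: in_Lie_log h.
  rewrite /evexp exp_log; last exact: in_Gr_nil h.
  by rewrite (evGrMul mG evG mp (gX _ ord0) (gX _ ord_max)) !(evGrExpX mG evG mp).
have eprod (I : los) (g : I -> G) p : @pg_prod k (Gr q (Lie q G)) I g p <-> pg_prod g p.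
  have mX := @multipl_expX k q I; have hG := in_Gr_series_prod mX (gX I).
  have e (mg : multipliable g) : @evLie k (Lie q G) I g
      (slog q (series_prod (fun i : I => sexp q (sX k i)))) =
      evGr q g (series_prod (fun i : I => sexp q (sX k i))).
    rewrite evLie_Lie //; last exact: in_Lie_log hG.
    by rewrite /evexp exp_log //; exact: in_Gr_nil hG.
  have hp (mg : multipliable g) : pg_prod g (evGr q g (series_prod (fun i : I => sexp q (sX k i)))).
    have := evGrProd mG evG mg mX (gX I).
    by congr pg_prod; apply: funext => i; rewrite (evGrExpX mG evG mg).
  split=> [[/Lie_summable mg ->]|hg]; first by rewrite e //; exact: hp.
  have mg : multipliable g by apply/(multipliable_in_dom mG); exists p.
  split; first exact/Lie_summable.
  by rewrite e //; apply: (prod_fun mG) hg (hp mg).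
case: G gG mG evG emul eprod => T o m v w S gG mG evG emul eprod.
have emul' : @pg_mul k (Gr q (Lie q (PGr o m v w S))) = m.
  by apply: funext => x; apply: funext => y; exact: emul.
have eprod' : @pg_prod k (Gr q (Lie q (PGr o m v w S))) = S.
  apply: functional_extensionality_dep => I; apply: funext => g; apply: funext => p.
  by apply: propext; exact: eprod.
transitivity (PGr (k := k) (pg_car := T) o
  (@pg_mul k (Gr q (Lie q (PGr o m v w S)))) v w
  (@pg_prod k (Gr q (Lie q (PGr o m v w S))))); first by [].
by rewrite emul' eprod'.
Qed.

End Inverse.

(** * Equality of functors *)

Section FunctorEquality.

Lemma existT_inj2 (U : Type) (P : U -> Type) (p : U) (x y : P p) :
  existT P p x = existT P p y -> x = y.
Proof.
move=> h; have := projT2_eq h.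
by rewrite (Prop_irrelevance (projT1_eq h) erefl).
Qed.

(** The two images of an arrow live in different types until the objects are identified, so they are
    compared together with their source and target. *)
Lemma functor_eq (C D : category) (F F' : functor C D) : (forall X, F X = F' X) ->
  (forall X Y (f : arrow X Y),
    existT (fun p : D * D => arrow p.1 p.2) (F X, F Y) (farr F f) =
    existT (fun p : D * D => arrow p.1 p.2) (F' X, F' Y) (farr F' f)) ->
  F = F'.
Proof.
case: F F' => [o a aid acomp] [o' a' aid' acomp'] /= /funext eo.
subst o' => ea.
have ea' : a = a'.
  apply: functional_extensionality_dep => X; apply: functional_extensionality_dep => Y.
  by apply: funext => f; apply: (existT_inj2 (P := fun p : D * D => arrow p.1 p.2)) (ea X Y f).
subst a'; congr Functor; exact: Prop_irrelevance.
Qed.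

Variables (k : comPzRingType) (q : {rmorphism rat -> k}).

Lemma slie_ev_eq (L M : slie_ev k) : slie_data L = slie_data M -> L = M.
Proof.
case: L M => [L ax ev] [M ax' ev'] /= e; subst M.
by congr SLieEv; exact: Prop_irrelevance.
Qed.

Lemma pgr_ev_eq (G H : pgr_ev q) : pgr_data G = pgr_data H -> G = H.
Proof.
case: G H => [G a b c] [H a' b' c'] /= e; subst H.
by congr PGrEv; exact: Prop_irrelevance.
Qed.

(** The underlying maps are compared together with their function type. In the application both
    constructions keep the carrier by computation, so this condition holds by reflexivity even
    though the objects are only provably equal. *)
Lemma SigmaLie_arrow_eq (A A' B B' : SigmaLie k) (f : arrow A B) (f' : arrow A' B') :
  A = A' -> B = B' ->
  existT (fun T => T) (sa_car A -> sa_car B) (sval f) =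
  existT (fun T => T) (sa_car A' -> sa_car B') (sval f') ->
  existT (fun p : SigmaLie k * SigmaLie k => arrow p.1 p.2) (A, B) f =
  existT (fun p : SigmaLie k * SigmaLie k => arrow p.1 p.2) (A', B') f'.
Proof.
move=> eA eB; subst A' B' => e.
have h := existT_inj2 (P := fun T => T) e.
by rewrite (sval_eq h).
Qed.

Lemma PiGr_arrow_eq (A A' B B' : PiGr q) (f : arrow A B) (f' : arrow A' B') :
  A = A' -> B = B' ->
  existT (fun T => T) (pg_car A -> pg_car B) (sval f) =
  existT (fun T => T) (pg_car A' -> pg_car B') (sval f') ->
  existT (fun p : PiGr q * PiGr q => arrow p.1 p.2) (A, B) f =
  existT (fun p : PiGr q * PiGr q => arrow p.1 p.2) (A', B') f'.
Proof.
move=> eA eB; subst A' B' => e.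
have h := existT_inj2 (P := fun T => T) e.
by rewrite (sval_eq h).
Qed.

End FunctorEquality.

Theorem theorem2 (k : comPzRingType) (q : {rmorphism rat -> k}) :
  exists (wdGr : Gr_well_defined q) (wdLie : Lie_well_defined q),
    mutually_inverse (GrFunctor wdGr) (LieFunctor wdLie).
Proof.
have wdGr : Gr_well_defined q.
  split.
  - by case=> L ax ev; exact: Gr_expgroup_axioms.
  - by case=> L ax ev; exact: Gr_multipliability_axioms.
  - by case=> L ax ev; exact: Gr_has_evGr.
  - by case=> L ax ev [M ax' ev'] phi h; exact: Gr_pgr_hom.
have wdLie : Lie_well_defined q.
  split.
  - by case=> G a b c; exact: Lie_slie_axioms.
  - by case=> G a b c; exact: Lie_has_evLie.
  - by case=> G a b c [H a' b' c'] phi h; exact: Lie_salg_hom.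
exists wdGr, wdLie; split; apply: functor_eq.
- by case=> L ax ev; apply: slie_ev_eq; exact: Lie_GrK.
- move=> X Y f; apply: SigmaLie_arrow_eq; last by [].
  + by apply: slie_ev_eq; exact: (Lie_GrK q (slie_ax X) (@slie_has_ev _ X)).
  + by apply: slie_ev_eq; exact: (Lie_GrK q (slie_ax Y) (@slie_has_ev _ Y)).
- by case=> G a b c; apply: pgr_ev_eq; exact: Gr_LieK.
- move=> X Y f; apply: PiGr_arrow_eq; last by [].
  + by apply: pgr_ev_eq; exact: (Gr_LieK (pgr_expgroup X) (pgr_multipliability X) (@pgr_has_ev _ _ X)).
  + by apply: pgr_ev_eq; exact: (Gr_LieK (pgr_expgroup Y) (pgr_multipliability Y) (@pgr_has_ev _ _ Y)).
Qed.
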